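(* Let $F'/F$ be unramified of degree $f$, $V$ an $F'$-vector space of dimension $n$, $G=R_{F'/F}(\mathrm{GL}(V))$, fix integers $0\le r_j\le n$ ($j\in\mathbf Z/f\mathbf Z$), let $\boldsymbol\mu=(\omega_{r_j})_{j}$, and let $b\in G(L)$. Then: (i) for every non-empty $\bar I\subset\mathbf Z/n\mathbf Z$, $X(\boldsymbol\mu,b)_{\bar I}\neq\emptyset$ if and only if $[b]\in B(G,\boldsymbol\mu)$; (ii) for all non-empty $\bar J\subset\bar I\subset\mathbf Z/n\mathbf Z$, the forgetful map $X(\boldsymbol\mu,b)_{\bar I}\to X(\boldsymbol\mu,b)_{\bar J}$ is surjective.
   Context: $F$ finite over $\mathbf Q_p$ with uniformizer $\pi$, $L$ the completion of its maximal unramified extension, $O_L$ its integers, $\mathbf F$ the residue field of $O_L$, $\sigma$ the Frobenius of $L/F$. Fix $F'\subset L$; $V\otimes_FL=\bigoplus_{j\in\mathbf Z/f\mathbf Z}N_j$, $N_j=\{v:(x\otimes1)v=(1\otimes\sigma^{-j}(x))v\ \forall x\in F'\}$, each of dimension $n$ over $L$. For $b\in G(L)=\mathrm{Aut}_{F'\otimes L}(V\otimes_FL)$, $F=b(\mathrm{id}_V\otimes\sigma)$ is $\sigma$-linear with $F(N_{j-1})=N_j$. $\omega_r=(1^r,0^{n-r})$. For non-empty $\bar I\subset\mathbf Z/n\mathbf Z$ with inverse image $I\subset\mathbf Z$, a periodic lattice chain of type $\bar I$ in an $n$-dimensional $L$-space is a family of $O_L$-lattices $(M^i)_{i\in I}$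 with $M^i\subset M^{i'}$, $\mathrm{length}(M^{i'}/M^i)=i'-i$ for $i<i'$ in $I$, and $M^{i+n}=\pi^{-1}M^i$. $X(\boldsymbol\mu,b)_{\bar I}$ is the set of families $(\tilde M^i_j)_{i\in I,j\in\mathbf Z/f\mathbf Z}$ such that for each $j$, $(\tilde M^i_j)_{i\in I}$ is a periodic lattice chain of type $\bar I$ in $N_j$, and $\tilde M^i_j\supset F\tilde M^i_{j-1}\supset\pi\tilde M^i_j$ with $\dim_{\mathbf F}\tilde M^i_j/F\tilde M^i_{j-1}=r_j$ for all $i,j$. The forgetful map restricts indices from $I$ to $J$. $B(G,\boldsymbol\mu)$ is Kottwitz's set of $\sigma$-conjugacy classes defined by the group-theoretic Mazur inequality; $[b]\in B(G,\boldsymbol\mu)$ iff the slope vector of the $\sigma^f$-linear isocrystal $(N_0,F^f)$ (slopes with $\mathrm{val}(\pi)=1$) is $\le\sum_j\omega_{r_j}$ in the dominance order. *)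

(* Defs.v *)
From HB Require Import structures.
From mathcomp Require Import all_boot all_order all_algebra.
Set Implicit Arguments. Unset Strict Implicit. Unset Printing Implicit Defensive.
Import Order.TTheory GRing.Theory Num.Theory.
Local Open Scope ring_scope.

Section Defs.
Variables (L : fieldType) (v : L -> int).

Definition ge_val (x : L) (k : int) : bool := (x == 0) || (k <= v x).
Definition intg (x : L) : bool := ge_val x 0.

(* Standing hypotheses characterizing (L, val, pi, sigma) as the completion of the
   maximal unramified extension of a finite extension F of Q_p with uniformizer pi,
   normalized valuation val(pi)=1, and sigma the Frobenius of L/F (F = fixed field of
   sigma, residue field of F = F_q with q = p^a). *)
Definition local_setup (sigma : {rmorphism L -> L}) (pi : L) (p a : nat) : Prop :=
  [/\
      (forall x y, x != 0 -> y != 0 -> v (x * y) = v x + v y) /\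
      (forall x y, x != 0 -> y != 0 -> x + y != 0 -> Num.min (v x) (v y) <= v (x + y)) /\
      (pi != 0 /\ v pi = 1),
      (forall u : nat -> L,
         (forall k : int, exists N, forall m m', (N <= m)%N -> (N <= m')%N ->
              ge_val (u m - u m') k) ->
         exists l, forall k : int, exists N, forall m, (N <= m)%N -> ge_val (u m - l) k),
      ((forall m : nat, (0 < m)%N -> (m%:R : L) != 0) /\ prime p /\ ge_val (p%:R) 1) /\
      (* residue field is an algebraic closure of F_p *)
      ((forall x, intg x -> exists m, (0 < m)%N /\ ge_val (x ^+ (p ^ m) - x) 1) /\
      (forall P : {poly L}, P \is monic -> (1 < size P)%N -> (forall i, intg P`_i) ->
         exists x, intg x /\ ge_val P.[x] 1)) &
      (* sigma: Frobenius of L over F = Fix(sigma), q = p^a, pi in F *)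
      [/\ (0 < a)%N, bijective sigma, (forall x, x != 0 -> v (sigma x) = v x),
          (forall x, intg x -> ge_val (sigma x - x ^+ (p ^ a)) 1) & sigma pi = pi]].

Variable n : nat.
Definition lset := 'rV[L]_n -> Prop.

Definition intg_row (c : 'rV[L]_n) : Prop := forall k, intg (c 0 k).
Definition ospan (A : 'M[L]_n) : lset := fun x => exists c, intg_row c /\ x = c *m A.
Definition is_lattice (M : lset) : Prop :=
  exists A, A \in unitmx /\ forall x, M x <-> ospan A x.
Definition lsub (M M' : lset) : Prop := forall x, M x -> M' x.
Definition img (g : 'rV[L]_n -> 'rV[L]_n) (M : lset) : lset :=
  fun y => exists x, M x /\ y = g x.
Definition scl (c : L) (M : lset) : lset := img (fun x => c *: x) M.

(* for lattices M \subset M', lat_len M M' k means length_{O_L}(M'/M) = k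
   (computed as val det of bases, independent of the chosen bases) *)
Definition lat_len (M M' : lset) (k : int) : Prop :=
  exists A A', [/\ A \in unitmx, A' \in unitmx, (forall x, M x <-> ospan A x),
                   (forall x, M' x <-> ospan A' x) & k = v (\det A) - v (\det A')].

Definition inI (Ib : {set 'I_n}) (i : int) : Prop :=
  exists2 k : 'I_n, k \in Ib & (i %% n%:Z)%Z = (k : nat)%:Z.

Definition periodic_chain (pi : L) (Ib : {set 'I_n}) (M : int -> lset) : Prop :=
  [/\ forall i, inI Ib i -> is_lattice (M i),
      forall i i', inI Ib i -> inI Ib i' -> i < i' ->
         lsub (M i) (M i') /\ lat_len (M i) (M i') (i' - i)
    & forall i, inI Ib i -> forall x, M (i + n%:Z) x <-> scl pi^-1 (M i) x].

(* coordinates: N_j = L^n via an F'-basis of V, so id (x) sigma : N_{j-1} -> N_j is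
   entrywise sigma, and F = b (id (x) sigma) restricted to N_{j-1} is
   x |-> sigma(x) *m B_j with B_j in GL_n(L) the j-component of b. *)
Definition Fmap (sigma : {rmorphism L -> L}) (Bj : 'M[L]_n) (x : 'rV[L]_n) : 'rV[L]_n :=
  map_mx sigma x *m Bj.

Variable f : nat.

Definition Xset (sigma : {rmorphism L -> L}) (pi : L) (r : 'I_f -> nat)
  (B : 'I_f -> 'M[L]_n) (Ib : {set 'I_n}) (Mt : int -> 'I_f -> lset) : Prop :=
  (forall j, periodic_chain pi Ib (fun i => Mt i j)) /\
  (forall i, inI Ib i -> forall j : 'I_f,
     let FM := img (Fmap sigma (B j)) (Mt i (ord_pred j)) in
     [/\ lsub FM (Mt i j), lsub (scl pi (Mt i j)) FM & lat_len FM (Mt i j) (r j)%:Z]).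

(* Phi = F^f on N_{j0} *)
Definition Phi (sigma : {rmorphism L -> L}) (B : 'I_f -> 'M[L]_n) (j0 : 'I_f)
  (x : 'rV[L]_n) : 'rV[L]_n :=
  (iter f (fun pr => (Fmap sigma (B (ordS pr.2)) pr.1, ordS pr.2)) (x, j0)).1.

(* nu : 'I_n -> rat is the (nonincreasing) slope vector of the isocrystal (L^n, Ph):
   there is a basis (rows of P) such that, for every rational lambda = a/s (lowest
   terms, s>0), the span W_lambda of the basis vectors k with nu k = lambda is
   Ph-stable and its O_L-lattice Lam spanned by the same vectors satisfies
   Ph^s(Lam) = pi^a Lam (Dieudonne-Manin decomposition into isoclinic parts). *)
Definition slope_vector (pi : L) (Ph : 'rV[L]_n -> 'rV[L]_n) (nu : 'I_n -> rat) : Prop :=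
  (forall i j : 'I_n, (i <= j)%N -> nu j <= nu i) /\
  exists P : 'M[L]_n, P \in unitmx /\
    forall lam : rat,
      let W : lset := fun x => exists c : 'rV[L]_n,
            (forall k, nu k != lam -> c 0 k = 0) /\ x = c *m P in
      let Lam : lset := fun x => exists c : 'rV[L]_n,
            [/\ intg_row c, (forall k, nu k != lam -> c 0 k = 0) & x = c *m P] in
      (forall x, W x -> W (Ph x)) /\
      (forall y, img (iter `|denq lam|%N Ph) Lam y <-> scl (pi ^ numq lam) Lam y).

(* mu = sum_j omega_{r_j}; its (0-indexed) i-th component is #{j | i < r_j} *)
Definition mu_sum (r : 'I_f -> nat) (i : 'I_n) : rat :=
  \sum_(j < f) ((i < r j)%N)%:R.

Definition dominated (nu mu : 'I_n -> rat) : Prop :=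
  (forall k : nat, (k <= n)%N ->
     \sum_(i < n | (i < k)%N) nu i <= \sum_(i < n | (i < k)%N) mu i) /\
  \sum_(i < n) nu i = \sum_(i < n) mu i.

Definition in_BGmu (sigma : {rmorphism L -> L}) (pi : L) (r : 'I_f -> nat)
  (B : 'I_f -> 'M[L]_n) (j0 : 'I_f) : Prop :=
  exists nu, slope_vector pi (Phi sigma B j0) nu /\ dominated nu (mu_sum r).

End Defs.

(* Main.v *)
(**
  (ii) reduces to inserting one lattice between two consecutive members of a chain.
  The quotients of these members carry, over the residue field, maps [F] and
  [V = pi F^-1] with [F V = V F = 0], and the task is to choose in each of the [f]
  quotients a line so that consecutive lines are compatible with [F] and [V].  Follow a
  line forward by [V^-1] where [V] is bijective and by [F] elsewhere.  Either some line
  is killed, and the free choice made there lets the family close up, or the composite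
  around the cycle is bijective and semilinear, and Lang's theorem gives an invariant
  line.  Hence (i) only concerns a single lattice in each [N_j].

  Let [Phi = F^f] act on [N_0].  Cyclic vectors and a Fitting argument decompose
  [(N_0, Phi)] into isoclinic parts.  Given a family of lattices, bases adapted to this
  decomposition bound the partial sums of the slopes at each breakpoint by
  [\sum_j min (k, r_j)]; concavity of the bound in [k] covers the other [k].
  Conversely, a part of slope [lam] has a lattice on which the elementary divisors of
  [Phi] are [floor lam] and [ceil lam], so that dominance by [\sum_j omega_(r_j)] passes
  from the slopes to the elementary divisors.  By Gale-Ryser these are the row sums of
  a 0/1 matrix with column sums [r_j], and the columns give the intermediate lattices.
*)
Require Import Defs.
From HB Require Import structures.
From mathcomp Require Import all_boot all_order all_algebra.
From mathcomp Require Import fingroup perm generic_quotient ring_quotient.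
From mathcomp Require Import zify lra.
From Stdlib Require Import Classical.
Set Implicit Arguments. Unset Strict Implicit. Unset Printing Implicit Defensive.
Import Order.TTheory GRing.Theory Num.Theory.
Local Open Scope ring_scope.

(** Everything is computed with matrices acting on row vectors: a lattice is the row span of an
    invertible matrix up to left multiplication by [GL(O)], a semilinear map is [x |-> t(x) G], and
    a length is a difference of valuations of determinants.

    Slopes are fractions whereas valuations are integers. No root of the uniformizer is adjoined:
    slope [a / s] is expressed by integrality of [pi^(-a) Phi^s]. Hence the iterates [t^s] and the
    pairs [(s, a)], not necessarily in lowest terms, that are carried along.

    Membership in [B(G, mu)] asks for a slope vector, so the isoclinic decomposition must be
    constructed even to prove the necessity of the inequality. The part of smallest slope is
    separated: Newton polygons of the relations of cyclic vectors give that slope, a rounding of the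
    associated norm gives a lattice, and there the scaled iterate is integral but not nilpotent
    modulo [pi]. Completeness then splits off its bijective part, by solving two matrix equations
    with contractions. *)

(** * Valuations and the residue field *)

Section Valuation.
Variables (L : fieldType) (v : L -> int).
Hypothesis vM : forall x y : L, x != 0 -> y != 0 -> v (x * y) = v x + v y.

Lemma vvalone : v 1 = 0.
Proof.
have e : v 1 = v 1 + v 1 by rewrite -vM ?oner_neq0 // mulr1.
lia.
Qed.

Lemma vvalN (x : L) : x != 0 -> v (- x) = v x.
Proof.
have N1 : (-1 : L) != 0 by rewrite oppr_eq0 oner_neq0.
have e : v (-1) + v (-1) = 0 by rewrite -vM // mulrNN mulr1 vvalone.
move=> nx; have -> : v (- x) = v (-1) + v x by rewrite -vM // mulN1r.
lia.
Qed.

Lemma vvalV (x : L) : x != 0 -> v x^-1 = - v x.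
Proof.
move=> nx; have nxi : x^-1 != 0 by rewrite invr_eq0.
have e : v x + v x^-1 = 0 by rewrite -vM // mulfV // vvalone.
lia.
Qed.

Lemma vvalX (x : L) (k : nat) : x != 0 -> v (x ^+ k) = v x *+ k.
Proof.
move=> nx; elim: k => [|k IH]; first by rewrite expr0 mulr0n vvalone.
by rewrite exprS vM ?expf_neq0 // IH mulrS.
Qed.

Lemma vvalXz (pi : L) (k : int) : pi != 0 -> v pi = 1 -> v (pi ^ k) = k.
Proof.
move=> pi0 vpi.
case: k => k; first by rewrite -exprnP vvalX // vpi; lia.
by rewrite -[pi ^ _]/(pi ^- k.+1) vvalV ?expf_neq0 // vvalX // vpi; lia.
Qed.

Hypothesis vD : forall x y : L, x != 0 -> y != 0 -> x + y != 0 ->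
  Num.min (v x) (v y) <= v (x + y).

Lemma ge_val0 k : ge_val v 0 k.
Proof. by rewrite /ge_val eqxx. Qed.

Lemma ge_valN x k : ge_val v (- x) k = ge_val v x k.
Proof. by rewrite /ge_val oppr_eq0; case: eqP => //= /eqP nx; rewrite vvalN. Qed.

Lemma ge_valD x y k : ge_val v x k -> ge_val v y k -> ge_val v (x + y) k.
Proof.
rewrite /ge_val; have [->|nx] /= := eqVneq x 0; first by rewrite add0r.
have [->|ny] /= := eqVneq y 0; first by rewrite addr0 (negPf nx).
have [//|nxy] /= := eqVneq (x + y) 0.
by move=> kx ky; apply: le_trans (vD nx ny nxy); rewrite le_min kx.
Qed.

Lemma ge_valM x y k l : ge_val v x k -> ge_val v y l -> ge_val v (x * y) (k + l).
Proof.
rewrite /ge_val mulf_eq0; have [//|nx] /= := eqVneq x 0.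
by have [//|ny] /= := eqVneq y 0; rewrite vM //; apply: lerD.
Qed.

Lemma ge_valW x k l : l <= k -> ge_val v x k -> ge_val v x l.
Proof. by move=> lk; rewrite /ge_val; case: eqP => //= _; apply: le_trans. Qed.

Lemma intg1 : intg v 1.
Proof. by rewrite /intg /ge_val vvalone lexx orbT. Qed.

Lemma intg0 : intg v 0.
Proof. exact: ge_val0. Qed.

Lemma intgM x y : intg v x -> intg v y -> intg v (x * y).
Proof. by move=> hx hy; rewrite /intg -[0]addr0 ge_valM. Qed.

Lemma intgD x y : intg v x -> intg v y -> intg v (x + y).
Proof. exact: ge_valD. Qed.

Lemma intgN x : intg v (- x) = intg v x.
Proof. exact: ge_valN. Qed.

Lemma not_ge_val1 x : intg v x -> ~~ ge_val v x 1 -> x != 0 /\ v x = 0.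
Proof.
rewrite /intg /ge_val; have [//|nx] /= := eqVneq x 0.
by move=> ? ?; split=> //; lia.
Qed.

Section ResidueField.

Definition oring := {x : L | intg v x}.
HB.instance Definition _ := Choice.on oring.

Fact intg_subring : subring_closed (intg v : {pred L}).
Proof.
split; first exact: intg1.
  by move=> x y hx hy; apply: intgD => //; rewrite intgN.
by move=> x y; apply: intgM.
Qed.
HB.instance Definition _ := GRing.isSubringClosed.Build L (intg v) intg_subring.
HB.instance Definition _ := SubChoice.on oring.
HB.instance Definition _ := [SubChoice_isSubComNzRing of oring by <:].

Definition maxideal (x : oring) : bool := ge_val v (val x) 1.

Fact maxideal_closed : idealr_closed (maxideal : {pred oring}).
Proof.
split; rewrite ?unfold_in /maxideal /=.
- exact: ge_val0.
- by rewrite /ge_val oner_eq0 /= vvalone.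
move=> x y z; rewrite !unfold_in /= => hy hz; apply: ge_valD => //.
by rewrite -[1]add0r; apply: ge_valM (valP x) hy.
Qed.
HB.instance Definition _ := isIdealr.Build oring maxideal maxideal_closed.

Definition mideal : idealr oring := maxideal.
Definition rquot := {ideal_quot mideal}.
HB.instance Definition _ := GRing.ComNzRing.on rquot.

(** Non-integral elements go to 0, which makes the residue map a total function on the field. *)
Definition toO (x : L) : oring := insubd 0 x.

Lemma val_toO x : intg v x -> val (toO x) = x.
Proof. by move=> hx; rewrite /toO val_insubd hx. Qed.

Definition rmap (x : L) : rquot := (\pi_rquot (toO x))%qT.

Definition rrep (t : rquot) : L := val (repr t).

Definition rinv (t : rquot) : rquot := if t == 0 then 0 else rmap (rrep t)^-1.

Lemma rmap_eq x y : intg v x -> intg v y -> (rmap x == rmap y) = ge_val v (x - y) 1.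
Proof.
move=> hx hy; rewrite /rmap -Quotient.idealrBE unfold_in /maxideal /=.
by rewrite !val_toO.
Qed.

Lemma rrepK t : rmap (rrep t) = t.
Proof. by rewrite /rmap /rrep /toO valKd reprK. Qed.

Lemma rrep_intg t : intg v (rrep t).
Proof. exact: valP (repr t). Qed.

Lemma rmapD x y : intg v x -> intg v y -> rmap (x + y) = rmap x + rmap y.
Proof.
move=> hx hy; rewrite /rmap -pi_addr; congr ((\pi_rquot _)%qT).
by apply: val_inj; rewrite /= !val_toO // intgD.
Qed.

Lemma rmapM x y : intg v x -> intg v y -> rmap (x * y) = rmap x * rmap y.
Proof.
move=> hx hy; rewrite /rmap -pi_mulr; congr ((\pi_rquot _)%qT).
by apply: val_inj; rewrite /= !val_toO // intgM.
Qed.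

Lemma rmap1 : rmap 1 = 1.
Proof.
rewrite -(@pi_oner _ _ _ _ _ _ _ rquot); congr ((\pi_rquot _)%qT).
by apply: val_inj; rewrite /= val_toO ?intg1.
Qed.

Lemma rmap0 : rmap 0 = 0.
Proof. by apply: (addrI (rmap 0)); rewrite -rmapD ?intg0 // !addr0. Qed.

Lemma rmap_eq0 x : intg v x -> (rmap x == 0) = ge_val v x 1.
Proof. by move=> hx; rewrite -rmap0 rmap_eq ?intg0 // subr0. Qed.

Fact rinvP t : t != 0 -> rinv t * t = 1.
Proof.
move=> nt; rewrite /rinv (negPf nt).
have hr := rrep_intg t.
have [nr vr] : rrep t != 0 /\ v (rrep t) = 0.
  by apply: not_ge_val1 => //; rewrite -rmap_eq0 // rrepK.
have hi : intg v (rrep t)^-1 by rewrite /intg /ge_val vvalV // vr oppr0 lexx orbT.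
by rewrite -{2}[t]rrepK -rmapM // mulVf // rmap1.
Qed.

Fact rinv0 : rinv 0 = 0.
Proof. by rewrite /rinv eqxx. Qed.

HB.instance Definition _ := GRing.ComNzRing_isField.Build rquot rinvP rinv0.

Definition rquot_field : fieldType := rquot.

End ResidueField.

(** The residue field is exported only through its residue map and a set-theoretic section; the
    ideal quotient stays hidden. *)
Lemma residue_field_exists : exists (k : fieldType) (res : L -> k) (lft : k -> L),
  [/\ forall x y, intg v x -> intg v y -> res (x + y) = res x + res y,
      forall x y, intg v x -> intg v y -> res (x * y) = res x * res y,
      res 1 = 1,
      forall x, intg v x -> (res x == 0) = ge_val v x 1 &
      forall t, intg v (lft t) /\ res (lft t) = t].
Proof.
exists rquot_field, rmap, rrep; split.
- exact: rmapD.
- exact: rmapM.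
- exact: rmap1.
- exact: rmap_eq0.
- by move=> t; rewrite rrepK; split=> //; exact: rrep_intg.
Qed.
End Valuation.

(** Residue map and section are bundled as data, so that reduction is an entrywise function on
    matrices and every residue matrix has a chosen lift. [res] is meaningful on integral elements
    only, and [lft] need not be additive. *)
Structure dvr := Dvr {
  dvr_field :> fieldType;
  dval : dvr_field -> int;
  unif : dvr_field;
  rfield : fieldType;
  res : dvr_field -> rfield;
  lft : rfield -> dvr_field;
  dvalM : forall x y : dvr_field, x != 0 -> y != 0 -> dval (x * y) = dval x + dval y;
  dvalD : forall x y : dvr_field, x != 0 -> y != 0 -> x + y != 0 ->
    Num.min (dval x) (dval y) <= dval (x + y);
  unif_neq0 : unif != 0;
  dval_unif : dval unif = 1;
  dvr_complete : forall u : nat -> dvr_field,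
    (forall k : int, exists N, forall m m', (N <= m)%N -> (N <= m')%N ->
       ge_val dval (u m - u m') k) ->
    exists l, forall k : int, exists N, forall m, (N <= m)%N -> ge_val dval (u m - l) k;
  resD : forall x y, ge_val dval x 0 -> ge_val dval y 0 -> res (x + y) = res x + res y;
  resM : forall x y, ge_val dval x 0 -> ge_val dval y 0 -> res (x * y) = res x * res y;
  res1 : res 1 = 1;
  res_eq0 : forall x, ge_val dval x 0 -> (res x == 0) = ge_val dval x 1;
  lft_intg : forall t, ge_val dval (lft t) 0;
  lftK : forall t, res (lft t) = t }.

(** * Integral matrices and their reduction *)

Section IntegralMatrices.
Variable S : dvr.
Local Notation L := (dvr_field S).
Local Notation v := (@dval S).
Local Notation pi := (unif S).
Local Notation ge x k := (ge_val v x k).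

Lemma dval1 : v 1 = 0.
Proof. exact: vvalone (@dvalM S). Qed.

Lemma dvalN (x : L) : x != 0 -> v (- x) = v x.
Proof. by move=> nx; apply: (vvalN (@dvalM S)). Qed.

Lemma dvalV (x : L) : x != 0 -> v x^-1 = - v x.
Proof. by move=> nx; apply: (vvalV (@dvalM S)). Qed.

Lemma dvalX (x : L) k : x != 0 -> v (x ^+ k) = v x *+ k.
Proof. by move=> nx; apply: (vvalX (@dvalM S)). Qed.

Lemma unifz_neq0 k : pi ^ k != 0.
Proof. by rewrite expfz_neq0 // unif_neq0. Qed.
Hint Resolve unifz_neq0 : core.

Lemma dval_unifz k : v (pi ^ k) = k.
Proof. by apply: (vvalXz (@dvalM S)); rewrite ?unif_neq0 ?dval_unif. Qed.

Lemma ge0 k : ge 0 k.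
Proof. exact: ge_val0. Qed.
Hint Resolve ge0 : core.

Lemma geN x k : ge (- x) k = ge x k.
Proof. exact: (ge_valN (@dvalM S)). Qed.

Lemma geD x y k : ge x k -> ge y k -> ge (x + y) k.
Proof. exact: (ge_valD (@dvalD S)). Qed.

Lemma geB x y k : ge x k -> ge y k -> ge (x - y) k.
Proof. by move=> hx hy; apply: geD => //; rewrite geN. Qed.

Lemma geM x y k l : ge x k -> ge y l -> ge (x * y) (k + l).
Proof. exact: (ge_valM (@dvalM S)). Qed.

Lemma geW k l x : l <= k -> ge x k -> ge x l.
Proof. exact: ge_valW. Qed.

Lemma ge1 : ge 1 0.
Proof. exact: intg1 (@dvalM S). Qed.
Hint Resolve ge1 : core.

Lemma ge_unifz k : ge (pi ^ k) k.
Proof. by rewrite /ge_val dval_unifz lexx orbT. Qed.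
Hint Resolve ge_unifz : core.

Lemma ge_neq0 x k : x != 0 -> ge x k = (k <= v x).
Proof. by rewrite /ge_val => /negPf ->. Qed.

Lemma ge_unifM x k l : ge (pi ^ l * x) k = ge x (k - l).
Proof.
apply/idP/idP => h.
  have := geM (ge_unifz (- l)) h.
  by rewrite mulrA -expfzDr ?unif_neq0 // addNr expr0z mul1r addrC.
by have := geM (ge_unifz l) h; rewrite addrC subrK.
Qed.

Lemma ge_all0 x : (forall k, ge x k) -> x = 0.
Proof.
move=> h; apply/eqP; have := h (v x + 1); rewrite /ge_val; case: eqP => //= _.
by move=> hh; exfalso; move: hh; lia.
Qed.

Lemma ge_sum (I : Type) (r : seq I) (P : pred I) (F : I -> L) k :
  (forall i, P i -> ge (F i) k) -> ge (\sum_(i <- r | P i) F i) k.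
Proof.
by move=> h; elim/big_rec: _ => // i x Pi hx; apply: geD => //; apply: h.
Qed.

Lemma ge_prod (I : Type) (r : seq I) (P : pred I) (F : I -> L) :
  (forall i, P i -> ge (F i) 0) -> ge (\prod_(i <- r | P i) F i) 0.
Proof.
move=> h; elim/big_rec: _ => // i x Pi hx.
by rewrite -[0]addr0; apply: geM => //; apply: h.
Qed.

Lemma geX x k : ge x 0 -> ge (x ^+ k) 0.
Proof.
move=> hx; elim: k => [|k IH]; first by rewrite expr0.
by rewrite exprS -[0]addr0; apply: geM.
Qed.

Lemma intg_unit x : x != 0 -> v x = 0 -> ge x 0 /\ ge x^-1 0.
Proof.
move=> nx vx; rewrite !ge_neq0 ?invr_eq0 // dvalV // vx.
by [].
Qed.

Lemma unit_intg x : x != 0 -> ge x 0 -> ge x^-1 0 -> v x = 0.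
Proof.
move=> nx; rewrite !ge_neq0 ?invr_eq0 // dvalV //.
move: (v x) => z; lia.
Qed.

Lemma res0 : res (0 : L) = 0.
Proof. by apply: (addrI (res 0)); rewrite -resD // !addr0. Qed.

Lemma resN x : ge x 0 -> res (- x) = - res x.
Proof.
by move=> hx; apply: (addrI (res x)); rewrite -resD // ?subrr ?res0 // geN.
Qed.

Lemma resB x y : ge x 0 -> ge y 0 -> res (x - y) = res x - res y.
Proof. by move=> hx hy; rewrite resD ?resN // geN. Qed.

Lemma res_eq x y : ge x 0 -> ge y 0 -> (res x == res y) = ge (x - y) 1.
Proof. by move=> hx hy; rewrite -subr_eq0 -resB // res_eq0 // geB. Qed.

Lemma res_sum (I : Type) (r : seq I) (P : pred I) (F : I -> L) :
  (forall i, P i -> ge (F i) 0) ->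
  res (\sum_(i <- r | P i) F i) = \sum_(i <- r | P i) res (F i).
Proof.
move=> h; elim: r => [|a r IH]; first by rewrite !big_nil res0.
rewrite !big_cons; case: ifP => // Pa; rewrite resD ?IH //; first exact: h.
exact: ge_sum.
Qed.

Lemma res_prod (I : Type) (r : seq I) (P : pred I) (F : I -> L) :
  (forall i, P i -> ge (F i) 0) ->
  res (\prod_(i <- r | P i) F i) = \prod_(i <- r | P i) res (F i).
Proof.
move=> h; elim: r => [|a r IH]; first by rewrite !big_nil res1.
rewrite !big_cons; case: ifP => // Pa; rewrite resM ?IH //; first exact: h.
exact: ge_prod.
Qed.

Lemma res_neq0 x : ge x 0 -> res x != 0 -> x != 0 /\ v x = 0.
Proof. by move=> hx; rewrite res_eq0 // => /(not_ge_val1 hx). Qed.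

Definition gem m n (A : 'M[L]_(m, n)) (k : int) : Prop := forall i j, ge (A i j) k.
Local Notation intm A := (gem A 0).
Definition resm m n (A : 'M[L]_(m, n)) : 'M[rfield S]_(m, n) := map_mx (@res S) A.

Lemma gem0 m n k : gem (0 : 'M_(m, n)) k.
Proof. by move=> i j; rewrite mxE. Qed.

Lemma gemD m n (A B : 'M_(m, n)) k : gem A k -> gem B k -> gem (A + B) k.
Proof. by move=> hA hB i j; rewrite mxE geD. Qed.

Lemma gemN m n (A : 'M_(m, n)) k : gem A k -> gem (- A) k.
Proof. by move=> hA i j; rewrite mxE geN. Qed.

Lemma gemB m n (A B : 'M_(m, n)) k : gem A k -> gem B k -> gem (A - B) k.
Proof. by move=> hA hB; apply: gemD => //; apply: gemN. Qed.

Lemma gemM m n p (A : 'M_(m, n)) (B : 'M_(n, p)) k l :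
  gem A k -> gem B l -> gem (A *m B) (k + l).
Proof. by move=> hA hB i j; rewrite mxE; apply: ge_sum => q _; apply: geM. Qed.

Lemma intmM m n p (A : 'M_(m, n)) (B : 'M_(n, p)) k : intm A -> gem B k -> gem (A *m B) k.
Proof. by move=> hA hB; rewrite -[k]add0r; apply: gemM. Qed.

Lemma gemMint m n p (A : 'M_(m, n)) (B : 'M_(n, p)) k : gem A k -> intm B -> gem (A *m B) k.
Proof. by move=> hA hB; rewrite -[k]addr0; apply: gemM. Qed.

Lemma gemW m n (A : 'M_(m, n)) k l : l <= k -> gem A k -> gem A l.
Proof. by move=> lk hA i j; apply: geW lk _. Qed.

Lemma gemZ m n (A : 'M_(m, n)) c k l : ge c k -> gem A l -> gem (c *: A) (k + l).
Proof. by move=> hc hA i j; rewrite mxE geM. Qed.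

Lemma gem_unifZ m n (A : 'M_(m, n)) k l : gem (pi ^ l *: A) k <-> gem A (k - l).
Proof. by split=> h i j; have := h i j; rewrite mxE ge_unifM. Qed.

Lemma gem_scalar n c k : ge c k -> gem (c%:M : 'M_n) k.
Proof. by move=> hc i j; rewrite mxE; case: eqP. Qed.

Lemma intm1 n : intm (1%:M : 'M_n).
Proof. exact: gem_scalar. Qed.

Lemma gem_all0 m n (A : 'M_(m, n)) : (forall k, gem A k) -> A = 0.
Proof. by move=> h; apply/matrixP => i j; rewrite mxE; apply: ge_all0 => k; apply: h. Qed.

Lemma gem_exists m n (A : 'M_(m, n)) : exists k : int, k <= 0 /\ gem A k.
Proof.
exists (- \sum_i \sum_j `|v (A i j)|); split.
  by rewrite oppr_le0; apply: sumr_ge0 => i _; apply: sumr_ge0.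
move=> i j; have [->//|nA] := eqVneq (A i j) 0; rewrite ge_neq0 //.
rewrite lerNl; apply: le_trans (_ : `|v (A i j)| <= _); first by rewrite -normrN ler_norm.
rewrite (bigD1 i) //= (bigD1 j) //= -addrA lerDl addr_ge0 ?sumr_ge0 // => k _.
by apply: sumr_ge0.
Qed.

Lemma gem_block m1 m2 n1 n2 (A : 'M_(m1, n1)) (B : 'M_(m1, n2)) (C : 'M_(m2, n1))
    (D : 'M_(m2, n2)) k :
  gem (block_mx A B C D) k <-> [/\ gem A k, gem B k, gem C k & gem D k].
Proof.
split=> [h|[hA hB hC hD] i j].
  split=> i j.
  - by have := h (lshift _ i) (lshift _ j); rewrite block_mxEul.
  - by have := h (lshift _ i) (rshift _ j); rewrite block_mxEur.
  - by have := h (rshift _ i) (lshift _ j); rewrite block_mxEdl.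
  - by have := h (rshift _ i) (rshift _ j); rewrite block_mxEdr.
rewrite -(splitK i) -(splitK j); case: (split i) => a; case: (split j) => b /=.
- by rewrite block_mxEul.
- by rewrite block_mxEur.
- by rewrite block_mxEdl.
- by rewrite block_mxEdr.
Qed.

Lemma det_intg n (A : 'M_n) : intm A -> ge (\det A) 0.
Proof.
move=> hA; apply: ge_sum => s _; rewrite -[0]addr0; apply: geM.
  by case: (perm.odd_perm s); rewrite ?expr0 ?expr1 ?geN.
by apply: ge_prod.
Qed.

Lemma adj_intm n (A : 'M_n) : intm A -> intm (\adj A).
Proof.
move=> hA i j; rewrite mxE /cofactor -[0]addr0; apply: geM.
  rewrite -signr_odd; case: (odd _); rewrite ?expr0 ?expr1 ?geN //.
by apply: det_intg => a b; rewrite !mxE.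
Qed.

Lemma resmM m n p (A : 'M_(m, n)) (B : 'M_(n, p)) :
  intm A -> intm B -> resm (A *m B) = resm A *m resm B.
Proof.
move=> hA hB; apply/matrixP => i j; rewrite !mxE res_sum.
  by apply: eq_bigr => k _; rewrite resM ?mxE //.
by move=> k _; rewrite -[0]addr0; apply: geM.
Qed.

Lemma resmD m n (A B : 'M_(m, n)) : intm A -> intm B -> resm (A + B) = resm A + resm B.
Proof.
by move=> hA hB; apply/matrixP => i j; rewrite !mxE resD //.
Qed.

Lemma resm1 n : resm (1%:M : 'M_n) = 1%:M.
Proof. by apply/matrixP => i j; rewrite !mxE; case: eqP; rewrite ?res1 ?res0. Qed.

Lemma resm_eq0 m n (A : 'M_(m, n)) : intm A -> resm A = 0 <-> gem A 1.
Proof.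
move=> hA; split=> [h i j|h].
  by rewrite -res_eq0; [move/matrixP: h => /(_ i j); rewrite !mxE => /eqP|apply: hA].
by apply/matrixP => i j; rewrite !mxE; apply/eqP; rewrite res_eq0 ?h //; apply: hA.
Qed.

Lemma resm_eq m n (A B : 'M_(m, n)) : intm A -> intm B -> resm A = resm B <-> gem (A - B) 1.
Proof.
move=> hA hB; rewrite -resm_eq0; last exact: gemB.
have -> : resm (A - B) = resm A - resm B.
  by apply/matrixP => i j; rewrite !mxE resB //.
by split=> [->|/eqP]; rewrite ?subrr // subr_eq0 => /eqP.
Qed.

Lemma det_resm n (A : 'M_n) : intm A -> \det (resm A) = res (\det A).
Proof.
move=> hA; rewrite /determinant res_sum => [|s _].
  apply: eq_bigr => s _; rewrite resM; last exact: ge_prod.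
    rewrite res_prod; last by move=> i _; apply: hA.
    congr (_ * _); last by apply: eq_bigr => i _; rewrite mxE.
    by case: (perm.odd_perm s); rewrite ?expr0 ?expr1 ?resN ?res1.
  by case: (perm.odd_perm s); rewrite ?expr0 ?expr1 ?geN.
rewrite -[0]addr0; apply: geM; last exact: ge_prod.
by case: (perm.odd_perm s); rewrite ?expr0 ?expr1 ?geN.
Qed.

Definition GLO n (A : 'M[L]_n) := [/\ intm A, A \in unitmx & intm (invmx A)].

Lemma det_neq0 n (A : 'M[L]_n) : A \in unitmx -> \det A != 0.
Proof. by rewrite unitmxE unitfE. Qed.

Definition vdet n (A : 'M[L]_n) := v (\det A).

Lemma vdetM n (A B : 'M_n) : A \in unitmx -> B \in unitmx -> vdet (A *m B) = vdet A + vdet B.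
Proof. by move=> uA uB; rewrite /vdet det_mulmx dvalM ?det_neq0. Qed.

Lemma vdetV n (A : 'M_n) : A \in unitmx -> vdet (invmx A) = - vdet A.
Proof. by move=> uA; rewrite /vdet det_inv dvalV ?det_neq0. Qed.

Lemma vdet_intm n (A : 'M_n) : A \in unitmx -> intm A -> 0 <= vdet A.
Proof. by move=> uA /det_intg; rewrite ge_neq0 ?det_neq0. Qed.

Lemma vdet1 n : vdet (1%:M : 'M_n) = 0.
Proof. by rewrite /vdet det1 dval1. Qed.

Lemma vdet_scale n c (A : 'M_n) : c != 0 -> A \in unitmx ->
  vdet (c *: A) = v c *+ n + vdet A.
Proof. by move=> nc uA; rewrite /vdet detZ dvalM ?expf_neq0 ?det_neq0 // dvalX. Qed.

Lemma scale_unitmx n c (A : 'M[L]_n) : c != 0 -> (c *: A \in unitmx) = (A \in unitmx).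
Proof. by move=> nc; rewrite unitmxZ // unitfE. Qed.

(** Cramer's rule: the inverse is the adjugate divided by a determinant that is a unit. *)
Lemma GLO_vdet n (A : 'M_n) : intm A -> A \in unitmx -> vdet A = 0 -> GLO A.
Proof.
move=> hA uA vA; split=> //; rewrite /invmx uA -[0]addr0; apply: gemZ; last exact: adj_intm.
by have [] := intg_unit (det_neq0 uA) vA.
Qed.

Lemma vdet_GLO n (A : 'M_n) : GLO A -> vdet A = 0.
Proof.
case=> hA uA hi; apply: unit_intg; first exact: det_neq0.
  exact: det_intg.
by rewrite -det_inv; apply: det_intg.
Qed.

Lemma GLO_res n (A : 'M_n) : intm A -> resm A \in unitmx -> GLO A.
Proof.
move=> hA; rewrite unitmxE unitfE det_resm // => /(res_neq0 (det_intg hA)) [nd vd].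
by apply: GLO_vdet; rewrite // unitmxE unitfE.
Qed.

Lemma res_GLO n (A : 'M_n) : GLO A -> resm A \in unitmx.
Proof.
case=> hA uA hi; apply: (@proj1 _ (resm (invmx A) \in unitmx)); apply/mulmx1_unit.
by rewrite -resmM // mulmxV // resm1.
Qed.

Lemma GLO1 n : GLO (1%:M : 'M_n).
Proof. by split; rewrite ?unitmx1 ?invmx1 //; apply: intm1. Qed.

Lemma GLO_inv n (A : 'M_n) : GLO A -> GLO (invmx A).
Proof. by case=> hA uA hi; split; rewrite ?unitmx_inv ?invmxK. Qed.

Lemma invmxM n (A B : 'M[L]_n) : A \in unitmx -> B \in unitmx ->
  invmx (A *m B) = invmx B *m invmx A.
Proof.
move=> uA uB; have uAB : A *m B \in unitmx by rewrite unitmx_mul uA.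
apply: (can_inj (mulKmx uAB)).
by rewrite mulmxV // mulmxA mulmxK // mulmxV.
Qed.

Lemma GLO_mul n (A B : 'M_n) : GLO A -> GLO B -> GLO (A *m B).
Proof.
move=> [hA uA iA] [hB uB iB]; split; first exact: intmM.
  by rewrite unitmx_mul uA.
by rewrite invmxM //; apply: intmM.
Qed.

Lemma lft_mx m n (A : 'M[rfield S]_(m, n)) : exists B, intm B /\ resm B = A.
Proof.
exists (map_mx (@lft S) A); split; first by move=> i j; rewrite mxE; apply: lft_intg.
by apply/matrixP => i j; rewrite !mxE lftK.
Qed.

Lemma lft_unitmx n (A : 'M[rfield S]_n) : A \in unitmx -> exists B, GLO B /\ resm B = A.
Proof.
by move=> uA; have [B [hB eB]] := lft_mx A; exists B; split=> //; apply: GLO_res; rewrite ?eB.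
Qed.

Lemma GLO_block n1 n2 (A : 'M_n1) (B : 'M_n2) :
  GLO A -> GLO B -> GLO (block_mx A 0 0 B).
Proof.
move=> gA gB; have [hA uA iA] := gA; have [hB uB iB] := gB.
apply: GLO_vdet; first by apply/gem_block; split=> //; apply: gem0.
  by rewrite unitmxE unitfE det_ublock mulf_neq0 ?det_neq0.
by rewrite /vdet det_ublock dvalM ?det_neq0 // -/(vdet A) -/(vdet B) !vdet_GLO.
Qed.

Lemma GLO_unit n (A : 'M_n) : GLO A -> A \in unitmx. Proof. by case. Qed.
Lemma GLO_intm n (A : 'M_n) : GLO A -> intm A. Proof. by case. Qed.

End IntegralMatrices.
Notation intm A := (gem A 0).
#[global] Hint Resolve unifz_neq0 ge0 ge1 ge_unifz : core.

(** * Semilinear maps: iterates and change of basis *)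

Section Iterates.
Variables (L : fieldType) (t : {rmorphism L -> L}).

(** The recursion runs over bundled morphisms, so that [map_mx (itm t k)] is still entrywise
    application of a ring morphism. *)
Fixpoint itm (k : nat) : {rmorphism L -> L} :=
  if k is k'.+1 then GRing.RMorphism.clone _ _ (t \o itm k') _
  else GRing.RMorphism.clone _ _ idfun _.

Lemma itmE k x : itm k x = iter k t x.
Proof. by elim: k => //= k ->. Qed.

Lemma map_itmS k m n (A : 'M_(m, n)) : map_mx (itm k.+1) A = map_mx t (map_mx (itm k) A).
Proof. by apply/matrixP => i j; rewrite !mxE. Qed.

Lemma map_itm0 m n (A : 'M_(m, n)) : map_mx (itm 0) A = A.
Proof. by apply/matrixP => i j; rewrite !mxE. Qed.

Lemma map_itm1 m n (A : 'M_(m, n)) : map_mx (itm 1) A = map_mx t A.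
Proof. by apply/matrixP => i j; rewrite !mxE. Qed.

End Iterates.

Section Semilinear.
Variable S : dvr.
Local Notation L := (dvr_field S).
Local Notation v := (@dval S).
Local Notation pi := (unif S).
Local Notation ge x k := (ge_val v x k).

(** Properties that [sigma] shares with all its iterates ([itm_frob]); [Phi] and its powers are
    semilinear for such iterates. *)
Definition frob (t : {rmorphism L -> L}) : Prop :=
  [/\ bijective t, forall x, x != 0 -> v (t x) = v x & t pi = pi].

Lemma frob_ge t x k : frob t -> ge (t x) k = ge x k.
Proof.
case=> _ tv _; rewrite /ge_val fmorph_eq0; have [//|nx] /= := eqVneq x 0.
by rewrite tv.
Qed.

Lemma frob_unifz t k : frob t -> t (pi ^ k) = pi ^ k.
Proof. by case=> _ _ tp; rewrite rmorphXz ?tp // unitfE unif_neq0. Qed.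

Lemma frob_gem t m n (A : 'M_(m, n)) k : frob t -> gem (map_mx t A) k <-> gem A k.
Proof. by move=> ft; split=> h i j; have := h i j; rewrite mxE frob_ge. Qed.

Lemma frob_vdet t n (A : 'M_n) : frob t -> A \in unitmx -> vdet (map_mx t A) = vdet A.
Proof. by case=> _ tv _ uA; rewrite /vdet det_map_mx tv ?det_neq0. Qed.

Lemma frob_GLO t n (A : 'M_n) : frob t -> GLO (map_mx t A) <-> GLO A.
Proof.
move=> ft; rewrite /GLO map_unitmx -map_invmx.
by split=> -[h1 h2 h3]; split=> //; apply/(frob_gem _ _ ft).
Qed.

Lemma frob_surj t m n (A : 'M_(m, n)) : frob t -> exists B, map_mx t B = A.
Proof.
by case=> -[g tK gK] _ _; exists (map_mx g A); apply/matrixP => i j; rewrite !mxE gK.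
Qed.

(** Applying [t] to a lift and reducing does not depend on the lift, because [t] preserves
    valuations; this makes the result a morphism although [lft] is only a section. *)
Lemma frob_res t : frob t -> exists u : {rmorphism rfield S -> rfield S},
  forall x, ge x 0 -> res (t x) = u (res x).
Proof.
move=> ft; pose u (y : rfield S) := res (t (lft y)).
have uE x : ge x 0 -> res (t x) = u (res x).
  move=> hx; apply/eqP; rewrite res_eq ?frob_ge ?lft_intg // -rmorphB frob_ge //.
  by rewrite -res_eq ?lft_intg // lftK.
have uB : zmod_morphism u.
  move=> x y; rewrite -[x]lftK -[y]lftK -resB ?lft_intg // -!uE ?lft_intg ?geB ?lft_intg //.
  by rewrite rmorphB resB // frob_ge ?lft_intg.
have uM : monoid_morphism u.
  split=> [|x y]; first by rewrite -(res1 S) -uE ?ge1 // rmorph1.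
  have h : ge (lft x * lft y) 0 by rewrite -[0]addr0 geM ?lft_intg.
  rewrite -[x]lftK -[y]lftK -resM ?lft_intg // -!uE ?lft_intg //.
  by rewrite rmorphM resM // frob_ge ?lft_intg.
pose zm := GRing.isZmodMorphism.Build _ _ u uB.
pose mm := GRing.isMonoidMorphism.Build _ _ u uM.
pose U : {rmorphism _ -> _} := HB.pack u zm mm.
by exists U.
Qed.

Variable t : {rmorphism L -> L}.

Lemma itm_frob k : frob t -> frob (itm t k).
Proof.
move=> [bt tv tp]; elim: k => [|k [b tv' tp']]; first by split=> //; exists idfun.
split=> /=; first exact: bij_comp.
  by move=> x nx; rewrite tv ?fmorph_eq0 // tv'.
by rewrite tp' tp.
Qed.

Section Powers.
Variable n : nat.

(** Matrix of the [k]-th iterate of [x |-> t(x) G], that is [t^(k-1)(G) .. t(G) G]; the iterate is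
    semilinear for [t^k]. *)
Fixpoint tpow (G : 'M[L]_n) (k : nat) : 'M[L]_n :=
  if k is k'.+1 then map_mx t (tpow G k') *m G else 1%:M.

Implicit Types G P : 'M[L]_n.

Lemma tpowS G k : tpow G k.+1 = map_mx t (tpow G k) *m G.
Proof. by []. Qed.

Lemma tpow1 G : tpow G 1 = G.
Proof. by rewrite /= map_mx1 mul1mx. Qed.

Lemma tpowD G k l : tpow G (k + l) = map_mx (itm t k) (tpow G l) *m tpow G k.
Proof.
elim: k => [|k IH]; first by rewrite map_itm0 mulmx1.
by rewrite addSn tpowS IH map_mxM -map_itmS tpowS mulmxA.
Qed.

Lemma tpowSr G k : tpow G k.+1 = map_mx (itm t k) G *m tpow G k.
Proof. by rewrite -addn1 tpowD tpow1. Qed.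

Lemma tpow_unit G k : G \in unitmx -> tpow G k \in unitmx.
Proof.
move=> uG; elim: k => [|k IH]; first by rewrite unitmx1.
by rewrite tpowS unitmx_mul map_unitmx IH.
Qed.

Lemma iter_Fmap G k x : iter k (Fmap t G) x = map_mx (itm t k) x *m tpow G k.
Proof.
elim: k => [|k IH]; first by rewrite map_itm0 mulmx1.
by rewrite iterS IH /Fmap map_mxM -map_itmS tpowS mulmxA.
Qed.

(** Matrix of the same semilinear map in the basis formed by the rows of [P]: twisted
    conjugation. *)
Definition cj P G := map_mx t P *m G *m invmx P.

Lemma cj_unit P G : P \in unitmx -> G \in unitmx -> cj P G \in unitmx.
Proof. by move=> uP uG; rewrite !unitmx_mul map_unitmx unitmx_inv uP uG. Qed.

Lemma cj_comp P Q G : P \in unitmx -> Q \in unitmx -> cj P (cj Q G) = cj (P *m Q) G.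
Proof. by move=> uP uQ; rewrite /cj map_mxM invmxM // !mulmxA. Qed.

Lemma vdet_tpow G k : frob t -> G \in unitmx -> vdet (tpow G k) = vdet G *+ k.
Proof.
move=> ft uG; elim: k => [|k IH]; first by rewrite vdet1.
by rewrite tpowS vdetM ?map_unitmx ?tpow_unit // frob_vdet ?tpow_unit // IH mulrSr.
Qed.

Lemma vdet_cj P G : frob t -> P \in unitmx -> G \in unitmx -> vdet (cj P G) = vdet G.
Proof.
move=> ft uP uG; rewrite /cj !vdetM ?unitmx_mul ?map_unitmx ?unitmx_inv ?uP ?uG //.
by rewrite frob_vdet // vdetV // addrAC subrr add0r.
Qed.

Lemma tpow_scale G c k : t c = c -> tpow (c *: G) k = c ^+ k *: tpow G k.
Proof.
move=> tc; elim: k => [|k IH]; first by rewrite expr0 scale1r.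
by rewrite !tpowS IH map_mxZ rmorphXn /= tc -scalemxAl -scalemxAr scalerA -exprSr.
Qed.

End Powers.
End Semilinear.

Arguments tpow {S} t {n} G k.
Arguments cj {S} t {n} P G.

Section SemilinearPowers.
Variable S : dvr.
Local Notation L := (dvr_field S).
Variable t : {rmorphism L -> L}.

Lemma itmM k l x : itm (itm t k) l x = itm t (k * l) x.
Proof.
elim: l => [|l IH]; first by rewrite muln0.
by rewrite mulnS /= IH !itmE iterD.
Qed.

Lemma map_itmM k l m n (A : 'M[L]_(m, n)) : map_mx (itm (itm t k) l) A = map_mx (itm t (k * l)) A.
Proof. by apply/matrixP => i j; rewrite !mxE itmM. Qed.

Variable n : nat.
Implicit Types G P : 'M[L]_n.

Lemma tpowM G k l : tpow t G (k * l) = tpow (itm t k) (tpow t G k) l.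
Proof.
elim: l => [|l IH]; first by rewrite muln0.
by rewrite mulnS tpowD IH.
Qed.

Lemma tpow_cj P G k : P \in unitmx -> tpow t (cj t P G) k = cj (itm t k) P (tpow t G k).
Proof.
move=> uP; elim: k => [|k IH]; first by rewrite /cj map_itm0 mulmx1 mulmxV.
rewrite !tpowS IH /cj !map_mxM -map_itmS map_invmx !mulmxA mulmxKV ?map_unitmx //.
Qed.

End SemilinearPowers.

Section SemilinearBlocks.
Variable S : dvr.
Local Notation L := (dvr_field S).
Variable t : {rmorphism L -> L}.
Variables m n : nat.

Lemma tpow_diag (G1 : 'M[L]_m) (G2 : 'M[L]_n) k :
  tpow t (block_mx G1 0 0 G2) k = block_mx (tpow t G1 k) 0 0 (tpow t G2 k).
Proof.
elim: k => [|k IH]; first by rewrite /= -scalar_mx_block.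
by rewrite !tpowS IH map_block_mx mulmx_block !map_mx0 !(mul0mx, mulmx0, addr0, add0r).
Qed.

Lemma tpow_lblock (G1 : 'M[L]_m) (H : 'M[L]_(n, m)) (G2 : 'M[L]_n) k :
  exists H', tpow t (block_mx G1 0 H G2) k = block_mx (tpow t G1 k) 0 H' (tpow t G2 k).
Proof.
elim: k => [|k [H' IH]]; first by exists 0; rewrite /= -scalar_mx_block.
exists (map_mx t H' *m G1 + map_mx t (tpow t G2 k) *m H).
by rewrite !tpowS IH map_block_mx mulmx_block !map_mx0 !(mul0mx, mulmx0, addr0, add0r).
Qed.

Lemma block_unitmx (A : 'M[L]_m) (B : 'M[L]_n) :
  (block_mx A 0 0 B \in unitmx) = (A \in unitmx) && (B \in unitmx).
Proof. by rewrite !unitmxE !unitfE det_ublock mulf_eq0 negb_or. Qed.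

Lemma invmx_diag (A : 'M[L]_m) (B : 'M[L]_n) : A \in unitmx -> B \in unitmx ->
  invmx (block_mx A 0 0 B) = block_mx (invmx A) 0 0 (invmx B).
Proof.
move=> uA uB; have u : block_mx A 0 0 B \in unitmx by rewrite block_unitmx uA.
apply: (can_inj (mulKmx u)); rewrite mulmxV // mulmx_block.
by rewrite !(mul0mx, mulmx0, addr0, add0r) !mulmxV // -scalar_mx_block.
Qed.

Lemma cj_diag (P1 G1 : 'M[L]_m) (P2 G2 : 'M[L]_n) : P1 \in unitmx -> P2 \in unitmx ->
  cj t (block_mx P1 0 0 P2) (block_mx G1 0 0 G2) = block_mx (cj t P1 G1) 0 0 (cj t P2 G2).
Proof.
move=> u1 u2; rewrite /cj invmx_diag // map_block_mx !mulmx_block !map_mx0.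
by rewrite !(mul0mx, mulmx0, addr0, add0r).
Qed.

Lemma vdet_block (A : 'M[L]_m) (H : 'M[L]_(m, n)) (B : 'M[L]_n) : A \in unitmx -> B \in unitmx ->
  vdet (block_mx A H 0 B) = vdet A + vdet B.
Proof. by move=> uA uB; rewrite /vdet det_ublock dvalM ?det_neq0. Qed.
End SemilinearBlocks.

(** * Lattices and their bases *)

Lemma int_min (P : int -> Prop) (K : int) : (exists z, P z) -> (forall z, P z -> K <= z) ->
  exists z, P z /\ forall z', P z' -> z <= z'.
Proof.
move=> [z Pz] bd; have [m] := ubnP `|z - K|%N; elim: m z Pz => // m IH z Pz zm.
have [[z' [Pz' lt]]|h] := classic (exists z', P z' /\ z' < z).
  by apply: (IH z') => //; have := bd _ Pz'; lia.
exists z; split=> // z' Pz'; rewrite leNgt; apply/negP => lt; apply: h; by exists z'.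
Qed.

Section Lattices.
Variable S : dvr.
Local Notation L := (dvr_field S).
Local Notation v := (@dval S).
Variable n : nat.
Implicit Types (A : 'M[L]_n) (x : 'rV[L]_n) (M : lset L n).

Lemma intg_rowE x : intg_row v x <-> intm x.
Proof. by split=> [h i j|h k]; [rewrite ord1|]; apply: h. Qed.

Lemma ospanP A x : A \in unitmx -> ospan v A x <-> intm (x *m invmx A).
Proof.
move=> uA; split=> [[c [hc ->]]|h]; first by rewrite mulmxK //; apply/intg_rowE.
by exists (x *m invmx A); rewrite mulmxKV //; split=> //; apply/intg_rowE.
Qed.

Lemma ospan_row A i : ospan v A (row i A).
Proof.
exists (delta_mx 0 i); rewrite rowE; split=> // k.
by rewrite mxE /intg; case: andP => // _; apply: ge1.
Qed.

Lemma intm_rows m p (A : 'M[L]_(m, p)) k : (forall i, gem (row i A) k) -> gem A k.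
Proof. by move=> h i j; have := h i 0 j; rewrite mxE. Qed.

Lemma ospan_sub A A' : A' \in unitmx ->
  lsub (ospan v A) (ospan v A') <-> intm (A *m invmx A').
Proof.
move=> u'; split=> [h|h x [c [hc ->]]].
  apply: intm_rows => i; rewrite row_mul; apply/(ospanP _ u'); apply: h.
  exact: ospan_row.
by apply/(ospanP _ u'); rewrite -mulmxA; apply: intmM => //; apply/intg_rowE.
Qed.

Lemma ospan_GLO A A' : A \in unitmx -> A' \in unitmx ->
  (forall x, ospan v A x <-> ospan v A' x) -> GLO (A *m invmx A').
Proof.
move=> uA uA' h; split; first by apply/ospan_sub => // x /h.
  by rewrite unitmx_mul unitmx_inv uA.
by rewrite invmxM ?unitmx_inv // invmxK; apply/ospan_sub => // x /h.
Qed.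

Lemma GLO_ospan A U : GLO U -> A \in unitmx -> forall x, ospan v (U *m A) x <-> ospan v A x.
Proof.
move=> [hU uU iU] uA x; rewrite !ospanP ?unitmx_mul ?uU // invmxM // mulmxA.
split=> h; last by apply: gemMint.
by rewrite -[_ *m invmx A](mulmxKV uU); apply: gemMint.
Qed.

Lemma ospan_vdet A A' : A \in unitmx -> A' \in unitmx ->
  (forall x, ospan v A x <-> ospan v A' x) -> vdet A = vdet A'.
Proof.
move=> uA uA' h; have /vdet_GLO := ospan_GLO uA uA' h.
by rewrite vdetM ?unitmx_inv // vdetV // => /eqP; rewrite subr_eq0 => /eqP.
Qed.

Definition basis_of A M := A \in unitmx /\ forall x, M x <-> ospan v A x.

(** Two bases of one lattice differ by an element of [GL(O)], whose determinant is a unit, so any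
    pair of bases computes the length. *)
Lemma lat_lenP A A' M M' k : basis_of A M -> basis_of A' M' ->
  lat_len v M M' k <-> k = vdet A - vdet A'.
Proof.
move=> [uA hA] [uA' hA']; split=> [[X [X' [uX uX' hX hX' ->]]]|->]; last by exists A, A'.
rewrite (@ospan_vdet A X) ?(@ospan_vdet A' X') // => x.
  by rewrite -hA' hX'.
by rewrite -hA hX.
Qed.

Lemma basis_of_vdet A A' M : basis_of A M -> basis_of A' M -> vdet A = vdet A'.
Proof. by move=> [uA hA] [uA' hA']; apply: ospan_vdet => // x; rewrite -hA hA'. Qed.

Lemma basis_of_GLOl A U M : GLO U -> basis_of A M -> basis_of (U *m A) M.
Proof.
move=> gU [uA hA]; split; first by rewrite unitmx_mul (GLO_unit gU).
by move=> x; rewrite hA GLO_ospan.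
Qed.

Lemma lsubP A A' M M' : basis_of A M -> basis_of A' M' ->
  lsub M M' <-> intm (A *m invmx A').
Proof.
move=> [uA hA] [uA' hA']; rewrite -ospan_sub //.
by split=> h x hx; apply/hA'/h/hA.
Qed.

Lemma basis_of_Fmap (t : {rmorphism L -> L}) A B M : frob t -> B \in unitmx ->
  basis_of A M -> basis_of (map_mx t A *m B) (img (Fmap t B) M).
Proof.
move=> ft uB [uA hA]; split; first by rewrite unitmx_mul map_unitmx uA.
move=> x; split=> [[y [/hA [c [hc ->]] ->]]|[c [hc ->]]].
  exists (map_mx t c); rewrite /Fmap map_mxM mulmxA; split=> //.
  by apply/intg_rowE/(frob_gem _ _ ft)/intg_rowE.
have [d dE] := frob_surj c ft; exists (d *m A); rewrite /Fmap map_mxM dE mulmxA; split=> //.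
by apply/hA; exists d; split=> //; apply/intg_rowE/(frob_gem _ _ ft); rewrite dE; apply/intg_rowE.
Qed.

Lemma basis_of_scl A M c : c != 0 -> basis_of A M -> basis_of (c *: A) (scl c M).
Proof.
move=> nc [uA hA]; split; first by rewrite scale_unitmx.
move=> x; split=> [[y [/hA [d [hd ->]] ->]]|[d [hd ->]]].
  by exists d; rewrite scalemxAr.
by exists (d *m A); rewrite scalemxAr; split=> //; apply/hA; exists d.
Qed.

End Lattices.

(* The induction strips the first coordinate: the elements of [M] whose first
   coordinate has minimal valuation provide the first basis vector. *)
Lemma sub_lattice (S : dvr) n (M : lset S n) (K K' : int) :
  (forall x y, M x -> M y -> M (x + y)) ->
  (forall c x, ge_val (@dval S) c 0 -> M x -> M (c *: x)) ->
  (forall x, gem x K -> M x) -> (forall x, M x -> gem x K') ->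
  exists A, basis_of A M /\ forall i j : 'I_n, (j < i)%N -> A i j = 0.
Proof.
elim: n M => [|n IH] M MD MZ Mlo Mhi.
  exists 1%:M; split; last by case.
  split=> [|x]; first exact: unitmx1.
  rewrite ospanP ?unitmx1 //; split=> _; first by move=> i [].
  by apply: Mlo => i [].
pose M' (y : 'rV[S]_n) := M (row_mx (0 : 'rV_1) y).
have gem_row y k : gem (row_mx (0 : 'rV[S]_1) y) k <-> gem y k.
  split=> h i j; first by have := h i (rshift 1 j); rewrite row_mxEr.
  rewrite -(splitK j); case: (split j) => a /=; first by rewrite row_mxEl mxE.
  by rewrite row_mxEr.
have [A' [[uA' hA'] tA']] : exists A, basis_of A M' /\ forall i j : 'I_n, (j < i)%N -> A i j = 0.
  apply: IH.
  - move=> x y Mx My; have e : row_mx (0 : 'rV_1) (x + y) = row_mx 0 x + row_mx 0 y.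
      by rewrite add_row_mx addr0.
    by rewrite /M' e; apply: MD.
  - move=> c x hc Mx; have e : row_mx (0 : 'rV_1) (c *: x) = c *: row_mx 0 x.
      by rewrite scale_row_mx scaler0.
    by rewrite /M' e; apply: MZ.
  - by move=> x hx; apply/Mlo/gem_row.
  - by move=> x Mx; apply/gem_row/Mhi.
have [d [[e [Me [ne <-]]] dmin]] : exists d : int, (exists e, M e /\ (e 0 0 != 0 /\ dval (e 0 0) = d))
    /\ forall d', (exists e, M e /\ (e 0 0 != 0 /\ dval (e 0 0) = d')) -> d <= d'.
  apply: (int_min (K := K')) => [|z [e [Me [ne <-]]]]; last first.
    by have := Mhi _ Me 0 0; rewrite ge_neq0.
  exists K, (unif S ^ K *: delta_mx 0 0); rewrite !mxE !eqxx /= mulr1 dval_unifz.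
  split; last by rewrite unifz_neq0.
  by apply/Mlo/gem_unifZ; rewrite subrr => i j; rewrite mxE; case: andP.
pose A : 'M[S]_(1 + n) := col_mx (e : 'rV_(1 + n)) (row_mx 0 A').
have AE : A = block_mx (e 0 0)%:M (rsubmx (e : 'rV_(1 + n))) 0 A'.
  rewrite /A /block_mx; congr col_mx; rewrite -{1}[e](@hsubmxK _ 1 1 n); congr row_mx.
  by apply/matrixP => i j; rewrite !mxE !ord1 eqxx mulr1n; congr (e _ _); apply: val_inj.
have uA : A \in unitmx.
  by rewrite AE unitmxE unitfE det_ublock det_scalar1 mulf_neq0 // det_neq0.
exists A; split; last first.
  move=> i j; rewrite /A => ji; case: (unliftP ord0 i) ji => [i'|] -> // ji.
  rewrite (_ : lift ord0 i' = rshift 1 i'); last exact: val_inj.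
  rewrite (@col_mxEd _ 1); case: (unliftP ord0 j) ji => [j'|] -> ji.
    rewrite (_ : lift ord0 j' = rshift 1 j'); last exact: val_inj.
    by rewrite (@row_mxEr _ n 1) tA'.
  rewrite (_ : ord0 = lshift n (0 : 'I_1)) in ji *; last exact: val_inj.
  by rewrite (@row_mxEl _ n 1) mxE.
split=> // x; split=> [Mx|[c [hc ->]]]; last first.
  rewrite -[c](@hsubmxK _ 1 1 n) (@mul_row_col _ 1 1 n (1 + n)); apply: MD.
    rewrite [lsubmx _]mx11_scalar mul_scalar_mx; apply: MZ => //.
    by rewrite mxE; apply: hc.
  rewrite mul_mx_row mulmx0; apply/hA'; exists (rsubmx (c : 'rV_(1 + n))); split=> // k.
  by rewrite mxE; apply: hc.
pose c := x 0 0 / e 0 0.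
have hc : ge_val (@dval S) c 0.
  rewrite /c; have [->|nx] := eqVneq (x 0 0) 0; first by rewrite mul0r.
  rewrite ge_neq0 ?mulf_neq0 ?invr_eq0 // dvalM ?invr_eq0 // dvalV // subr_ge0.
  by apply: dmin; exists x.
have Mxc : M (x - c *: e) by rewrite -scaleNr; apply: MD => //; apply: MZ => //; rewrite geN.
have xE : x - c *: e = row_mx (0 : 'rV_1) (rsubmx (x - c *: e : 'rV_(1 + n))).
  have h0 : @lsubmx _ 1 1 n (x - c *: e) = 0.
    apply/matrixP => i j; rewrite !mxE !ord1 (_ : lshift n 0 = 0); last exact: val_inj.
    by rewrite /c mulfVK // subrr.
  by rewrite -[LHS](@hsubmxK _ 1 1 n) h0.
rewrite xE in Mxc; have /hA' [c' [hc' c'E]] := Mxc.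
exists (row_mx c%:M c' : 'rV_(1 + n)); split.
  move=> k; rewrite -(splitK (k : 'I_(1 + n))); case: (split _) => a /=.
    by rewrite (@row_mxEl _ 1 1 n) mxE !ord1 eqxx mulr1n.
  by rewrite (@row_mxEr _ 1 1 n); apply: hc'.
have e2 : row_mx 0 (c' *m A') = c' *m row_mx (0 : 'M_(n, 1)) A' by rewrite mul_mx_row mulmx0.
rewrite (@mul_row_col _ 1 1 n) mul_scalar_mx.
transitivity (c *: e + @row_mx _ 1 1 n 0 (c' *m A')); first by rewrite -c'E -xE addrC subrK.
by congr (_ + _).
Qed.

(** * Powers of the uniformizer on the diagonal; elementary divisors 0 and 1 *)

Section ZDiag.
Variable S : dvr.
Local Notation L := (dvr_field S).
Local Notation pi := (unif S).
Variable n : nat.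
Implicit Types (e : 'I_n -> int) (A : 'M[L]_n).

Definition zdiag e : 'M[L]_n := diag_mx (\row_i pi ^ e i).

Lemma zdiag_mulE m e (A : 'M[L]_(n, m)) i j : (zdiag e *m A) i j = pi ^ e i * A i j.
Proof. by rewrite mul_diag_mx !mxE. Qed.

Lemma mul_zdiagE m e (A : 'M[L]_(m, n)) i j : (A *m zdiag e) i j = A i j * pi ^ e j.
Proof. by rewrite mul_mx_diag !mxE. Qed.

Lemma zdiagD e1 e2 : zdiag e1 *m zdiag e2 = zdiag (fun i => e1 i + e2 i).
Proof.
apply/matrixP => i j; rewrite zdiag_mulE !mxE.
by case: eqP => // _; rewrite ?mulr0n ?mulr0 // !mulr1n expfzDr ?unif_neq0.
Qed.

Lemma zdiag0 : zdiag (fun=> 0) = 1%:M.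
Proof. by apply/matrixP => i j; rewrite !mxE expr0z. Qed.

Lemma eq_zdiag e1 e2 : e1 =1 e2 -> zdiag e1 = zdiag e2.
Proof. by move=> h; apply/matrixP => i j; rewrite !mxE h. Qed.

Lemma zdiagN e : zdiag e *m zdiag (fun i => - e i) = 1%:M.
Proof. by rewrite zdiagD -zdiag0; apply: eq_zdiag => i; rewrite subrr. Qed.

Lemma zdiag_unit e : zdiag e \in unitmx.
Proof. by have [] := mulmx1_unit (zdiagN e). Qed.

Lemma invmx_zdiag e : invmx (zdiag e) = zdiag (fun i => - e i).
Proof. by apply: (can_inj (mulKmx (zdiag_unit e))); rewrite mulmxV ?zdiag_unit // zdiagN. Qed.

Lemma vdet_zdiag e : vdet (zdiag e) = \sum_i e i.
Proof.
have [//] : \prod_i (\row_i pi ^ e i) 0 i != 0 /\ dval (\prod_i (\row_i pi ^ e i) 0 i) = \sum_i e i.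
  elim/big_ind2: _ => [|x1 x2 y1 y2 [n1 h1] [n2 h2]|i _].
  - by rewrite dval1 oner_neq0.
  - by rewrite mulf_neq0 // dvalM // h1 h2.
  - by rewrite mxE dval_unifz unifz_neq0.
by rewrite /vdet det_diag.
Qed.

Lemma map_zdiag t e : frob t -> map_mx t (zdiag e) = zdiag e.
Proof.
by move=> ft; apply/matrixP => i j; rewrite !mxE rmorphMn /= frob_unifz.
Qed.

Lemma zdiag_intm e : (forall i, 0 <= e i) -> intm (zdiag e).
Proof.
move=> h i j; rewrite !mxE; case: eqP => // _; rewrite mulr1n.
by apply: geW (h i) _.
Qed.
End ZDiag.

Lemma pid_mulE (R : nzRingType) n p r (A : 'M[R]_(n, p)) i j :
  (pid_mx r *m A) i j = if (i < r)%N then A i j else 0.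
Proof.
rewrite mxE (bigD1 i) //= big1 => [|k ne].
  by rewrite mxE /= eqxx addr0; case: ltnP => _; rewrite ?mul1r ?mul0r.
by rewrite mxE eq_sym (inj_eq val_inj) (negPf ne) mul0r.
Qed.

Section Minuscule.
Variable S : dvr.
Local Notation L := (dvr_field S).
Local Notation pi := (unif S).

(** Modulo [pi], the matrix [G V^-1] becomes [col_ebase] times [pid_mx] of the rank, whose columns
    beyond the rank vanish. *)
Lemma row_ebase_col n (G V : 'M[L]_n) i (j : 'I_n) : intm G -> GLO V -> resm V = row_ebase (resm G) ->
  (\rank (resm G) <= j)%N -> ge_val (@dval S) ((G *m invmx V) i j) 1.
Proof.
move=> hG [hV uV iV] VE lt.
have iVE : resm (invmx V) *m row_ebase (resm G) = 1%:M.
  by rewrite -VE -resmM // mulVmx // resm1.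
have /resm_eq0 h : intm (col j (G *m invmx V)).
  by move=> a b; rewrite mxE; apply: gemMint.
suff /h : resm (col j (G *m invmx V)) = 0 by move=> /(_ i 0); rewrite mxE.
have -> : resm (col j (G *m invmx V)) = col j (resm (G *m invmx V)).
  by apply/matrixP => a b; rewrite !mxE.
rewrite resmM // -{1}[resm G]mulmx_ebase -!mulmxA (mulmx1C iVE) mulmx1.
apply/matrixP => a b; rewrite !mxE big1 // => c _; rewrite mxE.
by case: eqP => [->|]; rewrite /= ?mulr0 // ltnNge lt mulr0.
Qed.

(** The residue rank [m] decides everything: with [V] lifting [row_ebase], the columns of [G V^-1]
    from [m] on are divisible by [pi], and dividing them gives [U]. Integrality of [U^-1] comes from
    [pi G^-1], whose product with [G] vanishes modulo [pi]. *)
Lemma minuscule_smith n (G : 'M[L]_n) : G \in unitmx -> intm G -> intm (pi *: invmx G) ->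
  exists m U V, [/\ (m <= n)%N, GLO U, GLO V &
    G = U *m zdiag S (fun i : 'I_n => (m <= i)%N%:Z) *m V].
Proof.
move=> uG hG hH; set R := resm G.
have [V [gV VE]] := lft_unitmx (row_ebase_unit R).
have [hV uV iV] := gV.
pose m := \rank R; pose e (i : 'I_n) := (m <= i)%N%:Z.
pose U := G *m invmx V *m invmx (zdiag S e).
exists m, U, V; split=> //; first exact: rank_leq_row; last by rewrite /U !mulmxKV ?zdiag_unit.
have hU : intm U.
  move=> i j; rewrite /U invmx_zdiag mul_zdiagE /e mulrC ge_unifM.
  have [lt|gt] := leqP m j; last by rewrite subr0; apply: gemMint.
  by rewrite opprK add0r; apply: row_ebase_col.
have uU : U \in unitmx by rewrite !unitmx_mul !unitmx_inv uG uV zdiag_unit.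
split=> //.
rewrite /U !invmxM ?unitmx_mul ?unitmx_inv ?zdiag_unit ?uG ?uV // !invmxK mulmxA.
move=> i j; rewrite -mulmxA zdiag_mulE ge_unifM.
have hVH : intm (V *m (pi *: invmx G)) by apply: intmM.
have eq : (V *m invmx G) i j = pi ^ (-1) * (V *m (pi *: invmx G)) i j.
  rewrite -scalemxAr [in RHS]mxE mulrA -{2}[pi]expr1z -expfzDr ?unif_neq0 //.
  by rewrite addNr expr0z mul1r.
rewrite eq ge_unifM opprK /e; have [lt|gt] := leqP m i; first exact: hVH.
have /resm_eq0 h : intm (row i (V *m (pi *: invmx G))).
  by move=> a b; rewrite mxE.
suff /h : resm (row i (V *m (pi *: invmx G))) = 0 by move=> /(_ 0 j); rewrite mxE.
have -> : resm (row i (V *m (pi *: invmx G))) = row i (resm (V *m (pi *: invmx G))).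
  by apply/matrixP => a b; rewrite !mxE.
have RH : R *m resm (pi *: invmx G) = 0.
  rewrite -resmM // -scalemxAr mulmxV //; apply/resm_eq0.
    by rewrite scalemx1; apply: gem_scalar; apply: geW (ge_unifz S 1).
  by rewrite scalemx1; apply: gem_scalar; rewrite -{1}[pi]expr1z.
(* Cancelling [col_ebase] in [RH] shows that the first [m] rows of [V pi G^-1] vanish modulo
   [pi]. *)
have pH : pid_mx m *m resm (V *m (pi *: invmx G)) = 0 :> 'M_n.
  rewrite resmM // VE; move: RH; rewrite -{1}[R]mulmx_ebase -!mulmxA => RH.
  by apply: (can_inj (mulKmx (col_ebase_unit R))); rewrite RH mulmx0.
apply/matrixP => a b; move/matrixP: pH => /(_ i b).
by rewrite pid_mulE gt !mxE.
Qed.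

End Minuscule.

(** * Fixed points of contractions and the semilinear Fitting decomposition *)

Section Contraction.
Variable S : dvr.
Local Notation L := (dvr_field S).
Local Notation v := (@dval S).

(** The iterates of 0 converge entry by entry, by completeness; the limit is fixed because [X] and
    [f X] are both close to late iterates. *)
Lemma contraction_fixpoint p q (f : 'M[L]_(p, q) -> 'M[L]_(p, q)) (k0 : int) :
  (forall X, gem X k0 -> gem (f X) k0) ->
  (forall X Y k, gem X k0 -> gem Y k0 -> gem (X - Y) k -> gem (f X - f Y) (k + 1)) ->
  exists X, gem X k0 /\ f X = X.
Proof.
move=> fk fc; pose x i := iter i f 0.
have xk i : gem (x i) k0 by elim: i => [|i IH]; [apply: gem0|apply: fk].
have xS i : gem (x i.+1 - x i) (k0 + i%:Z).
  elim: i => [|i IH]; first by rewrite subr0 addr0.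
  have := fc _ _ _ (xk i.+1) (xk i) IH; rewrite -addrA.
  by rewrite -[_%:Z + 1]/(i + 1)%N%:Z addn1.
have xD i j : gem (x (i + j)%N - x i) (k0 + i%:Z).
  elim: j => [|j IH]; first by rewrite addn0 subrr; apply: gem0.
  rewrite addnS -(subrK (x (i + j)%N) (x (i + j).+1)) -addrA; apply: gemD => //.
  by apply: gemW (xS _); rewrite lerD2l; lia.
have [X Xlim] : exists X : 'M[L]_(p, q), forall a b (k : int), exists N, forall m, (N <= m)%N ->
    ge_val v (x m a b - X a b) k.
  have /fin_all_exists2 : forall ab : 'I_p * 'I_q, exists2 l, True & forall k : int,
      exists N, forall m, (N <= m)%N -> ge_val v (x m ab.1 ab.2 - l) k.
    move=> [a b] /=; have [|l hl] := @dvr_complete S (fun m => x m a b); last by exists l.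
    move=> k; exists `|k - k0|%N => m m' hm hm'.
    have h i : (`|k - k0| <= i)%N -> ge_val v (x i a b - x `|k - k0|%N a b) k.
      move=> hi; have := xD `|k - k0|%N (i - `|k - k0|)%N a b; rewrite subnKC // !mxE.
      by apply: geW; lia.
    by have := geB (h _ hm) (h _ hm'); rewrite opprB addrA subrK.
  case=> F _ hF; exists (\matrix_(a, b) F (a, b)) => a b; rewrite mxE; exact: (hF (a, b)).
have xX i : gem (x i - X) (k0 + i%:Z).
  move=> a b; have [N hN] := Xlim a b (k0 + i%:Z); have := hN (i + N)%N (leq_addl _ _) => h.
  have := geB h (xD i N a b); rewrite !mxE opprB.
  suff -> : x (i + N)%N a b - X a b + (x i a b - x (i + N)%N a b) = x i a b - X a b by [].
  by rewrite addrC addrA subrK.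
have Xk : gem X k0 by have := gemN (xX 0%N); rewrite sub0r opprK addr0.
exists X; split=> //.
apply/eqP; rewrite -subr_eq0; apply/eqP; apply: gem_all0 => k.
pose i := `|k - k0|%N.
have h0 : gem (X - x i) (k0 + i%:Z) by rewrite -opprB; apply: gemN.
have h1 := gemW _ (fc _ _ _ Xk (xk i) h0).
rewrite -(subrK (x i.+1) (f X)) -addrA; apply: gemD; first by apply: h1; rewrite /i; lia.
by apply: gemW (xX i.+1); rewrite /i; lia.
Qed.
End Contraction.

Section Fitting.
Variable S : dvr.
Local Notation L := (dvr_field S).
Variables m n : nat.
Variable u : {rmorphism L -> L}.
Hypothesis fu : frob u.

Lemma GLO_perturb p (A B : 'M[L]_p) : GLO A -> gem (B - A) 1 -> GLO B.
Proof.
move=> gA h; have [hA _ _] := gA.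
have hB : intm B by rewrite -(subrK A B); apply: gemD => //; apply: gemW h.
by apply: GLO_res => //; rewrite (_ : resm B = resm A) ?res_GLO //; apply/resm_eq.
Qed.

Lemma invmxB p (A B : 'M[L]_p) : A \in unitmx -> B \in unitmx ->
  invmx A - invmx B = invmx A *m (B - A) *m invmx B.
Proof.
by move=> uA uB; rewrite mulmxBr mulmxBl mulVmx // mul1mx mulmxK.
Qed.

(** The equation says that conjugation by [[1 X; 0 1]] kills the upper right block. Solved for the
    right-hand factor [X] it is a contraction, since [X], [B] and [E] are divisible by [pi]. *)
Lemma fitting_upper (A : 'M[L]_m) (B : 'M_(m, n)) (C : 'M_(n, m)) (E : 'M_n) :
  GLO A -> gem B 1 -> intm C -> gem E 1 ->
  exists X : 'M_(m, n), gem X 1 /\ (A + map_mx u X *m C) *m X = B + map_mx u X *m E.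
Proof.
move=> gA hB hC hE.
have gX X : gem X 1 -> GLO (A + map_mx u X *m C).
  move=> hX; apply: GLO_perturb gA _; rewrite addrC addKr.
  by apply: gemMint => //; apply/frob_gem.
have hY X : gem X 1 -> gem (B + map_mx u X *m E) 1.
  move=> hX; apply: gemD => //; apply: intmM => //; apply/frob_gem => //.
  exact: gemW hX.
have [X|X Y k hX hYY hXY|X [hX XE]] := @contraction_fixpoint S m n
  (fun X => invmx (A + map_mx u X *m C) *m (B + map_mx u X *m E)) 1.
- by move=> hX; have [_ _ hi] := gX X hX; apply: intmM => //; apply: hY.
- have [_ u1 i1] := gX X hX; have [_ u2 i2] := gX Y hYY.
  set P := A + _ in u1 i1 *; set Q := A + _ in u2 i2 *.
  set b1 := B + _; set b2 := B + _.
  have -> : invmx P *m b1 - invmx Q *m b2 = (invmx P - invmx Q) *m b1 + invmx Q *m (b1 - b2).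
    by rewrite mulmxBl mulmxBr addrA subrK.
  have uXY : gem (map_mx u X - map_mx u Y) k by rewrite -map_mxB; apply/frob_gem.
  apply: gemD.
    rewrite invmxB //; apply: gemM; last exact: hY.
    apply: gemMint => //; apply: intmM => //.
    rewrite /P /Q opprD addrACA subrr add0r -mulmxBl.
    by apply: gemMint => //; rewrite -opprB; apply: gemN.
  rewrite /b1 /b2 opprD addrACA subrr add0r -mulmxBl; apply: intmM => //.
  exact: gemM.
exists X; split=> //; rewrite -{2}XE mulKVmx //.
by have [] := gX X hX.
Qed.

(** The equation says that conjugation by [[1 0; Z 1]] kills the lower left block. Solving for the
    twisted [Z] uses the inverse of [u], and divisibility of [E] by [pi] makes this a
    contraction. *)
Lemma fitting_lower (A : 'M[L]_m) (C : 'M_(n, m)) (E : 'M_n) :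
  GLO A -> intm C -> gem E 1 ->
  exists Z : 'M_(n, m), intm Z /\ E *m Z = map_mx u Z *m A + C.
Proof.
move=> [hA uA iA] hC hE; have [[g ug gu] _ _] := fu.
have gK p q (X : 'M[L]_(p, q)) : map_mx u (map_mx g X) = X.
  by apply/matrixP => i j; rewrite !mxE gu.
have gg p q (X : 'M[L]_(p, q)) k : gem X k -> gem (map_mx g X) k.
  by move=> hX; apply/(frob_gem _ _ fu); rewrite gK.
have [X hX|X Y k hX hY hXY|Z [hZ ZE]] := @contraction_fixpoint S n m
  (fun Z => map_mx g ((E *m Z - C) *m invmx A)) 0.
- apply: gg; apply: gemMint => //; apply: gemB => //; apply: gemMint => //.
  exact: gemW hE.
- have -> : map_mx g ((E *m X - C) *m invmx A) - map_mx g ((E *m Y - C) *m invmx A) =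
     map_mx g (E *m (X - Y) *m invmx A).
    have -> : E *m (X - Y) *m invmx A = (E *m X - C) *m invmx A - (E *m Y - C) *m invmx A.
      by rewrite -mulmxBl mulmxBr opprB addrA subrK.
    move: (_ *m invmx A) (_ *m invmx A) => P Q.
    by apply/matrixP => i j; apply: (can_inj ug); rewrite !mxE rmorphB /= !gu.
  by apply: gg; apply: gemMint => //; rewrite [k + 1]addrC; apply: gemM.
exists Z; split=> //; rewrite -{2}ZE gK mulmxKV // subrK //.
Qed.

Lemma fitting_diag (A : 'M[L]_m) (B : 'M_(m, n)) (C : 'M_(n, m)) (E : 'M_n) :
  GLO A -> gem B 1 -> intm C -> gem E 1 ->
  exists Q A' E', [/\ Q \in unitmx, GLO A', gem E' 1 &
    cj u Q (block_mx A B C E) = block_mx A' 0 0 E'].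
Proof.
move=> gA hB hC hE; have [X [hX XE]] := fitting_upper gA hB hC hE.
pose A' := A + map_mx u X *m C; pose E' := E - C *m X.
have gA' : GLO A'.
  apply: GLO_perturb gA _; rewrite addrC addKr.
  by apply: gemMint => //; apply/frob_gem.
have hE' : gem E' 1 by apply: gemB => //; apply: intmM.
have [Z [hZ ZE]] := fitting_lower gA' hC hE'.
have i1 : block_mx 1%:M X 0 1%:M *m block_mx 1%:M (- X) 0 1%:M = 1%:M :> 'M_(m + n).
  rewrite mulmx_block !(mulmx1, mul1mx, mulmx0, mul0mx, addr0, add0r) addNr.
  by rewrite -scalar_mx_block.
have i2 : block_mx 1%:M 0 Z 1%:M *m block_mx 1%:M 0 (- Z) 1%:M = 1%:M :> 'M_(m + n).
  rewrite mulmx_block !(mulmx1, mul1mx, mulmx0, mul0mx, addr0, add0r) subrr.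
  by rewrite -scalar_mx_block.
have [u1 _] := mulmx1_unit i1; have [u2 _] := mulmx1_unit i2.
have v1 : invmx (block_mx 1%:M X 0 1%:M) = block_mx 1%:M (- X) 0 1%:M.
  by apply: (can_inj (mulKmx u1)); rewrite mulmxV.
have v2 : invmx (block_mx 1%:M 0 Z 1%:M) = block_mx 1%:M 0 (- Z) 1%:M.
  by apply: (can_inj (mulKmx u2)); rewrite mulmxV.
exists (block_mx 1%:M 0 Z 1%:M *m block_mx 1%:M X 0 1%:M), A', E'; split=> //.
  by rewrite unitmx_mul u1 u2.
rewrite -cj_comp //.
have -> : cj u (block_mx 1%:M X 0 1%:M) (block_mx A B C E) = block_mx A' 0 C E'.
  rewrite /cj v1 map_block_mx !map_mx1 map_mx0 !mulmx_block.
  rewrite !(mulmx1, mul1mx, mulmx0, mul0mx, addr0, add0r) mulmxN -/A' XE addNr.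
  by rewrite mulmxN addrC.
rewrite /cj v2 map_block_mx !map_mx1 map_mx0 !mulmx_block.
rewrite !(mulmx1, mul1mx, mulmx0, mul0mx, addr0, add0r) mulmxN ZE.
by rewrite addrN.
Qed.

(** The off-diagonal blocks of [G] intertwine [A] with [E]. As [A] is invertible and [E] divisible
    by [pi], such a block divisible by [pi^k] is divisible by [pi^(k+1)], hence is 0. *)
Lemma fitting_commute (t : {rmorphism L -> L}) (A : 'M[L]_m) (E : 'M[L]_n) (G : 'M[L]_(m + n)) :
  frob t -> GLO A -> gem E 1 ->
  map_mx t (block_mx A 0 0 E) *m G = map_mx u G *m block_mx A 0 0 E ->
  exists G1 G2, G = block_mx G1 0 0 G2.
Proof.
move=> ft gA hE; have [hA uA iA] := gA.
have [_ utA itA] : GLO (map_mx t A) by apply/frob_GLO.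
rewrite -[G]submxK; set G1 := ulsubmx G; set G2 := ursubmx G; set G3 := dlsubmx G.
set G4 := drsubmx G; rewrite !map_block_mx !mulmx_block !map_mx0.
rewrite !(mulmx0, mul0mx, addr0, add0r) => /eq_block_mx [_ e2 e3 _].
have up p q (X : 'M[L]_(p, q)) : (forall k, gem X k -> gem X (k + 1)) -> X = 0.
  move=> h; apply: gem_all0 => k; have [k0 [_ h0]] := gem_exists X.
  have hh i : gem X (k0 + i%:Z).
    elim: i => [|i /h]; first by rewrite addr0.
    by apply: gemW; lia.
  by apply: gemW (hh `|k - k0|%N); lia.
have z2 : G2 = 0.
  apply: up => k hk; rewrite -(mulKmx utA G2) e2; apply: intmM => //; apply: gemM => //.
  exact/frob_gem.
have z3 : G3 = 0.
  apply: up => k hk; apply/(frob_gem _ _ fu); rewrite -(mulmxK uA (map_mx u G3)) -e3.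
  apply: gemMint => //; rewrite addrC; apply: gemM => //; exact/frob_gem.
by exists G1, G4; rewrite z2 z3.
Qed.

End Fitting.

(** * Splitting off an isoclinic part *)

Section SlopeSplit.
Variable S : dvr.
Local Notation L := (dvr_field S).
Local Notation pi := (unif S).

Lemma exists_argmin (f : nat -> nat) : exists k, forall k', (f k <= f k')%N.
Proof.
suff H c : forall k, (f k <= c)%N -> exists k, forall k', (f k <= f k')%N by apply: (H (f 0%N) 0%N).
elim: c => [|c IH] k hk; first by exists k => k'; move: hk; rewrite leqn0 => /eqP ->.
have [[k' h]|h] := classic (exists k', (f k' <= c)%N); first exact: (IH k').
by exists k => k'; apply: leq_trans hk _; rewrite ltnNge; apply/negP => h'; apply: h; exists k'.
Qed.

Lemma resm_frob (u : {rmorphism L -> L}) (w : {rmorphism rfield S -> rfield S}) m n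
  (A : 'M[L]_(m, n)) : (forall x, ge_val (@dval S) x 0 -> res (u x) = w (res x)) ->
  intm A -> resm (map_mx u A) = map_mx w (resm A).
Proof. by move=> h hA; apply/matrixP => i j; rewrite !mxE h. Qed.

Lemma tpow_intm (t : {rmorphism L -> L}) n (G : 'M[L]_n) k : frob t -> intm G -> intm (tpow t G k).
Proof.
move=> ft hG; elim: k => [|k IH]; first exact: intm1.
by rewrite tpowS; apply: intmM => //; apply/frob_gem.
Qed.

Lemma unifz_exp (a : int) k : (pi ^ a) ^+ k = pi ^ (a * k%:Z).
Proof. by rewrite exprnP exprz_exp. Qed.

(** A power [D0] of the scaled iterate [D] has stable, positive residue rank. It splits into a
    bijective and a topologically nilpotent part, and [G] respects this splitting because it
    commutes with [D0] in the twisted sense. *)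
Lemma slope_split (t : {rmorphism L -> L}) n (G : 'M[L]_n) (s : nat) (a : int) :
  frob t -> G \in unitmx -> (0 < s)%N -> intm (pi ^ (- a) *: tpow t G s) ->
  (forall k, resm (tpow (itm t s) (pi ^ (- a) *: tpow t G s) k) <> 0) ->
  exists n1 n2 (e : (n1 + n2)%N = n) Q G1 G2 s1 a1,
    [/\ (0 < n1)%N, Q \in unitmx, (0 < s1)%N, GLO (pi ^ (- a1) *: tpow t (G1 : 'M[L]_n1) s1) &
        cj t Q G = castmx (e, e) (block_mx G1 0 0 G2)].
Proof.
move=> ft uG s0 hD nil; set D := pi ^ (- a) *: _ in hD nil.
have f0 := itm_frob s ft.
(* Minimising over [k.+1] keeps the exponent [k0] positive, hence also [s1]. *)
have [k0' kmin] := exists_argmin (fun k => \rank (resm (tpow (itm t s) D k.+1))).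
pose k0 := k0'.+1; pose u := itm (itm t s) k0.
have fu : frob u by apply: itm_frob.
pose s1 := (s * k0)%N; pose a1 := a * k0%:Z.
pose D0 := tpow (itm t s) D k0.
have D0E : D0 = pi ^ (- a1) *: tpow t G s1.
  by rewrite /D0 tpow_scale ?frob_unifz // unifz_exp mulNr -tpowM.
have hD0 : intm D0 by apply: tpow_intm.
set R := resm D0.
have R0 : (0 < \rank R)%N by rewrite lt0n mxrank_eq0; apply/eqP/nil.
(* The twisted square of [D0] is again a positive power of [D], so minimality bounds its rank from
   below. *)
have rk2 : (\rank R <= \rank (resm (map_mx u D0 *m D0)))%N.
  have := kmin (k0 + k0')%N; rewrite -addnS -/k0 tpowD -/D0 -/u; exact: leq_trans.
clearbody D0.
have [V [gV VE]] := lft_unitmx (row_ebase_unit R).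
have [hV uV iV] := gV.
pose D' := cj u V D0; pose G' := cj t V G.
have D'E : D' = pi ^ (- a1) *: tpow t G' s1.
  rewrite /D' /G' D0E tpow_cj // /cj -scalemxAr -scalemxAl; congr (_ *: (_ *m _ *m _)).
  exact: map_itmM.
have hD' : intm D'.
  by apply: gemMint => //; apply: intmM => //; apply/frob_gem.
have colD' i (j : 'I_n) : (\rank R <= j)%N -> ge_val (@dval S) (D' i j) 1.
  move=> lt; rewrite /D' /cj -mulmxA mxE; apply: ge_sum => k _; rewrite -[1]add0r.
  by apply: geM; [have /(frob_gem _ _ fu) := hV; apply|apply: row_ebase_col].
have [w wE] := frob_res fu.
have eqD : map_mx u D0 *m D0 = map_mx u (map_mx u (invmx V)) *m (map_mx u D' *m D') *m V.
  have iu : map_mx u (invmx V) *m map_mx u V = 1%:M by rewrite -map_mxM mulVmx // map_mx1.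
  have -> : map_mx u D' *m D' = map_mx u (map_mx u V) *m (map_mx u D0 *m D0) *m invmx V.
    rewrite /D' /cj !map_mxM -!mulmxA; congr (_ *m (_ *m _)).
    by rewrite mulmxA iu mul1mx.
  by rewrite mulmxA mulmxKV // mulmxA -map_mxM iu map_mx1 mul1mx.
clearbody D'.
have rk3 : (\rank R <= \rank (map_mx w (resm D') *m resm D'))%N.
  have hu : intm (map_mx u D') by apply/frob_gem.
  apply: leq_trans rk2 _; rewrite -(resm_frob wE) // -resmM // eqD.
  have h1 : intm (map_mx u D' *m D') by apply: intmM.
  have h2 : intm (map_mx u (map_mx u (invmx V))) by apply/(frob_gem _ _ fu)/(frob_gem _ _ fu).
  rewrite (resmM _ hV) ?(resmM h2 h1); last exact: intmM.
  by apply: leq_trans (mxrankM_maxl _ _) _; apply: mxrankM_maxr.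
have rn : (\rank R <= n)%N by apply: rank_leq_row.
clear VE; move: R0 colD' rk3 rn; move: (\rank R) => m m0 colD' rk3 rn.
have {rn} [n2 en] : exists n2, n = (m + n2)%N by exists (n - m)%N; rewrite subnKC.
subst n.
have hA := @gem_block S _ _ _ _ (ulsubmx D') (ursubmx D') (dlsubmx D') (drsubmx D') 0.
rewrite submxK in hA; have /hA [hA1 hA2 hA3 hA4] := hD'.
have hB : gem (ursubmx D') 1.
  by move=> i j; rewrite !mxE; apply: colD'; rewrite /= leq_addr.
have hE : gem (drsubmx D') 1.
  by move=> i j; rewrite !mxE; apply: colD'; rewrite /= leq_addr.
(* The residue of [D'] has zero last columns, so that of its twisted square factors through the
   upper left block; having rank at least [m], it forces this block to be invertible. *)
have gA : GLO (ulsubmx D').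
  apply: GLO_res => //; rewrite -row_full_unit /row_full eqn_leq rank_leq_col /=.
  apply: leq_trans rk3 _.
  have -> : resm D' = block_mx (resm (ulsubmx D')) 0 (resm (dlsubmx D')) 0.
    rewrite -[D' in LHS]submxK /resm map_block_mx; by congr block_mx; apply/resm_eq0.
  rewrite map_block_mx !map_mx0 mulmx_block !(mulmx0, mul0mx, addr0).
  set A := resm (ulsubmx D'); set C := resm (dlsubmx D').
  have -> : block_mx (map_mx w A *m A) 0 (map_mx w C *m A) 0 =
     col_mx (map_mx w A) (map_mx w C) *m A *m row_mx 1%:M (0 : 'M_(m, n2)).
    by rewrite mul_col_mx mul_col_row !mulmx1 !mulmx0.
  by apply: leq_trans (mxrankM_maxl _ _) _; apply: mxrankM_maxr.
have [Q [A' [E' [uQ gA' hE' QE]]]] := fitting_diag fu gA hB hA3 hE.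
rewrite submxK in QE.
have uG' : G' \in unitmx by apply: cj_unit.
pose G'' := cj t Q G'.
have DE : block_mx A' 0 0 E' = pi ^ (- a1) *: tpow t G'' s1.
  rewrite -QE D'E /G'' tpow_cj // /cj -scalemxAr -scalemxAl; congr (_ *: (_ *m _ *m _)).
  exact: map_itmM.
(* The commutation holds because, up to the scalar, both sides are the iterate of exponent [s1 + 1],
   unfolded at either end. *)
have [|G1 [G2 GE]] := fitting_commute fu ft gA' hE' (G := G'').
  rewrite DE map_mxZ frob_unifz // -scalemxAr -scalemxAl; congr (_ *: _).
  by rewrite /u map_itmM -/s1 -tpowS tpowSr.
exists m, n2, erefl, (Q *m V), G1, G2, s1, a1; split=> //.
- by rewrite unitmx_mul uQ.
- by rewrite /s1 muln_gt0 s0.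
- move: DE; rewrite GE tpow_diag scale_block_mx !scaler0 => /eq_block_mx [e _ _ _].
  by rewrite -e.
- by rewrite castmx_id -cj_comp.
Qed.
End SlopeSplit.

(** * Cyclic vectors and the smallest slope *)

Lemma first_dependence (F : fieldType) n (y : nat -> 'rV[F]_n) :
  exists m (c : 'rV_m), y m = c *m \matrix_(i < m) y i /\ row_free (\matrix_(i < m) y i).
Proof.
pose K m : 'M[F]_(m, n) := \matrix_(i < m) y i.
have step m : row_free (K m) -> ~~ (y m <= K m)%MS -> row_free (K m.+1).
  move=> fK ny; apply: inj_row_free => w; rewrite mulmx_sum_row big_ord_recr /= rowK /=.
  have -> : \sum_(i < m) w 0 (widen_ord (leqnSn m) i) *: row (widen_ord (leqnSn m) i) (K m.+1) =
    (\row_i w 0 (widen_ord (leqnSn m) i)) *m K m.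
    by rewrite mulmx_sum_row; apply: eq_bigr => i _; rewrite !rowK mxE.
  set w' := \row_i _ => e; have [w0|nw] := eqVneq (w 0 ord_max) 0.
    move: e; rewrite w0 scale0r addr0 => /eqP; rewrite mulmx_free_eq0 // => /eqP w'0.
    apply/rowP => i; rewrite mxE; have [lt|] := ltnP i m.
      by move/rowP: w'0 => /(_ (Ordinal lt)); rewrite !mxE => <-; congr (w _ _); apply: val_inj.
    move=> le; rewrite -w0; congr (w _ _); apply: val_inj => /=; have := ltn_ord i; lia.
  case/negP: ny; have -> : y m = (- (w 0 ord_max)^-1 *: w') *m K m.
    move/eqP: e; rewrite addr_eq0 => /eqP e; rewrite -scalemxAl e.
    by rewrite scaleNr scalerN opprK scalerA mulVf // scale1r.
  exact: submxMl.
have ex : exists m, (y m <= K m)%MS.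
  apply: NNPP => h; have all m : row_free (K m).
    elim: m => [|m IH]; first by rewrite /row_free -leqn0 rank_leq_row.
    by apply: step => //; apply/negP => hh; apply: h; exists m.
  have := rank_leq_col (K n.+1); move: (all n.+1); rewrite /row_free => /eqP ->.
  by rewrite ltnn.
case: (ex_minnP ex) => m /submxP [c cE] mmin; exists m, c; split=> //.
have : forall m', (m' <= m)%N -> row_free (K m').
  elim=> [|m' IH] lt; first by rewrite /row_free -leqn0 rank_leq_row.
  by apply: step; [apply/IH/ltnW|apply/negP => /mmin; lia].
exact.
Qed.

Lemma row_free_complete (F : fieldType) m n (K : 'M[F]_(m, n)) : row_free K ->
  exists n2 (K' : 'M_(n2, n)), (m + n2)%N = n /\ row_full (col_mx K K').
Proof.
move=> fK; exists (\rank K^C%MS), (row_base K^C%MS); split.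
  by have := mxrank_compl K; have := rank_leq_col K; move: fK; rewrite /row_free => /eqP ->; lia.
rewrite -sub1mx -addsmxE; have := addsmx_compl_full K; rewrite -sub1mx => h.
by apply: submx_trans h _; apply: addsmxS => //; rewrite eq_row_base.
Qed.

Section MinimalSlope.
Variable S : dvr.
Local Notation L := (dvr_field S).
Local Notation v := (@dval S).
Local Notation pi := (unif S).
Variable t : {rmorphism L -> L}.
Hypothesis ft : frob t.

(* [a / s] is the smallest slope, as witnessed by the standard lattice. *)
Definition min_slope n (G : 'M[L]_n) (s : nat) (a : int) : Prop :=
  [/\ (0 < s)%N, gem (tpow t G s) a & forall k, ~ gem (tpow t G (s * k)) (a * k%:Z + 1)].

Lemma gem_tpow (u : {rmorphism L -> L}) n (G : 'M[L]_n) a k :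
  frob u -> gem G a -> gem (tpow u G k) (a * k%:Z).
Proof.
move=> fu hG; elim: k => [|k IH]; first by rewrite mulr0; apply: intm1.
rewrite tpowS (_ : a * k.+1%:Z = a * k%:Z + a); last by lia.
by apply: gemM => //; apply/frob_gem.
Qed.

Lemma min_slope_mul n (G : 'M[L]_n) s a l : (0 < l)%N -> min_slope G s a ->
  min_slope G (s * l) (a * l%:Z).
Proof.
move=> l0 [s0 h1 h2]; split=> [||k]; first by rewrite muln_gt0 s0.
  by rewrite tpowM; apply: gem_tpow => //; apply: itm_frob.
by rewrite -mulnA -mulrA -PoszM; apply: h2.
Qed.

(** Over a common denominator [s] the candidate is the smaller numerator. The lower left block may
    violate the bound, but the change of basis [diag(1, c)] multiplies it by [c], a power of [pi]
    chosen large enough. *)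
Lemma min_slope_block m n (G1 : 'M[L]_m) (H : 'M_(n, m)) (G2 : 'M_n) s1 a1 s2 a2 :
  min_slope G1 s1 a1 -> min_slope G2 s2 a2 ->
  exists E s a, E \in unitmx /\ min_slope (cj t E (block_mx G1 0 H G2)) s a.
Proof.
move=> h1 h2; have [s10 _ _] := h1; have [s20 _ _] := h2.
have {}h1 := min_slope_mul s20 h1; have {}h2 := min_slope_mul s10 h2.
rewrite [(s2 * s1)%N]mulnC in h2; move: (s1 * s2)%N (a1 * _) (a2 * _) h1 h2 => s b1 b2.
move=> [s0 g1 k1] [_ g2 k2].
have [H' HE] := tpow_lblock t G1 H G2 s.
have [K [K0 hK]] := gem_exists H'.
pose a := Num.min b1 b2.
pose c := pi ^ (a - K); pose E : 'M[L]_(m + n) := block_mx 1%:M 0 0 c%:M.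
have nc : c != 0 by apply: unifz_neq0.
have uE : E \in unitmx by rewrite block_unitmx unitmx1 -scalemx1 scale_unitmx ?unitmx1.
have iE : invmx E = block_mx 1%:M 0 0 (c^-1)%:M.
  apply: (can_inj (mulKmx uE)); rewrite mulmxV // mulmx_block.
  rewrite !(mulmx0, mul0mx, addr0, add0r, mulmx1) -scalar_mxM mulfV //.
  by rewrite -scalar_mx_block.
have cjE (u : {rmorphism L -> L}) X1 X2 X3 : frob u ->
    cj u E (block_mx X1 0 X2 X3) = block_mx X1 0 (c *: X2) X3.
  move=> fu; rewrite /cj iE map_block_mx map_mx1 !map_mx0 map_scalar_mx /=.
  rewrite [u c]frob_unifz // -/c !mulmx_block.
  rewrite !(mulmx0, mul0mx, addr0, add0r, mulmx1, mul1mx) !mul_scalar_mx.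
  by rewrite -scalemxAl mul_mx_scalar scalerA mulfV // scale1r.
exists E, s, a; split=> //; split=> // [|k].
  rewrite tpow_cj // HE cjE; last exact: itm_frob.
  apply/gem_block; split; [|exact: gem0| |].
  - by apply: gemW g1; rewrite /a; lia.
  - by apply/gem_unifZ; apply: gemW hK; lia.
  - by apply: gemW g2; rewrite /a; lia.
have [H2 H2E] := tpow_lblock t G1 H G2 (s * k).
rewrite tpow_cj // H2E cjE; last exact: itm_frob.
move=> /gem_block [q1 _ _ q2]; rewrite /a in q1 q2.
case: (leP b1 b2) => lt.
  by apply: (k1 k); apply: gemW q1; rewrite min_l.
by apply: (k2 k); apply: gemW q2; rewrite min_r // ltW.
Qed.

Section Companion.
Variable m : nat.
Variables (G : 'M[L]_m.+1) (c : 'rV[L]_m.+1).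
Hypothesis Gdiag : forall i : 'I_m, row (widen_ord (leqnSn m) i) G = delta_mx 0 (lift ord0 i).
Hypothesis Glast : row ord_max G = c.
Hypothesis c0 : c != 0.

Lemma companion_coord0 x : Fmap t G x 0 ord0 = t (x 0 ord_max) * c 0 ord0.
Proof.
rewrite mxE big_ord_recr /= big1 ?add0r => [|i _].
  by rewrite mxE -Glast !mxE.
have /rowP /(_ ord0) := Gdiag i; rewrite !mxE => ->.
by rewrite eqxx /= mulr0.
Qed.

Lemma companion_coordS x (i : 'I_m) : Fmap t G x 0 (lift ord0 i) =
  t (x 0 (widen_ord (leqnSn m) i)) + t (x 0 ord_max) * c 0 (lift ord0 i).
Proof.
rewrite mxE big_ord_recr /= (bigD1 i) //= big1 ?addr0 => [|k nk].
  have /rowP /(_ (lift ord0 i)) := Gdiag i; rewrite !mxE => ->.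
  by rewrite !eqxx mulr1 -Glast !mxE.
have /rowP /(_ (lift ord0 i)) := Gdiag k; rewrite !mxE => ->.
by rewrite eqxx /= (inj_eq (@lift_inj _ _)) eq_sym (negPf nk) mulr0.
Qed.

Section Norm.
Variable s : nat.
Hypothesis s0 : (0 < s)%N.

(* [nv b x] says [val x >= b / s]. *)
Definition nv (b : int) (x : L) : bool := (x == 0) || (b <= s%:Z * v x).

Lemma nv0 b : nv b 0. Proof. by rewrite /nv eqxx. Qed.

Lemma nvW b b' x : b' <= b -> nv b x -> nv b' x.
Proof. by move=> le; rewrite /nv; case: eqP => //= _; apply: le_trans. Qed.

Lemma nvN b x : nv b (- x) = nv b x.
Proof. by rewrite /nv oppr_eq0; case: eqP => //= /eqP nx; rewrite dvalN. Qed.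

Lemma nvD b x y : nv b x -> nv b y -> nv b (x + y).
Proof.
rewrite /nv; have [->|nx] /= := eqVneq x 0; first by rewrite add0r.
have [->|ny] /= := eqVneq y 0; first by rewrite addr0 (negPf nx).
have [//|nxy] /= := eqVneq (x + y) 0 => h1 h2.
have := dvalD nx ny nxy; rewrite ge_min => /orP [] h.
  by apply: le_trans h1 _; rewrite ler_pM2l // ltz_nat.
by apply: le_trans h2 _; rewrite ler_pM2l // ltz_nat.
Qed.

Lemma nvDr b x y : nv b y -> nv b (x + y) -> nv b x.
Proof. by move=> hy h; rewrite -(addrK y x); apply: nvD => //; rewrite nvN. Qed.

Lemma nvM b b' x y : nv b x -> nv b' y -> nv (b + b') (x * y).
Proof.
rewrite /nv mulf_eq0; have [//|nx] /= := eqVneq x 0; have [//|ny] /= := eqVneq y 0.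
by rewrite dvalM // mulrDr => h1 h2; apply: lerD.
Qed.

Lemma nvM_exact b b' x y : ~~ nv (b + 1) x -> ~~ nv (b' + 1) y -> nv b x -> nv b' y ->
  ~~ nv (b + b' + 1) (x * y).
Proof.
rewrite /nv mulf_eq0; have [//|nx] /= := eqVneq x 0; have [//|ny] /= := eqVneq y 0.
rewrite dvalM // mulrDr; move: (_ * v x) (_ * v y) => p q; lia.
Qed.

Lemma nv_frob b x : nv b (t x) = nv b x.
Proof. by rewrite /nv fmorph_eq0; case: eqP => //= /eqP nx; case: ft => _ -> . Qed.

Variables (a : int) (i0 : 'I_m.+1).
Hypothesis cnv : forall j : 'I_m.+1, nv (m.+1%:Z * a - j%:Z * a) (c 0 j).

(** Level [r / s] of the norm in which the basis vector [e_j] has value [j a / s]. Under [cnv],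
    applying the semilinear map raises this norm by at least [a / s]. *)
Definition nge (x : 'rV[L]_m.+1) (r : int) := forall j : 'I_m.+1, nv (r - j%:Z * a) (x 0 j).

Lemma nge_step x r : nge x r -> nge (Fmap t G x) (r + a).
Proof.
move=> h j; have hl (l : 'I_m.+1) : nv (r + a - l%:Z * a) (t (x 0 ord_max) * c 0 l).
  have := nvM (x := t (x 0 ord_max)) (y := c 0 l) _ (cnv l).
  move=> /(_ (r - m%:Z * a)); rewrite nv_frob => /(_ (h ord_max)); apply: nvW.
  lia.
case: (unliftP ord0 j) => [i|] ->; last by rewrite companion_coord0.
rewrite companion_coordS; apply: nvD => //; rewrite nv_frob.
have := h (widen_ord (leqnSn m) i); apply: nvW; rewrite /= /bump /=; lia.
Qed.

Lemma iter_nge k x r : nge x r -> nge (iter k (Fmap t G) x) (r + k%:Z * a).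
Proof.
move=> h; elim: k => [|k IH]; first by rewrite mul0r addr0.
have := nge_step IH; rewrite (_ : r + k%:Z * a + a = r + k.+1%:Z * a) //; lia.
Qed.

Hypothesis cnv_lt : forall j : 'I_m.+1, (j < i0)%N -> nv (m.+1%:Z * a - j%:Z * a + 1) (c 0 j).
Hypothesis cnv_eq : ~~ nv (m.+1%:Z * a - i0%:Z * a + 1) (c 0 i0).

(** That the norm equals [r / s] need not persist under the map, as leading terms may cancel. What
    persists is that it is attained, and only at indices at least [i0], the first index where [cnv]
    is an equality. *)
Definition nexact (x : 'rV[L]_m.+1) (r : int) :=
  [/\ nge x r, forall j : 'I_m.+1, (j < i0)%N -> nv (r - j%:Z * a + 1) (x 0 j) &
      exists2 j : 'I_m.+1, (i0 <= j)%N & ~~ nv (r - j%:Z * a + 1) (x 0 j)].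

Lemma nexact_step x r : nexact x r -> nexact (Fmap t G x) (r + a).
Proof.
move=> [h1 h2 [j ij hj]]; split; first exact: nge_step.
  move=> l li; have hl : nv (r + a - l%:Z * a + 1) (t (x 0 ord_max) * c 0 l).
    have := nvM (x := t (x 0 ord_max)) (y := c 0 l) _ (cnv_lt li).
    move=> /(_ (r - m%:Z * a)); rewrite nv_frob => /(_ (h1 ord_max)); apply: nvW; lia.
  case: (unliftP ord0 l) li hl => [i|] -> li hl; last by rewrite companion_coord0.
  rewrite companion_coordS; apply: nvD => //; rewrite nv_frob.
  have := h2 (widen_ord (leqnSn m) i); move: li; rewrite /= /bump /= => li.
  by move=> /(_ ltac:(lia)); apply: nvW; lia.
(* If the last coordinate attains the norm, coordinate [i0] of the image does, since the term
   shifted from [i0 - 1] is strictly smaller. Otherwise the attaining index moves up by one. *)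
have [hm|hm] := boolP (nv (r - m%:Z * a + 1) (x 0 ord_max)); last first.
  exists i0 => //.
  have e0 : ~~ nv (r + a - i0%:Z * a + 1) (t (x 0 ord_max) * c 0 i0).
    rewrite -nv_frob in hm; have := nvM_exact hm cnv_eq.
    rewrite nv_frob => /(_ (h1 ord_max) (cnv i0)); apply: contra; apply: nvW; lia.
  move: h2 e0; case: (unliftP ord0 i0) => [i|] -> h2 e0; last by rewrite companion_coord0.
  rewrite companion_coordS [t _ + _]addrC; apply: contra e0 => hh; apply: (nvDr _ hh); rewrite nv_frob.
  have := h2 (widen_ord (leqnSn m) i); rewrite /= /bump /=.
  by move=> /(_ ltac:(lia)); apply: nvW; lia.
have jm : (j < m)%N.
  have := ltn_ord j; rewrite ltnS leq_eqVlt => /orP [/eqP e|//].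
  by case/negP: hj; rewrite (_ : j = ord_max) //; apply: val_inj.
exists (lift ord0 (Ordinal jm)); first by rewrite /= /bump /=; lia.
rewrite companion_coordS; apply: contra hj => h.
rewrite -nv_frob (_ : x 0 j = x 0 (widen_ord (leqnSn m) (Ordinal jm))); last first.
  by congr (x _ _); apply: val_inj.
apply: nvW (nvDr _ h); first by rewrite /= /bump /=; lia.
have := nvM (x := t (x 0 ord_max)) (y := c 0 (lift ord0 (Ordinal jm))) _ (cnv _).
move=> /(_ (r - m%:Z * a + 1)); rewrite nv_frob => /(_ hm); apply: nvW.
by rewrite /= /bump /=; lia.
Qed.

Lemma iter_nexact k x r : nexact x r -> nexact (iter k (Fmap t G) x) (r + k%:Z * a).
Proof.
move=> h; elim: k => [|k IH]; first by rewrite mul0r addr0.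
have := nexact_step IH; rewrite (_ : r + k%:Z * a + a = r + k.+1%:Z * a) //; lia.
Qed.

End Norm.

(** Newton polygon of the relation expressing the last iterate [m.+1] through [c]: the slope is the
    minimum of [val c_i / (m + 1 - i)], and [i0] is the first index reaching it. The lattice rounds
    the norm of [nge] to integral exponents. *)
Lemma companion_min_slope : exists E s a, E \in unitmx /\ min_slope (cj t E G) s a.
Proof.
pose F (i : 'I_m.+1) : rat := (v (c 0 i))%:~R / (m.+1 - i)%N%:R.
have [i1 ni1] : exists i, c 0 i != 0 by apply/rV0Pn.
case: (arg_minP F (ni1 : [pred i | c 0 i != 0] i1)) => i2 ni2 min2.
have P2 : [pred i | (c 0 i != 0) && (F i == F i2)] i2 by rewrite /= eqxx andbT.
case: (arg_minnP (fun i : 'I_m.+1 => i : nat) P2) => i0 /andP [ni0 /eqP F0] min0.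
pose s := (m.+1 - i0)%N; pose a := v (c 0 i0).
have s0 : (0 < s)%N by rewrite subn_gt0.
have FE (i j : 'I_m.+1) : (F i <= F j) = ((m.+1 - j)%N%:Z * v (c 0 i) <= (m.+1 - i)%N%:Z * v (c 0 j)).
  have pi' (k : 'I_m.+1) : 0 < ((m.+1 - k)%N%:R : rat) by rewrite ltr0n subn_gt0.
  rewrite /F ler_pdivrMr // mulrAC ler_pdivlMr // !pmulrn -!intrM ler_int.
  by rewrite mulrC [X in _ <= X]mulrC.
have cnv (j : 'I_m.+1) : nv s (m.+1%:Z * a - j%:Z * a) (c 0 j).
  rewrite /nv; have [//|nj] /= := eqVneq (c 0 j) 0.
  have := min2 j nj; rewrite -F0 FE -/s -/a; have := ltn_ord j; lia.
have cnv_lt (j : 'I_m.+1) : (j < i0)%N -> nv s (m.+1%:Z * a - j%:Z * a + 1) (c 0 j).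
  move=> ji; rewrite /nv; have [//|nj] /= := eqVneq (c 0 j) 0.
  have : ~~ (F j <= F i0).
    apply/negP => le; have := min0 j; rewrite /= nj /=.
    have -> : F j == F i2 by rewrite eq_le -{1}F0 le /=; apply: min2.
    by move=> /(_ isT); rewrite leqNgt ji.
  rewrite FE -/s -/a; have := ltn_ord j; lia.
have cnv_eq : ~~ nv s (m.+1%:Z * a - i0%:Z * a + 1) (c 0 i0).
  rewrite /nv (negPf ni0) /= -/a /s; have := ltn_ord i0; lia.
(* With [q j] the floor of [j a / s], the vector [pi^(-q j) e_j] has norm in [[0, 1)], and the
   integral levels of the norm are the multiples of one lattice. *)
pose q (j : 'I_m.+1) := (j%:Z * a %/ s%:Z)%Z.
have qE (j : 'I_m.+1) : exists2 r, j%:Z * a = q j * s%:Z + r & 0 <= r < s%:Z.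
  exists (j%:Z * a %% s%:Z)%Z; first exact: divz_eq.
  by rewrite modz_ge0 ?ltz_pmod; lia.
pose E := zdiag S (fun j => - q j).
have uE : E \in unitmx by apply: zdiag_unit.
have rowE i : row i E = pi ^ (- q i) *: delta_mx 0 i.
  apply/rowP => j; rewrite !mxE eqxx /= eq_sym.
  by rewrite mulr_natr.
have rowtp i k : row i (tpow t (cj t E G) k) = iter k (Fmap t G) (row i E) *m invmx E.
  rewrite tpow_cj // /cj map_zdiag; last exact: itm_frob.
  rewrite !row_mul iter_Fmap; congr (_ *m _ *m _); rewrite rowE map_mxZ frob_unifz; last exact: itm_frob.
  by rewrite map_delta_mx.
have gemE y b : nge s a y (s%:Z * b) <-> gem (y *m invmx E) b.
  rewrite invmx_zdiag; split=> h.
    move=> i j; rewrite !ord1 mul_zdiagE mulrC ge_unifM opprK; have := h j.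
    rewrite /nv /ge_val; case: eqP => //= _; have [r -> /andP [r0 rs]] := qE j.
    by move: (q j) (v _) => x y' hh; nia.
  move=> j; have := h 0 j; rewrite mul_zdiagE mulrC ge_unifM opprK.
  rewrite /nv /ge_val; case: eqP => //= _; have [r -> /andP [r0 rs]] := qE j.
  by move: (q j) (v _) => x y' hh; nia.
have ngeE i : nge s a (row i E) 0.
  move=> j; rewrite rowE !mxE eqxx /=; have [->|] := eqVneq j i; last by rewrite mulr0 nv0.
  rewrite mulr1 /nv (negPf (unifz_neq0 _ _)) dval_unifz /=.
  have [r -> /andP [r0 rs]] := qE i; nia.
exists E, s, a; split=> //; split=> // [|k hk].
  apply: intm_rows => i; rewrite rowtp; apply/gemE.
  by have := iter_nge s0 cnv s (ngeE i); rewrite add0r.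
have /gemE hg : gem (iter (s * k) (Fmap t G) (row i0 E) *m invmx E) (a * k%:Z + 1).
  by rewrite -rowtp => i j; rewrite mxE.
(* The vector [pi^(-q i0) e_i0] has norm exactly [r / s] with [r < s], so its iterates never reach
   the next integral level. *)
have [r rE /andP [r0 rs]] := qE i0; have hx : nexact s a i0 (row i0 E) r.
  split.
  - move=> j; rewrite rowE !mxE eqxx /=; have [->|] := eqVneq j i0; last by rewrite mulr0 nv0.
    by rewrite mulr1 /nv (negPf (unifz_neq0 _ _)) dval_unifz rE /=; nia.
  - move=> j ji; rewrite rowE !mxE eqxx /= (_ : j == i0 = false) ?mulr0 ?nv0 //.
    by apply/eqP => e; move: ji; rewrite e ltnn.
  - exists i0 => //; rewrite rowE !mxE !eqxx /=.
    by rewrite mulr1 /nv (negPf (unifz_neq0 _ _)) dval_unifz rE /=; nia.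
have [_ _ [j _ /negP []]] := iter_nexact s0 cnv cnv_lt cnv_eq (s * k) hx.
by apply: nvW (hg j); nia.
Qed.

End Companion.

Lemma min_slope_cj n (P G : 'M[L]_n) : P \in unitmx ->
  (exists E s a, E \in unitmx /\ min_slope (cj t E (cj t P G)) s a) ->
  exists E s a, E \in unitmx /\ min_slope (cj t E G) s a.
Proof.
move=> uP [E [s [a [uE h]]]]; exists (E *m P), s, a; rewrite -cj_comp // unitmx_mul uE.
by [].
Qed.

Lemma iter_Fmap_neq0 n (G : 'M[L]_n) x k : G \in unitmx -> x != 0 -> iter k (Fmap t G) x != 0.
Proof.
move=> uG nx; elim: k => //= k IH; apply: contra IH => /eqP h.
have : map_mx t (iter k (Fmap t G) x) = 0 by rewrite -(mulmxK uG (map_mx t _)) [_ *m G]h mul0mx.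
move/eqP; by rewrite map_mx_eq0 => /eqP ->.
Qed.

(** The iterates of a vector up to the first linear dependence span a stable subspace, on which the
    map is a companion matrix. The relation [c] is nonzero because the map is injective. *)
Lemma cyclic_decomposition n (G : 'M[L]_n) : G \in unitmx -> (0 < n)%N ->
  exists m n2 (e : (m.+1 + n2)%N = n) P (Gc : 'M[L]_m.+1) H G2 c,
  [/\ P \in unitmx, cj t P G = castmx (e, e) (block_mx Gc 0 H G2),
     forall i : 'I_m, row (widen_ord (leqnSn m) i) Gc = delta_mx 0 (lift ord0 i),
     row ord_max Gc = c & c != 0].
Proof.
move=> uG n0.
have [x nx] : exists x : 'rV[L]_n, x != 0.
  exists (delta_mx 0 (Ordinal n0)); apply/rV0Pn; exists (Ordinal n0).
  by rewrite mxE !eqxx oner_neq0.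
pose y k := iter k (Fmap t G) x.
have [[|m] [c [cE fK]]] := first_dependence y.
  by move: nx; rewrite -[x]/(y 0%N) cE [c]thinmx0 mul0mx eqxx.
set K := \matrix_(i < m.+1) y i in cE fK.
have nc : c != 0.
  have := iter_Fmap_neq0 m.+1 uG nx; rewrite -/(y m.+1) cE.
  by apply: contra => /eqP ->; rewrite mul0mx.
pose Gc : 'M[L]_m.+1 := \matrix_(i < m.+1) if unlift ord_max i is Some j then delta_mx 0 (lift ord0 j) else c.
have Gd (i : 'I_m) : row (widen_ord (leqnSn m) i) Gc = delta_mx 0 (lift ord0 i).
  rewrite rowK (_ : widen_ord _ _ = lift ord_max i) ?liftK //; apply: val_inj.
  by rewrite /= /bump leqNgt ltn_ord.
have Gl : row ord_max Gc = c by rewrite rowK unlift_none.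
have KE : map_mx t K *m G = Gc *m K.
  apply/row_matrixP => i; rewrite !row_mul -map_row rowK.
  have -> : map_mx t (y i) *m G = y i.+1 by [].
  case: (unliftP ord_max i) => [j|] ->; last by rewrite Gl -cE.
  rewrite (_ : lift ord_max j = widen_ord (leqnSn m) j); last first.
    by apply: val_inj; rewrite /= /bump leqNgt ltn_ord.
  by rewrite Gd -rowE rowK.
have [n2 [K' [e fP]]] := row_free_complete fK.
clearbody K; clear y cE fK; subst n.
have uP : col_mx K K' \in unitmx by rewrite -row_full_unit.
exists m, n2, erefl, (col_mx K K').
pose W := cj t (col_mx K K') G; exists Gc, (dlsubmx W), (drsubmx W), c; split=> //.
rewrite castmx_id -/W -[LHS]submxK.
have KP : K *m invmx (col_mx K K') = row_mx 1%:M 0.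
  have := mulmxV uP; rewrite mul_col_mx (scalar_mx_block m.+1 n2) /block_mx.
  by case/eq_col_mx.
have WE : W = col_mx (row_mx Gc 0) (map_mx t K' *m G *m invmx (col_mx K K')).
  by rewrite /W /cj map_col_mx !mul_col_mx KE -mulmxA KP mul_mx_row mulmx1 mulmx0.
congr block_mx; rewrite WE.
  by rewrite /ulsubmx col_mxKu row_mxKl.
by rewrite /ursubmx col_mxKu row_mxKr.
Qed.

Lemma min_slope_exists n (G : 'M[L]_n) : G \in unitmx -> (0 < n)%N ->
  exists E s a, E \in unitmx /\ min_slope (cj t E G) s a.
Proof.
have [N] := ubnP n; elim: N n G => // N IH n G nN uG n0.
have [m [n2 [e [P [Gc [H [G2 [c [uP PE Gd Gl nc]]]]]]]]] := cyclic_decomposition uG n0.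
subst n; rewrite castmx_id in PE.
apply: (min_slope_cj uP); rewrite PE.
have uB : block_mx Gc 0 H G2 \in unitmx by rewrite -PE cj_unit.
have [uGc uG2] : Gc \in unitmx /\ G2 \in unitmx.
  by move: uB; rewrite !unitmxE !unitfE det_lblock mulf_eq0 negb_or => /andP [].
have [E1 [s1 [a1 [uE1 h1]]]] := companion_min_slope Gd Gl nc.
have cjE E2 : E2 \in unitmx -> cj t (block_mx E1 0 0 E2) (block_mx Gc 0 H G2) =
  block_mx (cj t E1 Gc) 0 (map_mx t E2 *m H *m invmx E1) (cj t E2 G2).
  move=> uE2; rewrite /cj invmx_diag // map_block_mx !mulmx_block !map_mx0.
  by rewrite !(mul0mx, mulmx0, addr0, add0r).
(* In dimension 0 every divisibility holds and [min_slope] fails, so an empty complement is treated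
   apart. *)
have [n20|n2p] := posnP n2.
  subst n2; exists (block_mx E1 0 0 1%:M), s1, a1.
  rewrite block_unitmx uE1 unitmx1; split=> //; rewrite cjE ?unitmx1 //.
  move: (_ *m H *m _) (cj t 1%:M G2) => X Y; have [s0 g1 k1] := h1; split=> // [|k].
    have [X' ->] := tpow_lblock t (cj t E1 Gc) X Y s1.
    by apply/gem_block; split=> // [|[]|[]] //; apply: gem0.
  have [X' ->] := tpow_lblock t (cj t E1 Gc) X Y (s1 * k).
  by move/gem_block => [/k1].
have [|||E2 [s2 [a2 [uE2 h2]]]] := IH n2 G2 => //; first by lia.
apply: (min_slope_cj (P := block_mx E1 0 0 E2)); first by rewrite block_unitmx uE1.
rewrite cjE //; exact: min_slope_block h1 h2.
Qed.
End MinimalSlope.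

(** * Lattices adapted to an isoclinic map *)

Section IsoclinicLattice.
Variable S : dvr.
Local Notation L := (dvr_field S).
Local Notation pi := (unif S).

Lemma gem_bound_upto n (F : nat -> 'M[L]_n) (s : nat) :
  exists K : int, K <= 0 /\ forall r, (r < s)%N -> gem (F r) K.
Proof.
elim: s => [|s [K [K0 IH]]]; first by exists 0.
have [K' [K'0 h]] := gem_exists (F s); exists (Num.min K K'); split; first by lia.
move=> r; rewrite ltnS leq_eqVlt => /orP [/eqP ->|/IH h'].
  by apply: gemW h; lia.
by apply: gemW h'; lia.
Qed.

(* The lattice of all [x] such that [Phi^i x] lies in [pi^(floor (i a / s))] times the
   standard lattice for every [i]. *)
Lemma isoclinic_lattice (t : {rmorphism L -> L}) n (G : 'M[L]_n) (s : nat) (a c c' : int) :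
  frob t -> G \in unitmx -> (0 < s)%N -> GLO (pi ^ (- a) *: tpow t G s) ->
  c * s%:Z <= a <= c' * s%:Z ->
  exists E, [/\ E \in unitmx, gem (cj t E G) c & gem (invmx (cj t E G)) (- c')].
Proof.
move=> ft uG s0 gU /andP [ca ac].
pose e (i : nat) := (i%:Z * a %/ s%:Z)%Z.
have eE i : exists2 r, i%:Z * a = e i * s%:Z + r & 0 <= r < s%:Z.
  exists (i%:Z * a %% s%:Z)%Z; first exact: divz_eq.
  by rewrite modz_ge0 ?ltz_pmod; lia.
have eS i : c <= e i.+1 - e i <= c'.
  have [r1 e1 /andP [h1 h1']] := eE i; have [r2 e2 /andP [h2 h2']] := eE i.+1.
  by apply/andP; split; nia.
have es : e s = a by rewrite /e mulrC mulzK //; lia.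
have e0 : e 0%N = 0 by rewrite /e mul0r div0z.
have [hU uU iU] := gU.
have hts : gem (tpow t G s) a by have /gem_unifZ := hU; rewrite opprK add0r.
have uts : tpow t G s \in unitmx by apply: tpow_unit.
have its : gem (invmx (tpow t G s)) (- a).
  move: iU; rewrite invmxZ ?unitfE ?unifz_neq0 // invr_expz opprK => /gem_unifZ.
  by rewrite add0r.
pose M (x : 'rV[L]_n) := forall i, gem (iter i (Fmap t G) x) (e i).
have [K [K0 hK]] := gem_bound_upto (tpow t G) s.
have [E [[uE hE] _]] : exists E, basis_of E M /\ forall i j : 'I_n, (j < i)%N -> E i j = 0.
  (* [K] bounds the iterates of exponent below [s], and [s |a|] bounds the excess of the floor of
     [i a / s] over [a] times the floor of [i / s]. *)
  apply: (@sub_lattice S n M (s%:Z * `|a| - K) 0).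
  - move=> x y hx hy i; rewrite iter_Fmap map_mxD mulmxDl -!iter_Fmap.
    by apply: gemD.
  - move=> d x hd hx i; rewrite iter_Fmap map_mxZ -scalemxAl -iter_Fmap -[e i]add0r.
    by apply: gemZ => //; rewrite frob_ge //; apply: itm_frob.
  - move=> x hx i; rewrite iter_Fmap.
    have -> : tpow t G i = tpow t G (s * (i %/ s) + i %% s) by rewrite mulnC -divn_eq.
    rewrite tpowD tpowM; set q := (i %/ s)%N; set r := (i %% s)%N.
    have rs : (r < s)%N by rewrite ltn_mod.
    have hq := gem_tpow q (itm_frob s ft) hts.
    have hr : gem (map_mx (itm t (s * q)) (tpow t G r)) K.
      by apply/frob_gem; [apply: itm_frob|apply: hK].
    have hx' : gem (map_mx (itm t i) x) (s%:Z * `|a| - K) by apply/frob_gem => //; apply: itm_frob.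
    apply: gemW (gemM hx' (gemM hr hq)).
    have [r1 e1 /andP [h1 h1']] := eE i.
    have iE : i%:Z = s%:Z * q%:Z + r%:Z by rewrite -PoszM -PoszD mulnC -divn_eq.
    suff : e i - a * q%:Z <= s%:Z * `|a| by lia.
    have : (e i - a * q%:Z) * s%:Z <= r%:Z * a by rewrite iE in e1; nia.
    have : r%:Z * a <= s%:Z * `|a|.
      apply: le_trans (_ : r%:Z * `|a| <= _); first by rewrite ler_wpM2l // ler_norm.
      by rewrite ler_wpM2r // lez_nat ltnW.
    have := normr_ge0 a; move: (e i - _) `|a| (_ * a) => z y w y0 h2 h3.
    have [z0|z0] := leP z 0; first by nia.
    nia.
  - by move=> x hx; have := hx 0%N; rewrite e0.
have ME i : M (row i E) by apply/hE; apply: ospan_row.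
exists E; split=> //.
  apply: intm_rows => i; rewrite /cj row_mul row_mul -map_row.
  have : M (pi ^ (- c) *: Fmap t G (row i E)).
    move=> k; rewrite iter_Fmap map_mxZ frob_unifz; last exact: itm_frob.
    rewrite -scalemxAl -iter_Fmap -iterSr; apply/gem_unifZ; apply: gemW (ME i k.+1).
    by have := eS k; lia.
  move=> /hE /(ospanP _ uE); rewrite -scalemxAl => /gem_unifZ.
  by rewrite opprK add0r.
have utEG : map_mx t E *m G \in unitmx by rewrite unitmx_mul map_unitmx uE.
have -> : invmx (cj t E G) = E *m invmx G *m invmx (map_mx t E).
  by rewrite /cj invmxM ?unitmx_inv // invmxK invmxM ?map_unitmx // mulmxA.
apply: intm_rows => i; rewrite !row_mul.
(* [y] is the preimage of [pi^c'] times a basis vector. Its conditions at positive indices hold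
   because [e] grows by at most [c']; the one at index 0 is recovered from index [s], where the
   iterate is [pi^a] times an element of [GL(O)]. *)
have [y yE] := frob_surj (pi ^ c' *: (row i E *m invmx G)) ft.
have Fy : Fmap t G y = pi ^ c' *: row i E by rewrite /Fmap yE -scalemxAl mulmxKV.
have hS k : gem (iter k.+1 (Fmap t G) y) (e k.+1).
  rewrite iterSr Fy iter_Fmap map_mxZ frob_unifz; last exact: itm_frob.
  rewrite -scalemxAl -iter_Fmap; apply/gem_unifZ; apply: gemW (ME i k).
  by have := eS k; lia.
have : M y.
  case=> [|k]; last exact: hS.
  rewrite e0 /=; apply/(frob_gem _ _ (itm_frob s ft)).
  rewrite -(mulmxK uts (map_mx (itm t s) y)) -iter_Fmap.
  rewrite (_ : 0 = e s + - a); last by rewrite es subrr.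
  by apply: gemM => //; have := hS s.-1; rewrite prednK.
move=> /hE /(ospanP _ uE) /(frob_gem _ _ ft).
rewrite map_mxM yE map_invmx -scalemxAl => /gem_unifZ.
by rewrite add0r.
Qed.
End IsoclinicLattice.

(** * The slope decomposition in matrix form *)

Section SlopeData.
Variable S : dvr.
Local Notation L := (dvr_field S).
Local Notation v := (@dval S).
Local Notation pi := (unif S).
Variable t : {rmorphism L -> L}.
Hypothesis ft : frob t.

(* Entrywise form of the slope decomposition: [G] is block diagonal along the level
   sets of [nu], and on the block of slope [a / s] the matrix of [Phi^s] is [pi^a] times
   an element of [GL(O)]. *)
Definition slope_data n (G : 'M[L]_n) (nu : 'I_n -> rat) : Prop :=
  (forall k l, nu k != nu l -> G k l = 0) /\
  forall k l, ge_val v (tpow t G `|denq (nu k)| k l) (numq (nu k)) /\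
              ge_val v (invmx (tpow t G `|denq (nu k)|) k l) (- numq (nu k)).

Definition ord_cat (T : Type) m n (nu1 : 'I_m -> T) (nu2 : 'I_n -> T) (i : 'I_(m + n)) : T :=
  match split i with inl j => nu1 j | inr j => nu2 j end.

Lemma ord_catl (T : Type) m n (nu1 : 'I_m -> T) (nu2 : 'I_n -> T) i :
  ord_cat nu1 nu2 (lshift n i) = nu1 i.
Proof.
rewrite /ord_cat; case: split_ordP => j /eqP; last by rewrite eq_lrshift.
by rewrite eq_lshift => /eqP ->.
Qed.

Lemma ord_catr (T : Type) m n (nu1 : 'I_m -> T) (nu2 : 'I_n -> T) i :
  ord_cat nu1 nu2 (rshift m i) = nu2 i.
Proof.
rewrite /ord_cat; case: split_ordP => j /eqP; first by rewrite eq_rlshift.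
by rewrite eq_rshift => /eqP ->.
Qed.

Lemma slope_data_block m n (G1 : 'M[L]_m) (G2 : 'M[L]_n) nu1 nu2 :
  G1 \in unitmx -> G2 \in unitmx -> slope_data G1 nu1 -> slope_data G2 nu2 ->
  slope_data (block_mx G1 0 0 G2) (ord_cat nu1 nu2).
Proof.
move=> u1 u2 [z1 h1] [z2 h2]; split=> k l.
  case: (split_ordP k) => i ->; case: (split_ordP l) => j ->; rewrite ?ord_catl ?ord_catr => ne.
  - by rewrite block_mxEul z1.
  - by rewrite block_mxEur mxE.
  - by rewrite block_mxEdl mxE.
  - by rewrite block_mxEdr z2.
rewrite tpow_diag invmx_diag ?tpow_unit //.
case: (split_ordP k) => i ->; case: (split_ordP l) => j ->; rewrite ?ord_catl ?ord_catr.
- by rewrite !block_mxEul.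
- by rewrite !block_mxEur !mxE.
- by rewrite !block_mxEdl !mxE.
- by rewrite !block_mxEdr.
Qed.

(** Reduced to lowest terms, [a = k numq] and [s = k denq]. The iterate of exponent [denq] has the
    integral slope [numq], so [isoclinic_lattice] with equal bounds makes it [pi^numq] times an
    element of [GL(O)]. *)
Lemma slope_data_isoclinic n (G : 'M[L]_n) s a : G \in unitmx -> (0 < s)%N ->
  GLO (pi ^ (- a) *: tpow t G s) ->
  exists E, E \in unitmx /\ slope_data (cj t E G) (fun=> a%:~R / s%:Z%:~R).
Proof.
move=> uG s0 gU; set lam : rat := _ / _.
have [k k0 [aE sE]] : exists2 k : nat, (0 < k)%N & a = numq lam * k%:Z /\ s = (`|denq lam| * k)%N.
  have [k nk [aE sE]] : exists2 k : int, k != 0 & a = k * numq lam /\ s%:Z = k * denq lam.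
    have : s%:Z != 0 by lia.
    by rewrite /lam; case: divqP => [_|k x nk _]; rewrite ?eqxx //; exists k.
  exists `|k|%N; first by rewrite absz_gt0.
  have := denq_gt0 lam; move: sE; rewrite aE; move: (denq lam) (numq lam) => d b sE d0.
  have kp : 0 < k by nia.
  by split; [lia|apply/eqP; rewrite -eqz_nat PoszM !gez0_abs ?sE; nia].
have fu := itm_frob `|denq lam|%N ft.
have ut : tpow t G `|denq lam| \in unitmx by apply: tpow_unit.
have [||E [uE h1 h2]] := @isoclinic_lattice S (itm t `|denq lam|) n (tpow t G `|denq lam|)
  k a (numq lam) (numq lam) fu ut k0.
- by rewrite -tpowM -sE.
- by rewrite -aE lexx.
exists E; split=> //; split=> [i j|i j]; first by rewrite eqxx.
by rewrite tpow_cj.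
Qed.

(** Minimality of the slope says precisely that the scaled iterate is not nilpotent modulo [pi];
    [slope_split] then removes an isoclinic part of positive dimension, and induction applies to the
    rest. *)
Lemma slope_data_exists n (G : 'M[L]_n) : G \in unitmx ->
  exists P nu, P \in unitmx /\ slope_data (cj t P G) nu.
Proof.
have [N] := ubnP n; elim: N n G => // N IH n G nN uG.
have [n0|n0] := posnP n.
  subst n; exists 1%:M, (fun=> 0); rewrite unitmx1; split=> //.
  by split; case.
have [E [s [a [uE [s0 h1 h2]]]]] := min_slope_exists ft uG n0.
have hD : intm (pi ^ (- a) *: tpow t (cj t E G) s) by apply/gem_unifZ; rewrite opprK add0r.
have nil k : resm (tpow (itm t s) (pi ^ (- a) *: tpow t (cj t E G) s) k) <> 0.
  move/resm_eq0 => /(_ (tpow_intm k (itm_frob s ft) hD)).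
  rewrite tpow_scale ?frob_unifz //; last exact: itm_frob.
  rewrite unifz_exp -tpowM => /gem_unifZ; rewrite mulNr opprK addrC; exact: h2.
have [n1 [n2 [e [Q [G1 [G2 [s1 [a1 [n10 uQ s10 gU QE]]]]]]]]] :=
  slope_split ft (cj_unit t uE uG) s0 hD nil.
subst n; rewrite castmx_id in QE.
have uB : block_mx G1 0 0 G2 \in unitmx by rewrite -QE !cj_unit.
move: (uB); rewrite block_unitmx => /andP [u1 u2].
have [E1 [uE1 d1]] := slope_data_isoclinic u1 s10 gU.
have [|E2 [nu2 [uE2 d2]]] := IH n2 G2 _ u2; first by lia.
exists (block_mx E1 0 0 E2 *m (Q *m E)), (ord_cat (fun=> a1%:~R / s1%:Z%:~R) nu2).
have uE12 : block_mx E1 0 0 E2 \in unitmx by rewrite block_unitmx uE1.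
rewrite !unitmx_mul uE12 uQ uE; split=> //.
rewrite -cj_comp ?unitmx_mul ?uQ // -cj_comp // QE cj_diag //.
by apply: slope_data_block => //; apply: cj_unit.
Qed.

Lemma sorting_perm n (nu : 'I_n -> rat) :
  exists s : {perm 'I_n}, forall i j : 'I_n, (i <= j)%N -> nu (s j) <= nu (s i).
Proof.
pose tp := [tuple nu i | i < n].
have /tuple_permP [s sE] : perm_eq (sort_tuple >=%O tp) tp by rewrite /= perm_sort.
exists s => i j ij.
have nE (k : 'I_n) : nu (s k) = nth 0 (sort >=%O tp) k.
  by rewrite [sort _ _]sE -tnth_nth !tnth_map !tnth_ord_tuple.
rewrite !nE; have srt : sorted >=%O (sort >=%O tp) by apply: sort_sorted; apply: ge_total.
have := @sorted_leq_nth _ >=%O ge_trans ge_refl 0 _ srt i j.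
by rewrite !inE size_sort size_tuple !ltn_ord => /(_ isT isT ij).
Qed.

Lemma slope_data_perm n (G : 'M[L]_n) nu (s : {perm 'I_n}) : G \in unitmx -> slope_data G nu ->
  slope_data (cj t (perm_mx s) G) (fun i => nu (s i)).
Proof.
move=> uG [z h].
have map_perm (u : {rmorphism L -> L}) (s' : {perm 'I_n}) : map_mx u (perm_mx s') = perm_mx s'.
  by apply/matrixP => i j; rewrite !mxE; case: eqP; rewrite ?rmorph1 ?rmorph0.
have inv_perm (s' : {perm 'I_n}) : invmx (perm_mx s' : 'M[L]_n) = perm_mx s'^-1%g.
  apply: (can_inj (mulKmx (unitmx_perm _ s'))); rewrite mulmxV ?unitmx_perm //.
  by rewrite -perm_mxM mulgV perm_mx1.
have E (u : {rmorphism L -> L}) X i j : cj u (perm_mx s) X i j = X (s i) (s j).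
  by rewrite /cj map_perm inv_perm -row_permE -col_permE !mxE.
split=> k l; first by rewrite E; apply: z.
rewrite tpow_cj ?unitmx_perm // E; set m := `|_|%N.
have -> : invmx (cj (itm t m) (perm_mx s) (tpow t G m)) = cj (itm t m) (perm_mx s) (invmx (tpow t G m)).
  rewrite /cj map_perm !invmxM ?unitmx_mul ?unitmx_inv ?unitmx_perm ?tpow_unit //.
  by rewrite invmxK mulmxA.
by rewrite E; apply: h.
Qed.

Lemma sorted_slope_data_exists n (G : 'M[L]_n) : G \in unitmx ->
  exists P nu, [/\ P \in unitmx, slope_data (cj t P G) nu &
    forall i j : 'I_n, (i <= j)%N -> nu j <= nu i].
Proof.
move=> uG; have [P [nu [uP d]]] := slope_data_exists uG; have [s hs] := sorting_perm nu.
exists (perm_mx s *m P), (fun i => nu (s i)); rewrite unitmx_mul unitmx_perm uP; split=> //.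
by rewrite -cj_comp ?unitmx_perm //; apply: slope_data_perm => //; apply: cj_unit.
Qed.

Lemma denq_gt0_nat (q : rat) : (0 < `|denq q|)%N.
Proof. by rewrite absz_gt0 denq_neq0. Qed.

Lemma tpow_graded n (G : 'M[L]_n) (nu : 'I_n -> rat) k : 
  (forall i j, nu i != nu j -> G i j = 0) -> forall i j, nu i != nu j -> tpow t G k i j = 0.
Proof.
move=> z; elim: k => [|k IH] i j ne.
  by rewrite mxE; have [e|//] := eqVneq i j; rewrite e eqxx in ne.
rewrite tpowS mxE big1 // => l _; rewrite mxE.
have [e|ne'] := eqVneq (nu i) (nu l); last by rewrite IH // rmorph0 mul0r.
by rewrite z ?mulr0 // -e.
Qed.

(** Being graded by the level sets of [nu] amounts to commuting with the projectors [p x], which the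
    inverse inherits. *)
Lemma invmx_graded n (G : 'M[L]_n) (nu : 'I_n -> rat) : G \in unitmx ->
  (forall i j, nu i != nu j -> G i j = 0) -> forall i j, nu i != nu j -> invmx G i j = 0.
Proof.
move=> uG z i j ne; pose p (x : rat) : 'M[L]_n := diag_mx (\row_k (nu k == x)%:R).
have pE m x (A : 'M[L]_(n, m)) k l : (p x *m A) k l = (nu k == x)%:R * A k l.
  by rewrite mul_diag_mx !mxE.
have Ep m x (A : 'M[L]_(m, n)) k l : (A *m p x) k l = A k l * (nu l == x)%:R.
  by rewrite mul_mx_diag !mxE.
have com x : p x *m G = G *m p x.
  apply/matrixP => k l; rewrite pE Ep; have [e|nkl] := eqVneq (nu k) (nu l).
    by rewrite e mulrC.
  by rewrite z // mulr0 mul0r.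
have : p (nu i) *m invmx G = invmx G *m p (nu i).
  by apply: (can_inj (mulKmx uG)); rewrite mulmxA -com -mulmxA mulmxV // mulmx1 mulKVmx.
move/matrixP => /(_ i j); rewrite pE Ep eqxx mul1r [nu j == _]eq_sym (negPf ne) mulr0.
by [].
Qed.

End SlopeData.

Lemma card_ltn_ord n k : (k <= n)%N -> #|[pred j : 'I_n | (j < k)%N]| = k.
Proof. by move=> le; rewrite -sum1_card (big_ord_narrow le) sum1_card card_ord. Qed.

(** Serves to read the set where a sorted vector exceeds a bound as an initial segment. *)
Lemma prefix_card n (P : pred 'I_n) : (forall i j : 'I_n, (j <= i)%N -> P i -> P j) ->
  forall i : 'I_n, P i = (i < #|P|)%N.
Proof.
move=> cl i; apply/idP/idP => h.
  rewrite -(card_ltn_ord (ltn_ord i)); apply: subset_leq_card; apply/subsetP => j.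
  by rewrite inE ltnS => ji; apply: cl h.
apply: contraLR h => nP; rewrite -leqNgt -[X in (_ <= X)%N](card_ltn_ord (ltnW (ltn_ord i))).
apply: subset_leq_card; apply/subsetP => j Pj; rewrite inE ltnNge.
by apply: contra nP => ij; apply: cl Pj.
Qed.

(** * Comparison with the definition of the slope vector *)

Section SlopeVector.
Variable S : dvr.
Local Notation L := (dvr_field S).
Local Notation v := (@dval S).
Local Notation pi := (unif S).
Variable t : {rmorphism L -> L}.
Hypothesis ft : frob t.
Variable n : nat.
Implicit Types (C P : 'M[L]_n) (c x : 'rV[L]_n).

Lemma iter_Fmap_basis C P s c : P \in unitmx ->
  iter s (Fmap t C) (c *m P) = map_mx (itm t s) c *m tpow t (cj t P C) s *m P.
Proof.
move=> uP; rewrite iter_Fmap map_mxM tpow_cj // /cj !mulmxA mulmxKV //.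
Qed.

Lemma delta_intg k : intg_row v (delta_mx 0 k : 'rV[L]_n).
Proof. by move=> l; rewrite mxE /intg; case: andP => // _; apply: ge1. Qed.

Lemma delta_supp (nu : 'I_n -> rat) k l : nu l != nu k -> (delta_mx 0 k : 'rV[L]_n) 0 l = 0.
Proof. by rewrite mxE; have [->|//] := eqVneq l k; rewrite eqxx. Qed.

(** Both sides are compared on the rows of [P]: row [k] of a matrix holds the coordinates of the
    image of a basis vector of slope [nu k]. The bound on the inverse expresses that [pi^a Lam] is
    contained in the image of [Lam]. *)
Lemma slope_vectorE C (Ph : 'rV[L]_n -> 'rV[L]_n) nu : C \in unitmx -> Ph =1 Fmap t C ->
  slope_vector v pi Ph nu <->
  (forall i j : 'I_n, (i <= j)%N -> nu j <= nu i) /\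
  exists P, P \in unitmx /\ slope_data t (cj t P C) nu.
Proof.
move=> uC PhE; have itE s x : iter s Ph x = iter s (Fmap t C) x by apply: eq_iter.
split=> -[srt [P [uP h]]]; split=> //; exists P; split=> //; set G := cj t P C in h *.
  split=> [k l ne|k l].
    have [/(_ (delta_mx 0 k *m P)) hW _] := h (nu k).
    have [|c [hc cE]] := hW; first by exists (delta_mx 0 k); split=> // j; apply: delta_supp.
    have : row k G = c.
      apply: (can_inj (mulmxK uP)); rewrite -cE PhE -[Fmap _ _ _]/(iter 1 (Fmap t C) _).
      by rewrite iter_Fmap_basis // tpow1 map_delta_mx -rowE.
    by move/rowP => /(_ l); rewrite mxE => ->; apply: hc; rewrite eq_sym.
  have [_ hL] := h (nu k); set s := `|_|%N; set a := numq _.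
  have uT : tpow t G s \in unitmx by rewrite tpow_unit // cj_unit.
  split.
    have [|z [[c [hc _ ->]] zE]] := (hL (iter s Ph (delta_mx 0 k *m P))).1.
      exists (delta_mx 0 k *m P); split=> //; exists (delta_mx 0 k).
      by split=> //; [apply: delta_intg|move=> j; apply: delta_supp].
    have : row k (tpow t G s) = pi ^ a *: c.
      apply: (can_inj (mulmxK uP)); rewrite -scalemxAl -zE itE iter_Fmap_basis //.
      by rewrite map_delta_mx -rowE.
    by move/rowP => /(_ l); rewrite !mxE => ->; rewrite ge_unifM subrr; apply: hc.
  have [|z [[c [hc _ ->]] zE]] := (hL (pi ^ a *: (delta_mx 0 k *m P))).2.
    exists (delta_mx 0 k *m P); split=> //; exists (delta_mx 0 k).
    by split=> //; [apply: delta_intg|move=> j; apply: delta_supp].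
  have e : pi ^ a *: row k (invmx (tpow t G s)) = map_mx (itm t s) c.
    apply: (can_inj (mulmxK uT)); apply: (can_inj (mulmxK uP)).
    rewrite -iter_Fmap_basis // -itE -zE -!scalemxAl; congr (_ *: (_ *m _)).
    by rewrite -row_mul mulVmx // row1.
  have := hc l; rewrite /intg -(frob_ge _ _ (itm_frob s ft)).
  move/rowP: e => /(_ l); rewrite !mxE => <-; rewrite ge_unifM add0r.
  by [].
case: h => z h lam /=; split=> [x [c [hc ->]]|y].
  exists (map_mx t c *m G); split.
    move=> l ne; rewrite mxE big1 // => k _; rewrite mxE.
    have [e|ne'] := eqVneq (nu k) lam; last by rewrite hc // rmorph0 mul0r.
    by rewrite z ?mulr0 // e eq_sym.
  rewrite PhE -[Fmap _ _ _]/(iter 1 (Fmap t C) _) iter_Fmap_basis // tpow1.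
  by rewrite map_itm1.
set s := `|_|%N; set a := numq _.
have uT : tpow t G s \in unitmx by rewrite tpow_unit // cj_unit.
have fs := itm_frob s ft.
have zT := tpow_graded t s z; have ziT := invmx_graded uT zT.
have gr (d : 'rV[L]_n) (X : 'M[L]_n) : (forall i j, nu i != nu j -> X i j = 0) ->
    (forall k, nu k != lam -> d 0 k = 0) -> forall k, nu k != lam -> (d *m X) 0 k = 0.
  move=> hX hd k nk; rewrite mxE big1 // => l _.
  have [e|ne'] := eqVneq (nu l) lam; last by rewrite hd // mul0r.
  by rewrite hX ?mulr0 // e eq_sym.
split=> [[x [[c [hc hs ->]] ->]]|[x [[c [hc hs ->]] ->]]].
  rewrite itE iter_Fmap_basis //.
  pose d := map_mx (itm t s) c *m tpow t G s.
  exists (pi ^ (- a) *: d *m P); split.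
    exists (pi ^ (- a) *: d); split=> // k.
      rewrite mxE /intg ge_unifM opprK add0r mxE; apply: ge_sum => l _; rewrite mxE.
      have [e|ne] := eqVneq (nu l) lam; last by rewrite hs // rmorph0 mul0r.
      rewrite -[a]add0r; apply: geM; first by rewrite frob_ge //; apply: hc.
      by have [] := h l k; rewrite e.
    move=> nk; rewrite mxE; rewrite (gr _ _ zT) ?mulr0 // => l nl.
    by rewrite mxE hs // rmorph0.
  by rewrite -scalemxAl scalerA -expfzDr ?unif_neq0 // subrr expr0z scale1r.
pose d := pi ^ a *: (c *m invmx (tpow t G s)).
have [b bE] := frob_surj d fs.
have hd k : ge_val v (d 0 k) 0 /\ (nu k != lam -> d 0 k = 0).
  split; last by move=> nk; rewrite mxE (gr _ _ ziT) ?mulr0.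
  rewrite mxE ge_unifM add0r mxE; apply: ge_sum => l _.
  have [e|ne] := eqVneq (nu l) lam; last by rewrite hs // mul0r.
  rewrite -[- a]add0r; apply: geM; first exact: hc.
  by have [_] := h l k; rewrite e.
have bd k : d 0 k = itm t s (b 0 k) by rewrite -bE mxE.
exists (b *m P); split.
  exists b; split=> // k; first by have [+ _] := hd k; rewrite bd frob_ge.
  move=> nk; have [_ /(_ nk)] := hd k; rewrite bd => /eqP; rewrite fmorph_eq0 => /eqP.
  by [].
by rewrite itE iter_Fmap_basis // bE -!scalemxAl mulmxKV.
Qed.

End SlopeVector.

(** * Induction over the slopes; the sum of the slopes *)

Section SlopeInduction.
Variable S : dvr.
Local Notation L := (dvr_field S).
Local Notation pi := (unif S).
Variable t : {rmorphism L -> L}.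
Hypothesis ft : frob t.

Lemma slope_data_split m n (G : 'M[L]_(m + n)) nu :
  G \in unitmx -> slope_data t G nu ->
  (forall i j, nu (lshift n i) != nu (rshift m j)) ->
  exists G1 G2, [/\ G = block_mx G1 0 0 G2, G1 \in unitmx, G2 \in unitmx,
    slope_data t G1 (fun i => nu (lshift n i)) & slope_data t G2 (fun j => nu (rshift m j))].
Proof.
move=> uG [z h] ne.
have [G1 [G2 GE]] : exists G1 G2, G = block_mx G1 0 0 G2.
  exists (ulsubmx G), (drsubmx G).
  rewrite -[LHS]submxK; congr block_mx; apply/matrixP => i j; rewrite !mxE z //.
  by rewrite eq_sym.
subst G; exists G1, G2; move: (uG); rewrite block_unitmx => /andP [u1 u2]; split=> //.
  split=> k l.
    by move=> nkl; have := z (lshift n k) (lshift n l) nkl; rewrite block_mxEul.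
  have := h (lshift n k) (lshift n l); rewrite tpow_diag invmx_diag ?tpow_unit //.
  by rewrite !block_mxEul.
split=> k l.
  by move=> nkl; have := z (rshift m k) (rshift m l) nkl; rewrite block_mxEdr.
have := h (rshift m k) (rshift m l); rewrite tpow_diag invmx_diag ?tpow_unit //.
by rewrite !block_mxEdr.
Qed.

(* Blocks of equal slope are contiguous because [nu] is sorted. *)
Lemma slope_data_ind (Q : forall n, 'M[L]_n -> ('I_n -> rat) -> Prop) :
  (forall n G nu nu', nu =1 nu' -> Q n G nu -> Q n G nu') ->
  (forall n (G : 'M[L]_n) (lam : rat), G \in unitmx ->
     GLO (pi ^ (- numq lam) *: tpow t G `|denq lam|) -> Q n G (fun=> lam)) ->
  (forall m n (G1 : 'M[L]_m) (G2 : 'M[L]_n) (lam : rat) nu2, G1 \in unitmx -> G2 \in unitmx ->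
     (forall j, nu2 j != lam) ->
     Q m G1 (fun=> lam) -> Q n G2 nu2 -> Q _ (block_mx G1 0 0 G2) (ord_cat (fun=> lam) nu2)) ->
  forall n G nu, G \in unitmx -> slope_data t G nu ->
    (forall i j : 'I_n, (i <= j)%N -> nu j <= nu i) -> Q n G nu.
Proof.
move=> Qext Q1 Q2 n G nu uG; have [N] := ubnP n; elim: N n G nu uG => // N IH n G nu uG nN d srt.
have iso m (G1 : 'M[L]_m) lam : G1 \in unitmx -> slope_data t G1 (fun=> lam) -> Q m G1 (fun=> lam).
  move=> u1 [_ h1]; apply: Q1 => //; split.
  - by apply/gem_unifZ => i j; rewrite opprK add0r; have [] := h1 i j.
  - by rewrite scale_unitmx ?unifz_neq0 // tpow_unit.
  - rewrite invmxZ ?scale_unitmx ?unifz_neq0 ?tpow_unit // invr_expz opprK.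
    by apply/gem_unifZ => i j; rewrite add0r; have [] := h1 i j.
case: n G nu uG nN d srt => [|n] G nu uG nN d srt.
  by apply: (Qext _ _ (fun=> 0)); [case|apply: iso => //; split; case].
pose lam := nu 0; pose m := #|[pred i : 'I_n.+1 | nu i == lam]|.
have mP (i : 'I_n.+1) : (nu i == lam) = (i < m)%N.
  rewrite -[LHS]/([pred i : 'I_n.+1 | nu i == lam] i); apply: prefix_card => {}i j ji /= /eqP e.
  by rewrite eq_le /lam srt //= -/lam -e srt.
have m0 : (0 < m)%N by rewrite -(mP 0).
have mn : (m <= n.+1)%N by rewrite -[X in (_ <= X)%N]card_ord max_card.
have [n2 e] : exists n2, n.+1 = (m + n2)%N by exists (n.+1 - m)%N; rewrite subnKC.
have {mn} lamE : (forall i j : 'I_n.+1, (i < m)%N -> ~~ (j < m)%N -> nu i != nu j) /\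
    (forall i : 'I_n.+1, (i < m)%N -> nu i = lam).
  by split=> [i j|i]; rewrite -!mP => /eqP //= ->; rewrite eq_sym.
clear mP; clearbody m; clearbody lam; case: lamE.
move: n.+1 e G nu uG nN d srt => n' e; subst n' => G nu uG nN d srt ne lamE.
have [|G1 [G2 [-> u1 u2 d1 d2]]] := slope_data_split uG d.
  by move=> i j; apply: ne; rewrite /= ?ltn_ord // -leqNgt leq_addr.
apply: (Qext _ _ (ord_cat (fun=> lam) (fun j => nu (rshift m j)))).
  move=> i; case: (split_ordP i) => j ->; rewrite ?ord_catl ?ord_catr //.
  by rewrite lamE //= ltn_ord.
apply: Q2 => //.
- move=> j; pose i0 : 'I_m := Ordinal m0.
  rewrite -(lamE (lshift n2 i0) m0) eq_sym; apply: ne => //=.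
  by rewrite -leqNgt leq_addr.
- apply: iso => //; case: d1 => z1 h1; split=> k l; first by rewrite eqxx.
  by have := h1 k l; rewrite lamE //= ltn_ord.
- apply: IH => //; first by lia.
  by move=> i j ij; apply: srt; rewrite /= leq_add2l.
Qed.

(** An element of [GL(O)] has determinant of valuation 0, so [denq lam] times [vdet G] equals [n]
    times [numq lam]. *)
Lemma isoclinic_vdet n (G : 'M[L]_n) (lam : rat) : G \in unitmx ->
  GLO (pi ^ (- numq lam) *: tpow t G `|denq lam|) -> (vdet G)%:~R = \sum_(i < n) lam.
Proof.
move=> uG /vdet_GLO; rewrite vdet_scale ?unifz_neq0 ?tpow_unit // vdet_tpow //.
rewrite dval_unifz sumr_const card_ord => h.
have d0 : (denq lam)%:~R != 0 :> rat by rewrite intr_eq0 denq_neq0.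
have hh : (denq lam) * vdet G = numq lam *+ n.
  rewrite -{1}(gez0_abs (ltW (denq_gt0 lam))) -natz mulr_natl.
  by move: h; rewrite mulNrn => /eqP; rewrite addrC subr_eq0 => /eqP.
have lE : lam * (denq lam)%:~R = (numq lam)%:~R by rewrite -[X in X * _]divq_num_den divfK.
by apply: (mulfI d0); rewrite -intrM hh rmorphMn /= -lE mulrC mulrnAr.
Qed.

Lemma slope_data_vdet n (G : 'M[L]_n) nu : G \in unitmx -> slope_data t G nu ->
  (forall i j : 'I_n, (i <= j)%N -> nu j <= nu i) -> (vdet G)%:~R = \sum_i nu i.
Proof.
apply: (slope_data_ind (Q := fun n G nu => (vdet G)%:~R = \sum_i nu i)) => {n G nu}.
- by move=> n G nu nu' e ->; apply: eq_bigr => i _; rewrite e.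
- by move=> n G lam; apply: isoclinic_vdet.
- move=> m n G1 G2 lam nu2 u1 u2 _ h1 h2; rewrite vdet_block // rmorphD /= h1 h2.
  rewrite big_split_ord /=.
  by congr (_ + _); apply: eq_bigr => i _; rewrite ?ord_catl ?ord_catr.
Qed.
End SlopeInduction.

(** * Lattices whose elementary divisors round the slopes *)

Section HodgeLattice.
Variable S : dvr.
Local Notation L := (dvr_field S).
Local Notation pi := (unif S).
Variable t : {rmorphism L -> L}.
Hypothesis ft : frob t.

Lemma zdiag_block m n (e1 : 'I_m -> int) (e2 : 'I_n -> int) :
  zdiag S (ord_cat e1 e2) = block_mx (zdiag S e1) 0 0 (zdiag S e2).
Proof.
apply/matrixP => i j; case: (split_ordP i) => a ->; case: (split_ordP j) => b ->.
- by rewrite block_mxEul !mxE ord_catl eq_lshift.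
- by rewrite block_mxEur !mxE eq_lrshift.
- by rewrite block_mxEdl !mxE eq_rlshift.
- by rewrite block_mxEdr !mxE ord_catr eq_rshift.
Qed.

Lemma zdiag_scale n (e : 'I_n -> int) c : pi ^ c *: zdiag S e = zdiag S (fun i => c + e i).
Proof.
by apply/matrixP => i j; rewrite !mxE mulrnAr expfzDr ?unif_neq0.
Qed.

(** [lam] lists the elementary divisors on a suitable lattice. Quantifying over integers [c] says,
    without floors, that [lam k] is at least the floor of [nu k] and at most that floor plus 1. The
    predicate [Q] selects a union of level sets of [nu], on which the sums agree. *)
Definition hodge_of n (G : 'M[L]_n) (nu : 'I_n -> rat) : Prop :=
  exists E W1 W2 (lam : 'I_n -> int), [/\ E \in unitmx, GLO W1, GLO W2,
    cj t E G = W1 *m zdiag S lam *m W2 &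
    [/\ forall k (c : int), c%:~R <= nu k -> c <= lam k,
        forall k (c : int), nu k < c%:~R -> lam k <= c &
        forall Q : pred rat, \sum_(k | Q (nu k)) (lam k)%:~R = \sum_(k | Q (nu k)) nu k]].

(** On the lattice of [isoclinic_lattice] with bounds [c], the floor of [lam], and [c + 1], the
    matrix scaled by [pi^(-c)] has elementary divisors 0 and 1. The sum of the divisors is the
    valuation of the determinant, hence the sum of the slopes. *)
Lemma isoclinic_hodge n (G : 'M[L]_n) (lam : rat) : G \in unitmx ->
  GLO (pi ^ (- numq lam) *: tpow t G `|denq lam|) -> hodge_of G (fun=> lam).
Proof.
move=> uG gU; pose s := `|denq lam|%N; pose a := numq lam; pose c := (a %/ s%:Z)%Z.
have s0 : (0 < s)%N := denq_gt0_nat lam.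
have sE : s%:Z = denq lam by rewrite gez0_abs // ltW // denq_gt0.
have sp : 0 < s%:Z by lia.
have cle (d : int) : (d%:~R <= lam) = (d <= c).
  rewrite /c lez_divRL // -{1}[lam]divq_num_den ler_pdivlMr ?ltr0z ?denq_gt0 //.
  by rewrite -intrM ler_int -sE.
have clt (d : int) : (lam < d%:~R) = (c < d) by rewrite ltNge cle -ltNge.
have [|E [uE h1 h2]] := isoclinic_lattice (c := c) (c' := c + 1) ft uG s0 gU.
  have := divz_eq a s%:Z; rewrite -/c -/a; have := ltz_pmod a sp.
  have : 0 <= (a %% s%:Z)%Z by rewrite modz_ge0; lia.
  by rewrite /s mulrDl mul1r => *; apply/andP; split; lia.
have uX : cj t E G \in unitmx by apply: cj_unit.
have [|||m [U [V [mn gU' gV XE]]]] := minuscule_smith (G := pi ^ (- c) *: cj t E G).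
- by rewrite scale_unitmx ?unifz_neq0.
- by apply/gem_unifZ; rewrite opprK add0r.
- rewrite invmxZ ?scale_unitmx ?unifz_neq0 // invr_expz opprK scalerA.
  rewrite -{1}[pi]expr1z -expfzDr ?unif_neq0 //; apply/gem_unifZ.
  by rewrite add0r addrC.
have cjE : cj t E G = U *m zdiag S (fun i : 'I_n => c + (m <= i)%N%:Z) *m V.
  rewrite -zdiag_scale -scalemxAr -scalemxAl -XE scalerA -expfzDr ?unif_neq0 //.
  by rewrite subrr expr0z scale1r.
exists E, U, V, (fun i : 'I_n => c + (m <= i)%N%:Z); split=> //; split.
- by move=> k d; rewrite cle; case: (m <= k)%N; lia.
- by move=> k d; rewrite clt; case: (m <= k)%N; lia.
move=> Q; case: (Q lam); last by rewrite !big_pred0_eq.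
rewrite -(isoclinic_vdet ft uG gU) -(vdet_cj ft uE uG) cjE.
rewrite !vdetM ?unitmx_mul ?(GLO_unit gU') ?(GLO_unit gV) ?zdiag_unit //.
by rewrite (vdet_GLO gU') (vdet_GLO gV) add0r addr0 vdet_zdiag rmorph_sum.
Qed.

Lemma slope_data_hodge n (G : 'M[L]_n) nu : G \in unitmx -> slope_data t G nu ->
  (forall i j : 'I_n, (i <= j)%N -> nu j <= nu i) -> hodge_of G nu.
Proof.
apply: (slope_data_ind (Q := fun n G nu => hodge_of G nu)) => {n G nu}.
- move=> n G nu nu' e [E [W1 [W2 [lam [uE g1 g2 cE [h1 h2 h3]]]]]].
  exists E, W1, W2, lam; split=> //; split=> [k c|k c|x].
  + by rewrite -e; apply: h1.
  + by rewrite -e; apply: h2.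
  + have := h3 x; rewrite (eq_bigl (fun k => x (nu' k))) => [->|k]; last by rewrite e.
    by apply: eq_big => k; rewrite e.
- by move=> n G lam; apply: isoclinic_hodge.
move=> m n G1 G2 lam nu2 u1 u2 _ [E1 [V1 [V2 [l1 [uE1 g1 g2 c1 [h1 h2 h3]]]]]].
move=> [E2 [W1 [W2 [l2 [uE2 k1 k2 c2 [q1 q2 q3]]]]]].
exists (block_mx E1 0 0 E2), (block_mx V1 0 0 W1), (block_mx V2 0 0 W2), (ord_cat l1 l2).
split; [by rewrite block_unitmx uE1|exact: GLO_block|exact: GLO_block| |].
  rewrite cj_diag // c1 c2 zdiag_block !mulmx_block.
  by rewrite !(mul0mx, mulmx0, addr0, add0r).
split=> [k c|k c|x].
- by case: (split_ordP k) => i ->; rewrite ?ord_catl ?ord_catr; [apply: h1|apply: q1].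
- by case: (split_ordP k) => i ->; rewrite ?ord_catl ?ord_catr; [apply: h2|apply: q2].
rewrite !big_split_ord /=; congr (_ + _).
  transitivity (\sum_(k | x ((fun=> lam) k)) (l1 k)%:~R : rat).
    by apply: eq_big => k; rewrite !ord_catl.
  by rewrite h3; apply: eq_big => k; rewrite ord_catl.
transitivity (\sum_(k | x (nu2 k)) (l2 k)%:~R : rat).
  by apply: eq_big => k; rewrite !ord_catr.
by rewrite q3; apply: eq_big => k; rewrite ord_catr.
Qed.
End HodgeLattice.

(** * 0/1 matrices with prescribed row and column sums *)

Lemma top_set n (lam : 'I_n -> int) r : (r <= n)%N ->
  exists A : {set 'I_n}, #|A| = r /\ forall l i, l \in A -> i \notin A -> lam i <= lam l.
Proof.
elim: r => [|r IH] rn; first by exists set0; rewrite cards0; split=> // l i; rewrite inE.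
have [A [cA hA]] := IH (ltnW rn).
have [i0 hi0] : exists i, i \notin A.
  have /set0Pn [i] : ~: A != set0.
    by rewrite -card_gt0; have := cardsC A; rewrite card_ord; lia.
  by rewrite inE; exists i.
have [l lA lmax] := arg_maxP lam (P := [pred i | i \notin A]) hi0.
rewrite /= in lA; exists (l |: A); rewrite cardsU1 lA cA; split=> // l' i.
rewrite !inE negb_or => /orP [/eqP ->|l'A] /andP [_ iA]; last exact: hA.
exact: lmax.
Qed.

Lemma minn_concave (s r : nat) : (0 < s)%N ->
  (minn s.+1 r)%:Z + (minn s.-1 r)%:Z <= (minn s r)%:Z + (minn s r)%:Z.
Proof. lia. Qed.

(* Gale-Ryser, greedily: the first column takes the rows with the largest sums. A violating
   row set for the rest is chosen with largest trace on these rows, then smallest. *)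
Lemma gale_ryser n f (r : 'I_f -> nat) (lam : 'I_n -> int) :
  (forall j, (r j <= n)%N) ->
  (forall T : {set 'I_n}, \sum_(i in T) lam i <= \sum_j (minn #|T| (r j))%:Z) ->
  \sum_i lam i = \sum_j (r j)%:Z ->
  exists eps : 'I_f -> {set 'I_n}, (forall j, #|eps j| = r j) /\
    forall i, lam i = \sum_j (i \in eps j)%:Z.
Proof.
elim: f r lam => [|f IH] r lam rn dom tot.
  exists (fun=> set0); split=> [[]//|i]; rewrite big_ord0.
  have le0 k : lam k <= 0 by have := dom [set k]; rewrite big_set1 big_ord0.
  have : \sum_i - lam i = 0 by rewrite sumrN tot big_ord0 oppr0.
  move/eqP; rewrite psumr_eq0 => [|k _]; last by rewrite oppr_ge0.
  by move/allP => /(_ i); rewrite mem_index_enum => /(_ isT) /=; rewrite oppr_eq0 => /eqP.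
pose r' j := r (lift ord0 j); pose h k := \sum_j (minn k (r' j))%:Z.
have [A [cA topA]] := top_set lam (rn ord0).
pose lam' i := lam i - (i \in A)%:Z.
have lam'E (T : {set 'I_n}) : \sum_(i in T) lam' i = \sum_(i in T) lam i - #|T :&: A|%:Z.
  rewrite big_split /= sumrN; congr (_ - _).
  rewrite -sum1_card -natz natr_sum big_mkcond [in RHS]big_mkcond /=; apply: eq_bigr => i _.
  by rewrite inE; case: (i \in T); case: (i \in A).
have hconc s : (0 < s)%N -> h s.+1 + h s.-1 <= h s + h s.
  by move=> s0; rewrite -!big_split /=; apply: ler_sum => j _; apply: minn_concave.
have viol (T : {set 'I_n}) : \sum_(i in T) lam' i <= h #|T|.
  rewrite leNgt; apply/negP => bad.
  pose P (T : {set 'I_n}) := h #|T| < \sum_(i in T) lam' i.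
  (* The factor [n.+2] exceeds any difference of cardinalities, so the weight is lexicographic. *)
  pose mu (T : {set 'I_n}) := (#|T| + n.+2 * (n - #|T :&: A|))%N.
  have [T0 bad0 min0] := arg_minnP mu (bad : P T); rewrite /P in bad0 min0.
  have capn (U : {set 'I_n}) : (#|U :&: A| <= n)%N by rewrite -[X in (_ <= X)%N]card_ord max_card.
  have good U : (mu U < mu T0)%N -> \sum_(i in U) lam' i <= h #|U|.
    by move=> lt; rewrite leNgt; apply/negP => /min0; rewrite leqNgt lt.
  have dom0 : \sum_(i in T0) lam i <= (minn #|T0| (r ord0))%:Z + h #|T0|.
    by have := dom T0; rewrite big_ord_recl.
  have [sTA|/subsetPn [i iT iA]] := boolP (T0 \subset A).
    move: bad0; rewrite lam'E (setIidPl sTA).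
    have := subset_leq_card sTA; rewrite cA.
    move: dom0; move: (\sum_(i in _) _) (h _) => z z'; lia.
  have [sAT|/subsetPn [l lA lT]] := boolP (A \subset T0).
    move: bad0; rewrite lam'E (setIidPr sAT) cA; have := subset_leq_card sAT; rewrite cA.
    move: dom0; move: (\sum_(i in _) _) (h _) => z z'; lia.
  (* Adding [l] or removing [i] lowers the weight, so both sets satisfy the bound; concavity of [h]
     together with [lam i <= lam l] then contradicts the violation at [T0]. *)
  have li := topA l i lA iA.
  have c1 : #|l |: T0| = #|T0|.+1 by rewrite cardsU1 lT.
  have c2 : #|T0| = #|T0 :\ i|.+1 by rewrite [LHS](cardsD1 i) iT.
  have g1 := good (l |: T0); have g2 := good (T0 :\ i).
  have x1 : #|(l |: T0) :&: A| = #|T0 :&: A|.+1.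
    rewrite (_ : (l |: T0) :&: A = l |: (T0 :&: A)) ?cardsU1 ?inE ?(negPf lT) //.
    by apply/setP => x; rewrite !inE; case: eqP => // ->; rewrite lA.
  have x2 : (T0 :\ i) :&: A = T0 :&: A.
    by apply/setP => x; rewrite !inE; case: eqP => // ->; rewrite (negPf iA) /= andbF.
  have := g1; rewrite /mu x1 c1 big_setU1 //= => {}g1.
  have := g2; rewrite /mu x2 c2 => {}g2.
  have s2 : \sum_(k in T0) lam' k = lam' i + \sum_(k in T0 :\ i) lam' k by rewrite (big_setD1 i).
  have := hconc #|T0|; rewrite c2 /= => /(_ isT).
  have := capn (l |: T0); rewrite x1.
  move: bad0 g1 g2; rewrite s2 c2 /lam' lA (negPf iA).
  move: (\sum_(k in _) _) (h _.+2) => z h2; move: (h _.+1) => h1; move: (h _) => h0.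
  move: (#|T0 :\ i|) (#|T0 :&: A|) => x y.
  move=> q1 q2 q3 q4 q5.
  have := q2 ltac:(nia); have := q3 ltac:(nia); lia.
have tot' : \sum_i lam' i = \sum_j (r' j)%:Z.
  have tT (F : 'I_n -> int) : \sum_(i in setT) F i = \sum_i F i.
    by apply: eq_bigl => i; rewrite inE.
  by rewrite -tT lam'E tT setTI cA tot big_ord_recl addrC addKr.
have [eps' [ce he]] := IH r' lam' (fun j => rn _) viol tot'.
exists (fun j => if unlift ord0 j is Some j' then eps' j' else A); split=> [j|i].
  by case: unliftP => [j'|] ->.
rewrite big_ord_recl unlift_none /= (eq_bigr (fun j => (i \in eps' j)%:Z)) => [|j _].
  by rewrite -he /lam' addrC subrK.
by rewrite liftK.
Qed.

(** * Dominance and the polygon of [mu] *)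

Lemma concave_interpolation (G G0 G1 t N0 N1 N c x0 x x1 : rat) :
  x0 <= x -> x <= x1 -> G0 <= G + c * (x0 - x) -> G1 <= G + c * (x1 - x) ->
  N = N0 + t * (x - x0) -> N1 = N + t * (x1 - x) -> N0 <= G0 -> N1 <= G1 -> N <= G.
Proof.
(* If the slope [t] of the segment is at least the supergradient [c], the right endpoint bounds [N];
   otherwise the left one does. *)
move=> l0 l1 g0 g1 s0 s1 b0 b1; have [ct|tc] := lerP c t.
  have : c * (x1 - x) <= t * (x1 - x) by apply: ler_wpM2r => //; lra.
  lra.
have : t * (x - x0) <= c * (x - x0) by apply: ler_wpM2r => //; lra.
lra.
Qed.

Section Dominance.
Variables (n f : nat) (r : 'I_f -> nat).
Hypothesis rn : forall j, (r j <= n)%N.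

(** Height at [k] of the polygon of [mu], a concave function of [k]; [gslope k] is its slope just to
    the right of [k]. *)
Definition gsum (k : nat) : int := \sum_j (minn k (r j))%:Z.
Definition gslope (k : nat) : int := \sum_j (k < r j)%N%:Z.

Lemma gsum_supergradient k m : gsum m <= gsum k + gslope k * (m%:Z - k%:Z).
Proof.
rewrite /gsum /gslope mulr_suml -big_split /=; apply: ler_sum => j _.
by case: ltnP => /= _; lia.
Qed.

Lemma mu_sum_partial k : (k <= n)%N ->
  \sum_(i < n | (i < k)%N) mu_sum r i = (gsum k)%:~R.
Proof.
move=> kn; rewrite exchange_big /= /gsum rmorph_sum /=; apply: eq_bigr => j _.
rewrite (eq_bigr (fun i : 'I_n => if (i < r j)%N then 1 else 0)); last by move=> i _; case: ltnP.
rewrite -big_mkcondr /= sumr_const -[_%:~R]/((minn k (r j))%:R); congr _%:R.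
rewrite -[RHS](@card_ltn_ord n); last by rewrite geq_min kn.
by apply: eq_card => i; rewrite !inE leq_min.
Qed.

Lemma gsum_total : gsum n = \sum_j (r j)%:Z.
Proof. by apply: eq_bigr => j _; rewrite (minn_idPr _). Qed.

Variable nu : 'I_n -> rat.
Hypothesis srt : forall i j : 'I_n, (i <= j)%N -> nu j <= nu i.

(** Let [c] be the slope of the bound at [#|T|]. The sum over [T] exceeds [c #|T|] by at most the
    sum of the positive parts of [lam i - c]. These are supported where [nu] is at least [c], a set
    on which [lam] and [nu] have equal sums, so dominance applies there, and the supergradient
    inequality leads back to [#|T|]. *)
Lemma hodge_dominated (lam : 'I_n -> int) :
  dominated nu (mu_sum r) ->
  (forall k (c : int), c%:~R <= nu k -> c <= lam k) ->
  (forall k (c : int), nu k < c%:~R -> lam k <= c) ->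
  (forall Q : pred rat, \sum_(k | Q (nu k)) (lam k)%:~R = \sum_(k | Q (nu k)) nu k) ->
  (forall T : {set 'I_n}, \sum_(i in T) lam i <= gsum #|T|) /\ \sum_i lam i = \sum_j (r j)%:Z.
Proof.
move=> [dom tot] h1 h2 h3; split; last first.
  apply: (@intr_inj rat); rewrite rmorph_sum /= (h3 xpredT) tot -gsum_total -mu_sum_partial //.
  by apply: eq_bigl => i; rewrite ltn_ord.
move=> T; pose c := gslope #|T|; pose P := [pred i | c%:~R <= nu i]; pose m := #|P|.
have Pm (i : 'I_n) : (c%:~R <= nu i) = (i < m)%N.
  rewrite -[LHS]/(P i); apply: prefix_card => {}i j ji; rewrite /= => h.
  by apply: le_trans h (srt ji).
have mn : (m <= n)%N by rewrite -[X in (_ <= X)%N]card_ord max_card.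
have e1 : \sum_(i in T) lam i <= c * #|T|%:Z + \sum_(i | P i) (lam i - c).
  have -> : \sum_(i in T) lam i = c * #|T|%:Z + \sum_(i in T) (lam i - c).
    by rewrite big_split /= sumr_const -[X in _ + (_ + X)]mulr_natr natz mulNr addrC subrK.
  rewrite lerD2l big_mkcond [X in _ <= X]big_mkcond /=; apply: ler_sum => i _.
  case: (leP c%:~R (nu i)) => h; first by have := h1 _ _ h; case: (i \in T); lia.
  by have := h2 _ _ h; case: (i \in T); lia.
have e2 : \sum_(i | P i) (lam i - c) <= gsum m - c * m%:Z.
  rewrite big_split /= sumr_const -/m -mulr_natr natz mulNr lerD2r.
  rewrite -(ler_int rat) rmorph_sum /= (h3 (fun x => c%:~R <= x)) -mu_sum_partial //.
  by rewrite (eq_bigl _ _ Pm); apply: dom.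
have := gsum_supergradient #|T| m; rewrite -/c; nia.
Qed.

Lemma dominated_of_breakpoints :
  (forall k, (k <= n)%N -> (forall i j : 'I_n, (i < k)%N -> (k <= j)%N -> nu j < nu i) ->
     \sum_(i < n | (i < k)%N) nu i <= (gsum k)%:~R) ->
  \sum_i nu i = (gsum n)%:~R -> dominated nu (mu_sum r).
Proof.
move=> brk tot; split; last first.
  by rewrite tot -mu_sum_partial //; apply: eq_bigl => i; rewrite ltn_ord.
move=> k; rewrite leq_eqVlt => /orP [/eqP ->|kn].
  rewrite mu_sum_partial // -tot.
  by rewrite (eq_bigl xpredT) // => i; rewrite ltn_ord.
rewrite mu_sum_partial; last exact: ltnW.
pose t := nu (Ordinal kn).
(* [k0 <= k < k1] are the ends of the segment of slope [t] containing [k], on which the partial sums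
   of [nu] are affine. *)
pose P0 := [pred i | t < nu i]; pose P1 := [pred i | t <= nu i].
pose k0 := #|P0|; pose k1 := #|P1|.
have E0 (i : 'I_n) : (t < nu i) = (i < k0)%N.
  by rewrite -[LHS]/(P0 i); apply: prefix_card => {}i j ji /= h; apply: lt_le_trans h (srt ji).
have E1 (i : 'I_n) : (t <= nu i) = (i < k1)%N.
  by rewrite -[LHS]/(P1 i); apply: prefix_card => {}i j ji /= h; apply: le_trans h (srt ji).
have k0n : (k0 <= n)%N by rewrite -[X in (_ <= X)%N]card_ord max_card.
have k1n : (k1 <= n)%N by rewrite -[X in (_ <= X)%N]card_ord max_card.
have k0k : (k0 <= k)%N by rewrite leqNgt -(E0 (Ordinal kn)) ltxx.
have kk1 : (k < k1)%N by rewrite -(E1 (Ordinal kn)).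
have b0 : \sum_(i < n | (i < k0)%N) nu i <= (gsum k0)%:~R.
  by apply: brk => // i j; rewrite -E0 leqNgt -E0 -leNgt => h1 h2; apply: le_lt_trans h2 h1.
have b1 : \sum_(i < n | (i < k1)%N) nu i <= (gsum k1)%:~R.
  by apply: brk => // i j; rewrite -E1 leqNgt -E1 -ltNge => h1 h2; apply: lt_le_trans h2 h1.
have seg a b : (k0 <= a)%N -> (a <= b)%N -> (b <= k1)%N ->
    \sum_(i < n | (i < b)%N) nu i = \sum_(i < n | (i < a)%N) nu i + t * (b%:R - a%:R).
  move=> h1 h2 h3; rewrite (bigID (fun i : 'I_n => (i < a)%N)) /=; congr (_ + _).
    by apply: eq_bigl => i; lia.
  rewrite (eq_bigr (fun=> t)) => [|i /andP [ib ia]].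
    rewrite sumr_const -[LHS]mulr_natr -natrB //; congr (_ * _%:R).
    have cb : #|[pred i : 'I_n | (i < b)%N]| = b by rewrite card_ltn_ord //; lia.
    have ca : #|[predI [pred i : 'I_n | (i < b)%N] & [pred i : 'I_n | (i < a)%N]]| = a.
      rewrite -[RHS](@card_ltn_ord n a); last by lia.
      by apply: eq_card => i; rewrite !inE; apply/andP/idP => [[]|h] //; split=> //; apply: leq_trans h2.
    have := cardID [pred i : 'I_n | (i < a)%N] [pred i : 'I_n | (i < b)%N].
    rewrite ca cb => e; transitivity #|[predD [pred i : 'I_n | (i < b)%N] & [pred i : 'I_n | (i < a)%N]]|.
      by apply: eq_card => i; rewrite !inE andbC.
    by rewrite -[X in (X - _)%N]e addKn.
  by apply/eqP; rewrite eq_le E1 (leq_trans ib h3) leNgt E0 -leqNgt andbT (leq_trans h1) // leqNgt.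
have s0 := seg _ _ (leqnn k0) k0k (ltnW kk1).
have s1 := seg _ _ k0k (ltnW kk1) (leqnn k1).
have sg m : (gsum m)%:~R <= (gsum k)%:~R + (gslope k)%:~R * (m%:R - k%:R) :> rat.
  have := gsum_supergradient k m; rewrite -(ler_int rat) rmorphD rmorphM rmorphB /=.
  by [].
have g0 := sg k0; have g1 := sg k1.
have l0 : (k0%:R : rat) <= k%:R by rewrite ler_nat.
have l1 : (k%:R : rat) <= k1%:R by rewrite ler_nat ltnW.
exact: concave_interpolation l0 l1 g0 g1 s0 s1 b0 b1.
Qed.
End Dominance.

(** * The cyclic structure of [F] and transported bases *)

Section CyclicFrobenius.
Variables (L : fieldType) (sg : {rmorphism L -> L}) (n f : nat) (B : 'I_f.+1 -> 'M[L]_n).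

(** Summand reached after [k] steps around the cycle of length [f.+1]; exponents of [F] stay natural
    numbers while [pos] names the summand. *)
Definition pos (k : nat) : 'I_f.+1 := iter k (@ordS f.+1) ord0.

Lemma val_pos k : pos k = (k %% f.+1)%N :> nat.
Proof.
elim: k => [|k IH]; first by rewrite mod0n.
by rewrite /pos iterS -/(pos k) /= IH -addn1 modnDml addn1.
Qed.

Lemma pos_ord (j : 'I_f.+1) : pos j = j.
Proof. by apply: val_inj; rewrite [LHS]val_pos modn_small. Qed.

Lemma pos_full : pos f.+1 = ord0.
Proof. by apply: val_inj; rewrite [LHS]val_pos modnn. Qed.

Lemma posS k : pos k.+1 = ordS (pos k). Proof. by []. Qed.

Lemma pos_pred k : ord_pred (pos k.+1) = pos k.
Proof. exact: ordSK. Qed.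

(** Matrix of [F^k] from summand 0 to summand [pos k]; at [k = f.+1] it is the matrix of [Phi]. *)
Fixpoint Bt (k : nat) : 'M[L]_n :=
  if k is k'.+1 then map_mx sg (Bt k') *m B (pos k'.+1) else 1%:M.

Lemma BtS k : Bt k.+1 = map_mx sg (Bt k) *m B (pos k.+1). Proof. by []. Qed.

Lemma Phi_Bt x : Phi sg B ord0 x = Fmap (itm sg f.+1) (Bt f.+1) x.
Proof.
rewrite /Phi; suff H k : iter k (fun pr => (Fmap sg (B (ordS pr.2)) pr.1, ordS pr.2)) (x, ord0) =
    (map_mx (itm sg k) x *m Bt k, pos k) by rewrite H.
elim: k => [|k IH]; first by rewrite map_itm0 mulmx1.
by rewrite iterS IH /= /Fmap map_mxM -map_itmS -mulmxA.
Qed.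

Hypothesis uB : forall j, B j \in unitmx.

Lemma Bt_unit k : Bt k \in unitmx.
Proof.
elim: k => [|k IH]; first exact: unitmx1.
by rewrite BtS unitmx_mul map_unitmx IH uB.
Qed.

End CyclicFrobenius.

Section CyclicBases.
Variable S : dvr.
Local Notation L := (dvr_field S).
Variables (sg : {rmorphism L -> L}) (n f : nat) (B : 'I_f.+1 -> 'M[L]_n).
Hypothesis uB : forall j, B j \in unitmx.
Local Notation pos := (pos f).
Local Notation Bt := (Bt sg B).

Definition PP (P : 'M[L]_n) (k : nat) := map_mx (itm sg k) P *m Bt k.

Lemma PP_unit P k : P \in unitmx -> PP P k \in unitmx.
Proof. by move=> uP; rewrite unitmx_mul map_unitmx uP Bt_unit. Qed.

Lemma PP0 P : PP P 0 = P.
Proof. by rewrite /PP map_itm0 mulmx1. Qed.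

Lemma PPS P k : map_mx sg (PP P k) *m B (pos k.+1) = PP P k.+1.
Proof. by rewrite /PP map_mxM -map_itmS BtS mulmxA. Qed.

Lemma PP_full P : P \in unitmx -> PP P f.+1 = cj (itm sg f.+1) P (Bt f.+1) *m P.
Proof. by move=> uP; rewrite /cj mulmxKV. Qed.

(** [PP P j] is the image of the basis [P] under [F^j]. In these bases every step of [F] has
    identity matrix, except the one returning to summand 0, which carries the whole of [Phi]. *)
Lemma PP_pred P (j : 'I_f.+1) : P \in unitmx ->
  map_mx sg (PP P (ord_pred j)) *m B j =
  (if j == ord0 then cj (itm sg f.+1) P (Bt f.+1) else 1%:M) *m PP P j.
Proof.
move=> uP; case: j => [[|k] hk].
  rewrite (_ : Ordinal hk == ord0) // PP0 -PP_full //.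
  rewrite (_ : Ordinal hk = pos f.+1); last by rewrite pos_full; apply: val_inj.
  by rewrite pos_pred val_pos modn_small // PPS.
rewrite (_ : Ordinal hk == ord0 = false) // mul1mx.
rewrite (_ : Ordinal hk = pos k.+1); last by apply: val_inj; rewrite [RHS]val_pos modn_small.
by rewrite pos_pred !val_pos (modn_small hk) (modn_small (ltnW hk)) PPS.
Qed.

End CyclicBases.

(** * The Mazur inequality *)

Section Mazur.
Variable S : dvr.
Local Notation L := (dvr_field S).
Local Notation v := (@dval S).
Local Notation pi := (unif S).

(** Hermite form relative to the basis [P]: [sub_lattice] is applied to coordinates in [P]. *)
Lemma triangular_basis n (M : lset L n) (X P : 'M[L]_n) : P \in unitmx -> basis_of X M ->
  exists Y, [/\ Y \in unitmx, basis_of (Y *m P) M & forall i j : 'I_n, (j < i)%N -> Y i j = 0].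
Proof.
move=> uP [uX hX]; pose M' (y : 'rV[L]_n) := M (y *m P).
have M'E y : M' y <-> intm (y *m (P *m invmx X)) by rewrite /M' hX ospanP // mulmxA.
have [K1 [_ h1]] := gem_exists (P *m invmx X); have [K2 [_ h2]] := gem_exists (X *m invmx P).
have [||||Y [[uY hY] tY]] := @sub_lattice S n M' (- K1) K2.
- by move=> x y /M'E hx /M'E hy; apply/M'E; rewrite mulmxDl; apply: gemD.
- by move=> c x hc /M'E hx; apply/M'E; rewrite -scalemxAl -[0]addr0; apply: gemZ.
- by move=> x hx; apply/M'E; rewrite -(addNr K1); apply: gemM.
- move=> x /M'E hx; have -> : x = x *m (P *m invmx X) *m (X *m invmx P).
    by rewrite -!mulmxA mulKmx // mulmxV // mulmx1.
  exact: intmM.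
have uYP : Y *m P \in unitmx by rewrite unitmx_mul uY.
exists Y; split=> //; split=> // x.
rewrite -[x](mulmxKV uP) -/(M' _) hY !ospanP // invmxM // mulmxA.
by rewrite mulmxK.
Qed.

Lemma invmx_ublock m n (C1 : 'M[L]_m) H (C2 : 'M[L]_n) : C1 \in unitmx -> C2 \in unitmx ->
  invmx (block_mx C1 H 0 C2) =
  block_mx (invmx C1) (- (invmx C1 *m H *m invmx C2)) 0 (invmx C2).
Proof.
move=> u1 u2; have u : block_mx C1 H 0 C2 \in unitmx.
  by rewrite unitmxE unitfE det_ublock mulf_neq0 ?det_neq0.
apply: (can_inj (mulKmx u)); rewrite mulmxV // mulmx_block.
rewrite !(mul0mx, mulmx0, addr0, add0r) !mulmxV // mulmxN -!mulmxA mulKVmx // addNr.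
by rewrite -scalar_mx_block.
Qed.

(** Diagonal blocks inherit integrality: from [C2] comes [vdet C1 <= vdet C], and from [pi C1^-1]
    comes [vdet C1 <= m]. *)
Lemma ublock_minuscule m n (C1 : 'M[L]_m) H (C2 : 'M[L]_n) :
  let C := block_mx C1 H 0 C2 in
  C1 \in unitmx -> C2 \in unitmx -> intm C -> intm (pi *: invmx C) ->
  vdet C1 <= m%:Z /\ vdet C1 <= vdet C.
Proof.
move=> C u1 u2 /gem_block [_ _ _ hC2]; rewrite invmx_ublock // scale_block_mx.
move=> /gem_block [hC1 _ _ _]; rewrite /C vdet_block //; split.
  have := vdet_intm _ hC1; rewrite scale_unitmx ?unif_neq0 // unitmx_inv u1 => /(_ isT).
  rewrite vdet_scale ?unif_neq0 ?unitmx_inv // vdetV // dval_unif -[1 *+ m]/(m%:R) natz.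
  by rewrite subr_ge0.
by rewrite lerDl vdet_intm.
Qed.

Variables (sg : {rmorphism L -> L}) (n f : nat) (r : 'I_f.+1 -> nat) (B : 'I_f.+1 -> 'M[L]_n).
Hypothesis fs : frob sg.
Hypothesis rn : forall j, (r j <= n)%N.
Hypothesis uB : forall j, B j \in unitmx.
Variable M : 'I_f.+1 -> lset L n.
Hypothesis Mlat : forall j, is_lattice v (M j).
Hypothesis Mcond : forall j, let FM := img (Fmap sg (B j)) (M (ord_pred j)) in
  [/\ lsub FM (M j), lsub (scl pi (M j)) FM & lat_len v FM (M j) (r j)%:Z].

Section Triangular.
Variables (G : 'M[L]_n) (Y : 'I_f.+1 -> 'M[L]_n).
Hypothesis uG : G \in unitmx.
Hypothesis uY : forall j, Y j \in unitmx.
Let g (j : 'I_f.+1) := if j == ord0 then G else 1%:M.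
Let C j := map_mx sg (Y (ord_pred j)) *m g j *m invmx (Y j).

Lemma vdet_transition j : vdet (C j) =
  vdet (Y (ord_pred j)) - vdet (Y j) + (if j == ord0 then vdet G else 0).
Proof.
have ug : g j \in unitmx by rewrite /g; case: eqP => // _; apply: unitmx1.
rewrite /C !vdetM ?unitmx_mul ?map_unitmx ?unitmx_inv ?uY // frob_vdet // vdetV //.
by rewrite addrAC /g; case: eqP => //; rewrite vdet1.
Qed.

(** The contributions of [Y] telescope around the cycle. *)
Lemma sum_vdet_transition : \sum_j vdet (C j) = vdet G.
Proof.
rewrite (eq_bigr _ (fun j _ => vdet_transition j)) big_split big_split /= sumrN.
rewrite [X in X - _ + _](_ : _ = \sum_j vdet (Y j)); last first.
  by rewrite [RHS](reindex (@ord_pred f.+1)) //; exists (@ordS f.+1) => j _; rewrite ?ordSK ?ord_predK.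
rewrite subrr add0r (bigD1 ord0) //= big1 ?addr0 // => j /negPf -> //.
Qed.
End Triangular.

(** [C] is the matrix of [F] between triangular bases of consecutive lattices, written in the
    transported bases; the two inclusions and the length become its three properties. *)
Lemma transition_exists P : P \in unitmx ->
  let G := cj (itm sg f.+1) P (Bt sg B f.+1) in
  exists Y : 'I_f.+1 -> 'M[L]_n, [/\ forall j, Y j \in unitmx,
    forall j (i i' : 'I_n), (i' < i)%N -> Y j i i' = 0 &
    forall j, let C := map_mx sg (Y (ord_pred j)) *m (if j == ord0 then G else 1%:M) *m invmx (Y j) in
     [/\ intm C, intm (pi *: invmx C) & vdet C = (r j)%:Z]].
Proof.
move=> uP G.
have /fin_all_exists [Y hY] : forall j : 'I_f.+1, exists Y, [/\ Y \in unitmx,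
    basis_of (Y *m PP sg B P j) (M j) & forall i i' : 'I_n, (i' < i)%N -> Y i i' = 0].
  by move=> j; have [X hX] := Mlat j; apply: triangular_basis hX; apply: PP_unit.
exists Y; split=> [j|j|j]; try by have [] := hY j.
have [uY bY _] := hY j; have [uY' bY' _] := hY (ord_pred j).
have [h1 h2 h3] := Mcond j.
have bF := basis_of_Fmap fs (uB j) bY'.
rewrite map_mxM -mulmxA PP_pred // -/G mulmxA in bF.
have uPj : PP sg B P j \in unitmx by apply: PP_unit.
set g := (if _ then _ else _) in bF *; set C := _ *m _ *m invmx _.
have CE : C = map_mx sg (Y (ord_pred j)) *m g *m PP sg B P j *m invmx (Y j *m PP sg B P j).
  by rewrite invmxM // mulmxA mulmxK.
have ug : g \in unitmx.
  rewrite /g; case: eqP => _; last exact: unitmx1.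
  by apply: cj_unit => //; apply: Bt_unit.
have uW : map_mx sg (Y (ord_pred j)) *m g \in unitmx by rewrite unitmx_mul map_unitmx uY'.
split.
- by rewrite CE; apply/(lsubP bF bY).
- have /(lsubP (basis_of_scl (unif_neq0 S) bY) bF) := h2.
  have -> : invmx C = Y j *m invmx (map_mx sg (Y (ord_pred j)) *m g).
    by rewrite /C [LHS]invmxM ?unitmx_inv // invmxK.
  by rewrite -scalemxAl [invmx (_ *m PP _ _ _ _)]invmxM // mulmxA mulmxK.
- have /(lat_lenP _ bF bY) -> := h3; have [uWP _] := bF; have [uYP _] := bY.
  by rewrite CE (vdetM uWP) ?unitmx_inv // vdetV.
Qed.

End Mazur.

(** The blocks [ulsubmx (Y j)] are bases of the projections of the lattices to the first [m]
    coordinates. On these each step of [F] has colength at most [minn m (r j)], and the colengths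
    add up to [vdet G1]. *)
Lemma mazur_block (S : dvr) (sg : {rmorphism S -> S}) m n f (r : 'I_f.+1 -> nat)
  (G1 : 'M[S]_m) (G2 : 'M[S]_n) (Y : 'I_f.+1 -> 'M[S]_(m + n)) : frob sg ->
  G1 \in unitmx -> G2 \in unitmx -> (forall j, Y j \in unitmx) ->
  (forall j (i i' : 'I_(m + n)), (i' < i)%N -> Y j i i' = 0) ->
  (forall j, let C := map_mx sg (Y (ord_pred j)) *m
      (if j == ord0 then block_mx G1 0 0 G2 else 1%:M) *m invmx (Y j) in
     [/\ intm C, intm (unif S *: invmx C) & vdet C = (r j)%:Z]) ->
  vdet G1 <= gsum r m.
Proof.
move=> fs u1 u2 uY tY hC.
have YE j : Y j = block_mx (ulsubmx (Y j)) (ursubmx (Y j)) 0 (drsubmx (Y j)).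
  rewrite -[LHS]submxK; congr block_mx; apply/matrixP => a b; rewrite !mxE tY //=.
  by have := ltn_ord b; lia.
have uYb j : ulsubmx (Y j) \in unitmx /\ drsubmx (Y j) \in unitmx.
  have := uY j; rewrite {1}YE unitmxE unitfE det_ublock mulf_eq0 negb_or => /andP [h1 h2].
  by rewrite !unitmxE !unitfE.
pose Y1 j := ulsubmx (Y j); have uY1 j : Y1 j \in unitmx by have [] := uYb j.
rewrite -(sum_vdet_transition fs u1 uY1); apply: ler_sum => j _.
have [h1 h2 h3] := hC j.
have [H CE] : exists H, map_mx sg (Y (ord_pred j)) *m
      (if j == ord0 then block_mx G1 0 0 G2 else 1%:M) *m invmx (Y j) =
   block_mx (map_mx sg (Y1 (ord_pred j)) *m (if j == ord0 then G1 else 1%:M) *m invmx (Y1 j)) H 0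
     (map_mx sg (drsubmx (Y (ord_pred j))) *m (if j == ord0 then G2 else 1%:M) *m invmx (drsubmx (Y j))).
  have [a1 a2] := uYb j.
  rewrite [Y j]YE [Y (ord_pred j)]YE invmx_ublock // ?block_mxKul ?block_mxKdr.
  have -> : (if j == ord0 then block_mx G1 0 0 G2 else 1%:M) =
     block_mx (if j == ord0 then G1 else 1%:M) 0 0 (if j == ord0 then G2 else 1%:M).
    by case: eqP => // _; rewrite -scalar_mx_block.
  rewrite map_block_mx !map_mx0 !mulmx_block !(mul0mx, mulmx0, addr0, add0r) /Y1.
  by eexists.
have [a1 a2] := uYb j; have [b1 b2] := uYb (ord_pred j).
rewrite CE in h1 h2 h3.
have [||q1 q2] := ublock_minuscule _ _ h1 h2.
- by rewrite !unitmx_mul map_unitmx unitmx_inv uY1 uY1; case: eqP; rewrite ?u1 ?unitmx1.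
- by rewrite !unitmx_mul map_unitmx unitmx_inv a2 b2; case: eqP; rewrite ?u2 ?unitmx1.
have lemin (z : int) : z <= m%:Z -> z <= (r j)%:Z -> z <= (minn m (r j))%:Z by lia.
by rewrite h3 in q2; apply: lemin q1 q2.
Qed.

Section MazurInequality.
Variable S : dvr.
Local Notation L := (dvr_field S).
Local Notation v := (@dval S).
Local Notation pi := (unif S).

Lemma mazur_breakpoint (sg t : {rmorphism L -> L}) n f (r : 'I_f.+1 -> nat) (G : 'M[L]_n)
  (Y : 'I_f.+1 -> 'M[L]_n) nu k : frob sg -> frob t -> G \in unitmx -> slope_data t G nu ->
  (forall i j : 'I_n, (i <= j)%N -> nu j <= nu i) -> (k <= n)%N ->
  (forall i j : 'I_n, (i < k)%N -> (k <= j)%N -> nu j < nu i) ->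
  (forall j, Y j \in unitmx) -> (forall j (i i' : 'I_n), (i' < i)%N -> Y j i i' = 0) ->
  (forall j, let C := map_mx sg (Y (ord_pred j)) *m (if j == ord0 then G else 1%:M) *m invmx (Y j) in
     [/\ intm C, intm (pi *: invmx C) & vdet C = (r j)%:Z]) ->
  \sum_(i < n | (i < k)%N) nu i <= (gsum r k)%:~R.
Proof.
move=> fs ft uG d srt kn brk uY tY hC.
have [m e] : exists m, n = (k + m)%N by exists (n - k)%N; rewrite subnKC.
subst n.
have [|G1 [G2 [GE u1 u2 d1 d2]]] := slope_data_split uG d.
  by move=> i j; rewrite gt_eqF //; apply: brk; rewrite /= ?ltn_ord ?leq_addr.
subst G; have le := mazur_block fs u1 u2 uY tY hC.
rewrite big_split_ord /= [X in _ + X]big1 ?addr0 => [|i]; last by rewrite ltnNge leq_addr.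
rewrite (eq_bigl xpredT) => [|i]; last by rewrite ltn_ord.
rewrite -(slope_data_vdet ft u1 d1) ?ler_int // => i j ij; exact: srt.
Qed.

Lemma mazur_inequality (sg : {rmorphism L -> L}) n f (r : 'I_f.+1 -> nat) (B : 'I_f.+1 -> 'M[L]_n)
  (M : 'I_f.+1 -> lset L n) : frob sg -> (forall j, (r j <= n)%N) ->
  (forall j, B j \in unitmx) -> (forall j, is_lattice v (M j)) ->
  (forall j, let FM := img (Fmap sg (B j)) (M (ord_pred j)) in
    [/\ lsub FM (M j), lsub (scl pi (M j)) FM & lat_len v FM (M j) (r j)%:Z]) ->
  in_BGmu v sg pi r B ord0.
Proof.
move=> fs rn uB Mlat Mcond; have ft := itm_frob f.+1 fs.
have uC := Bt_unit sg uB f.+1.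
have [P [nu [uP d srt]]] := sorted_slope_data_exists ft uC.
have [Y [uY tY hC]] := transition_exists fs uB Mlat Mcond uP.
have uG := cj_unit (itm sg f.+1) uP uC.
exists nu; split.
  apply/(slope_vectorE ft nu uC (Phi_Bt sg B)); split=> //; by exists P.
apply: dominated_of_breakpoints => //.
  by move=> k kn brk; apply: (mazur_breakpoint fs ft uG d srt kn brk uY tY hC).
rewrite -(slope_data_vdet ft uG d srt) gsum_total // -(sum_vdet_transition fs uG uY).
by congr _%:~R; apply: eq_bigr => j _; have [] := hC j.
Qed.

End MazurInequality.

(** * From elementary divisors to a family of lattices *)

Section LatticeFamily.
Variable S : dvr.
Local Notation L := (dvr_field S).
Local Notation v := (@dval S).
Local Notation pi := (unif S).
Variables (sg : {rmorphism L -> L}) (n f : nat) (r : 'I_f.+1 -> nat) (B : 'I_f.+1 -> 'M[L]_n).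
Hypothesis fs : frob sg.
Hypothesis uB : forall j, B j \in unitmx.

(* The lattices [F^-j M_j] are [pi^-(eps_1 + .. + eps_j)] times a fixed one, coordinatewise. *)
Lemma lattice_family_of_hodge (E W1 W2 : 'M[L]_n) (lam : 'I_n -> int) (eps : 'I_f.+1 -> {set 'I_n}) :
  E \in unitmx -> GLO W1 -> GLO W2 ->
  cj (itm sg f.+1) E (Bt sg B f.+1) = W1 *m zdiag S lam *m W2 ->
  (forall i, lam i = \sum_j (i \in eps j)%:Z) ->
  exists X W : 'I_f.+1 -> 'M[L]_n, forall j, [/\ X j \in unitmx, GLO (W j) &
    map_mx sg (X (ord_pred j)) *m B j = zdiag S (fun i => (i \in eps j)%:Z) *m W j *m X j].
Proof.
move=> uE g1 g2 cE lamE; have ft := itm_frob f.+1 fs.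
(* [V] absorbs [W1]: twisted conjugation multiplies on the left by the Frobenius image of [V],
   chosen to be [W1^-1]. *)
have [V VE] := frob_surj (invmx W1) ft.
have gV : GLO V by apply/(frob_GLO _ ft); rewrite VE; apply: GLO_inv.
have uV := GLO_unit gV.
pose E' := V *m E; have uE' : E' \in unitmx by rewrite unitmx_mul uV.
have cE' : cj (itm sg f.+1) E' (Bt sg B f.+1) = zdiag S lam *m (W2 *m invmx V).
  rewrite /E' -cj_comp // cE /cj VE !mulmxA mulVmx ?mul1mx //; exact: GLO_unit.
(* The sum starts with the column of index 1; the column of index 0 belongs to the step that closes
   the cycle and enters last. *)
pose cum k i : int := \sum_(l < k) (i \in eps (pos f l.+1))%:Z.
have cumS k i : cum k.+1 i = cum k i + (i \in eps (pos f k.+1))%:Z by rewrite /cum big_ord_recr.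
have cum_full i : cum f.+1 i = lam i.
  rewrite lamE /cum [RHS](reindex (@ordS f.+1)) /=; last first.
    by exists (@ord_pred f.+1) => j _; rewrite ?ordSK ?ord_predK.
  by apply: eq_bigr => l _; have <- : pos f l.+1 = ordS l by rewrite posS pos_ord.
pose X (j : 'I_f.+1) := zdiag S (fun i => - cum j i) *m PP sg B E' j.
pose W (j : 'I_f.+1) := if j == ord0 then W2 *m invmx V else 1%:M.
have gW j : GLO (W j).
  by rewrite /W; case: eqP => _; [apply: GLO_mul => //; apply: GLO_inv|apply: GLO1].
exists X, W => j; split=> //.
  by rewrite unitmx_mul zdiag_unit PP_unit.
rewrite /X map_mxM map_zdiag // -mulmxA PP_pred // /W.
have [->|nj] := eqVneq j ord0.
  rewrite cE' PP0 -!mulmxA !mulmxA zdiagD.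
  have -> : zdiag S (fun i => - cum (ord0 : 'I_f.+1) i) = 1%:M.
    by rewrite -zdiag0; apply: eq_zdiag => i; rewrite /cum big_ord0 oppr0.
  rewrite mulmx1; congr (_ *m _ *m _ *m _); congr (_ *m _); apply: eq_zdiag => i.
  have -> : nat_of_ord (ord_pred (ord0 : 'I_f.+1)) = f.
    by rewrite -(pos_full f) pos_pred val_pos modn_small.
  by rewrite -cum_full cumS pos_full addKr.
rewrite mulmx1 mul1mx mulmxA zdiagD; congr (_ *m _); apply: eq_zdiag => i.
case: j nj => [[|k] hk] nj //.
have jE : Ordinal hk = pos f k.+1 by apply: val_inj; rewrite [RHS]val_pos modn_small.
rewrite {1 2}jE pos_pred val_pos (modn_small (ltnW hk)) /= cumS.
by rewrite opprD addrCA subrr addr0.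
Qed.

Lemma lattice_family_exists : (forall j, (r j <= n)%N) -> in_BGmu v sg pi r B ord0 ->
  exists X : 'I_f.+1 -> 'M[L]_n, forall j, X j \in unitmx /\
    let M i := ospan v (X i) in let FM := img (Fmap sg (B j)) (M (ord_pred j)) in
    [/\ lsub FM (M j), lsub (scl pi (M j)) FM & lat_len v FM (M j) (r j)%:Z].
Proof.
move=> rn [nu [sv dom]]; have ft := itm_frob f.+1 fs.
have uC := Bt_unit sg uB f.+1.
have /(slope_vectorE ft nu uC (Phi_Bt sg B)) [srt [P [uP d]]] := sv.
have uG := cj_unit (itm sg f.+1) uP uC.
have [E [W1 [W2 [lam [uE g1 g2 cE [h1 h2 h3]]]]]] := slope_data_hodge ft uG d srt.
have [dT tot] := hodge_dominated rn srt dom h1 h2 h3.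
have [eps [ce he]] := gale_ryser rn dT tot.
rewrite cj_comp // in cE; have uEP : E *m P \in unitmx by rewrite unitmx_mul uE.
have [X [W hX]] := lattice_family_of_hodge uEP g1 g2 cE he.
exists X => j; have [uX gW XE] := hX j; split=> // M FM.
have bM i : basis_of (X i) (M i) by split=> //; have [] := hX i.
have bF : basis_of (zdiag S (fun i => (i \in eps j)%:Z) *m W j *m X j) FM.
  by rewrite -XE; apply: basis_of_Fmap.
have uW := GLO_unit gW.
split.
- apply/(lsubP bF (bM j)); rewrite mulmxK //; apply: intmM; last exact: GLO_intm.
  by apply: zdiag_intm.
- apply/(lsubP (basis_of_scl (unif_neq0 S) (bM j)) bF).
  rewrite !invmxM ?unitmx_mul ?zdiag_unit ?uW // invmx_zdiag -scalemxAl mulKVmx //.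
  rewrite scalemxAr -{1}[pi]expr1z zdiag_scale; apply: intmM; first by case: gW.
  by apply: zdiag_intm => i; case: (i \in _).
- apply/(lat_lenP _ bF (bM j)).
  rewrite !vdetM ?unitmx_mul ?zdiag_unit ?uW // addrK (vdet_GLO gW) addr0 vdet_zdiag.
  rewrite -ce -sum1_card big_mkcond /= -natz natr_sum; apply: eq_bigr => i _.
  by case: (i \in _).
Qed.
End LatticeFamily.

(** * Lang's theorem and compatible lines over the residue field *)

Section Lang.
Variable K : fieldType.
Hypothesis closedK : forall P : {poly K}, (1 < size P)%N -> exists x, root P x.

(* With [x_k = T^k x] and first dependence [x_m = \sum_i c_i x_i], the vector
   [\sum_i a_i x_i] is fixed iff [a_0 = c_0 a_(m-1)^Q] and [a_i = c_i a_(m-1)^Q + a_(i-1)^Q];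
   eliminating leaves one polynomial equation in [a_(m-1)]. *)
Lemma lang_fixed_vector (u : {rmorphism K -> K}) Q d (N : 'M[K]_d) (x : 'rV[K]_d) :
  (1 < Q)%N -> (forall z, u z = z ^+ Q) -> (forall k, iter k (Fmap u N) x != 0) ->
  exists2 y, y != 0 & Fmap u N y = y.
Proof.
move=> Q1 uE nz; pose y k := iter k (Fmap u N) x.
have [[|m] [c [cE fK]]] := first_dependence y.
  by have := nz 0%N; rewrite -/(y 0%N) cE [c]thinmx0 mul0mx eqxx.
set M := \matrix_(i < m.+1) y i in cE fK.
have nc : c != 0.
  by have := nz m.+1; rewrite -/(y m.+1) cE; apply: contra => /eqP ->; rewrite mul0mx.
pose cc i := if insub i : option 'I_m.+1 is Some j then c 0 j else 0.
have ccE (i : 'I_m.+1) : cc i = c 0 i by rewrite /cc valK.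
(* [g i] is [a_i / t^Q] as a polynomial in the last coefficient [t = a_m]; the monomial comes from
   dividing the [Q]-th power of [t^Q] by [t^Q]. *)
pose g := fix g (i : nat) : {poly K} :=
  if i is i'.+1 then (cc i)%:P + 'X^(Q * Q - Q) * g i' ^+ Q else (cc 0%N)%:P.
have gS i : g i.+1 = (cc i.+1)%:P + 'X^(Q * Q - Q) * g i ^+ Q by [].
have QQ : (0 < Q * Q - Q)%N by rewrite subn_gt0 -{1}[Q]mul1n ltn_mul2r; lia.
have g0 i : g i = 0 -> forall l, (l <= i)%N -> cc l = 0.
  elim: i => [|i IH].
    by move/eqP; rewrite polyC_eq0 => /eqP e l; rewrite leqn0 => /eqP ->.
  rewrite gS => e; have c0 : cc i.+1 = 0.
    have := congr1 (horner^~ 0) e; rewrite !hornerE ?hornerXn expr0n.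
    by rewrite (gtn_eqF QQ) mul0r addr0.
  move: e; rewrite c0 add0r => /eqP; rewrite mulf_eq0 expf_eq0 polyX_eq0 andbF /=.
  rewrite expf_eq0 => /andP [_ /eqP /IH h] l; rewrite leq_eqVlt => /orP [/eqP -> //|].
  by rewrite ltnS; apply: h.
have gm : g m != 0.
  apply: contra nc => /eqP /g0 h; apply/eqP/rowP => i; rewrite mxE -ccE h //.
  by rewrite -ltnS.
(* This is the equation [a_m = t] divided by [t], which excludes the zero solution. *)
have [t rt] : exists t, root ('X^(Q - 1) * g m - 1) t.
  apply: closedK; rewrite size_polyDl.
    rewrite mulrC size_mulXn //; have := size_poly_gt0 (g m); rewrite gm; lia.
  rewrite size_polyN size_poly1 mulrC size_mulXn //; have := size_poly_gt0 (g m); rewrite gm; lia.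
have tE : t ^+ (Q - 1) * (g m).[t] = 1.
  by move: rt; rewrite /root !hornerE ?hornerXn subr_eq0 => /eqP.
have nt : t != 0.
  apply/eqP => t0; move: tE; rewrite t0 expr0n (_ : (Q - 1)%N == 0%N = false); last by lia.
  by rewrite mul0r => /eqP; rewrite eq_sym oner_eq0.
pose a i := t ^+ Q * (g i).[t].
have a0 : a 0%N = cc 0%N * t ^+ Q by rewrite /a hornerC mulrC.
have aS i : a i.+1 = cc i.+1 * t ^+ Q + a i ^+ Q.
  rewrite /a gS !hornerE ?hornerXn mulrDr; congr (_ + _); first by rewrite mulrC.
  by rewrite mulrA -exprD subnKC ?exprMn ?exprM // leq_pmulr // ltnW.
have am : a m = t by rewrite /a -{1}(subnK (ltnW Q1)) exprD expr1 mulrAC tE mul1r.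
pose av : 'rV[K]_m.+1 := \row_i a i.
exists (av *m M).
  rewrite mulmx_free_eq0 //; apply/rV0Pn; exists ord_max.
  by rewrite mxE /= am.
have yS i : map_mx u (y i) *m N = y i.+1 by [].
clearbody y.
have -> : Fmap u N (av *m M) = \sum_(i < m.+1) a i ^+ Q *: y i.+1.
  rewrite /Fmap map_mxM -mulmxA mulmx_sum_row; apply: eq_bigr => i _.
  by rewrite row_mul -map_row rowK yS !mxE [u _]uE.
rewrite big_ord_recr /= am cE mulmx_sum_row scaler_sumr.
have -> : \sum_(i < m) a i ^+ Q *: y i.+1 = \sum_(i < m.+1) (if (i : nat) is j.+1 then a j ^+ Q else 0) *: y i.
  by rewrite big_ord_recl /= scale0r add0r; apply: eq_bigr => i _.
rewrite mulmx_sum_row -big_split /=; apply: eq_bigr => i _; rewrite rowK scalerA -scalerDl mxE.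
congr (_ *: _); rewrite -ccE mulrC addrC.
by case: i => [[|i] hi] /=; rewrite ?a0 ?aS ?addr0.
Qed.

Variables (s : {rmorphism K -> K}) (q : nat).
Hypothesis q1 : (1 < q)%N.
Hypothesis sE : forall z, s z = z ^+ q.

Lemma itm_pow k z : itm s k z = z ^+ (q ^ k).
Proof.
elim: k => [|k IH]; first by rewrite expn0 expr1.
by rewrite /= IH sE expnSr exprM.
Qed.

Variables (f d : nat) (Fm Wm : 'I_f.+1 -> 'M[K]_d).
Hypothesis d0 : (0 < d)%N.
Hypothesis FW : forall j, Fm j *m Wm j = 0.

(** Compatibility of two consecutive lines with [F] and [V]. Here [y *m Wm j] is the Frobenius twist
    of [V y], so that no inverse of [s] occurs. *)
Definition adjacent j (x y : 'rV[K]_d) : bool :=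
  (map_mx s x *m Fm j <= y)%MS && (y *m Wm j <= map_mx s x)%MS.

Definition Tm j := if Wm j \in unitmx then invmx (Wm j) else Fm j.

Lemma map_neq0 (x : 'rV[K]_d) : (map_mx s x == 0) = (x == 0).
Proof. exact: map_mx_eq0. Qed.

(** Where [Wm j] is invertible, [FW] forces [Fm j = 0] and the condition on [V] holds by
    construction; elsewhere the image of [F] is killed by [V]. *)
Lemma adjacentT j x : Fmap s (Tm j) x != 0 -> adjacent j x (Fmap s (Tm j) x).
Proof.
rewrite /adjacent /Fmap /Tm; case: ifP => [uW|nW] nz.
  by rewrite mulmxKV // submx_refl andbT -(mulmxK uW (Fm j)) FW mul0mx mulmx0 sub0mx.
by rewrite submx_refl -mulmxA FW mulmx0 sub0mx.
Qed.

Lemma Tm_ker j x : Wm j \notin unitmx -> Fmap s (Tm j) x *m Wm j = 0.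
Proof. by rewrite /Fmap /Tm => /negPf ->; rewrite -mulmxA FW mulmx0. Qed.

Lemma Tm_eq0 j x : x != 0 -> Fmap s (Tm j) x = 0 ->
  Wm j \notin unitmx /\ map_mx s x *m Fm j = 0.
Proof.
rewrite /Fmap /Tm; case: ifP => [uW|nW] nx h; last by split.
have : map_mx s x = 0 by rewrite -(mulmxKV uW (map_mx s x)) h mul0mx.
by move/eqP; rewrite map_neq0 (negPf nx).
Qed.

Lemma singular_kernel (A : 'M[K]_d) : A \notin unitmx -> exists2 x : 'rV_d, x != 0 & x *m A = 0.
Proof.
rewrite -row_free_unit -kermx_eq0 => /rowV0Pn [x /sub_kermxP xA nx]; by exists x.
Qed.

Lemma adjacent_lines : exists X : 'I_f.+1 -> 'rV[K]_d,
  forall j, X j != 0 /\ adjacent j (X (ord_pred j)) (X j).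
Proof.
have [e ne] : exists e : 'rV[K]_d, e != 0.
  by exists (delta_mx 0 (Ordinal d0)); apply/rV0Pn; exists (Ordinal d0); rewrite mxE !eqxx oner_neq0.
have /fin_all_exists [ka hka] : forall j, exists ka : 'rV[K]_d, ka != 0 /\ (Wm j \notin unitmx -> ka *m Wm j = 0).
  move=> j; have [uW|nW] := boolP (Wm j \in unitmx); first by exists e.
  by have [x nx xW] := singular_kernel nW; exists x.
(* A killed line is replaced by [ka j], which [V] kills; both compatibility conditions are then
   trivial. *)
pose step j x := if Fmap s (Tm j) x != 0 then Fmap s (Tm j) x else ka j.
have step_neq0 j x : step j x != 0 by rewrite /step; case: ifP => // _; have [] := hka j.
have step_ker j x : Wm j \notin unitmx -> step j x *m Wm j = 0.
  by move=> nW; rewrite /step; case: ifP => _; [apply: Tm_ker|have [_ ->] := hka j].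
have step_adj j x : x != 0 -> adjacent j x (step j x).
  move=> nx; rewrite /step; case: ifP => [|/negbFE /eqP h]; first exact: adjacentT.
  have [nW xF] := Tm_eq0 nx h; have [_ kW] := hka j.
  by rewrite /adjacent xF kW // !sub0mx.
pose xs := fix xs (i : nat) := if i is i'.+1 then step (pos f i) (xs i') else e.
have xsS i : xs i.+1 = step (pos f i.+1) (xs i) by [].
have xs_neq0 i : xs i != 0 by case: i => [|i] //; rewrite xsS.
clearbody xs.
(* If [xs i] is killed with [i > f], the family consists of the lines [xs b .. xs i] with
   [b = i - f]. Since [b > 0], the line [xs b] was itself produced by [step] at a place where [V] is
   not bijective; so [V] kills it and the cycle closes. *)
have [[i [fi Ti]]|noz] := classic (exists i, (f < i)%N /\ Fmap s (Tm (pos f i.+1)) (xs i) = 0).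
  pose b := (i - f)%N.
  have posb k : pos f (k + f.+1) = pos f k by apply: val_inj; rewrite [LHS]val_pos [RHS]val_pos modnDr.
  have [k [kP kb]] : exists k : 'I_f.+1 -> nat, (forall j, pos f (k j) = j) /\
      forall j, (b <= k j <= b + f)%N.
    exists (fun j => (b + (j + (f.+1 - b %% f.+1)) %% f.+1)%N); split=> j; last first.
      by rewrite leq_addr leq_add2l -ltnS ltn_mod.
    apply: val_inj; rewrite [LHS]val_pos modnDmr -modnDml addnCA subnKC; last exact/ltnW/ltn_pmod.
    by rewrite modnDr modn_small.
  have kuniq j l : (b <= l <= b + f)%N -> pos f l = j -> k j = l.
    move=> hl e1; have := kb j; have /(congr1 val) := kP j; rewrite -e1 /= !val_pos => e2 hk.
    have e3 : (k (pos f l) - b = l - b %[mod f.+1])%N.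
      by apply/eqP; rewrite -(eqn_modDr b) !subnK ?e2; lia.
    by move: e3; rewrite !modn_small; lia.
  exists (fun j => xs (k j)) => j; split=> //.
  have [e0|ne0] := eqVneq (k j) b.
    have jE : j = pos f i.+1.
      by rewrite -(kP j) e0 -[RHS](_ : pos f b = _) // -posb; congr (pos f _); rewrite /b; lia.
    have -> : k (ord_pred j) = i.
      by apply: kuniq; [rewrite /b; lia|rewrite jE pos_pred].
    have [nW xF] := Tm_eq0 (xs_neq0 i) Ti.
    rewrite -jE in nW xF; rewrite /adjacent xF sub0mx /= e0.
    have bS : b = b.-1.+1 by rewrite /b; lia.
    have jb : pos f b.-1.+1 = j by rewrite -bS -e0 kP.
    by rewrite bS xsS jb step_ker // sub0mx.
  have [l le] : exists l, k j = l.+1 by exists (k j).-1; have := kb j; rewrite /b; lia.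
  have -> : k (ord_pred j) = l.
    by apply: kuniq; [have := kb j; lia|rewrite -pos_pred -le kP].
  have jl : pos f l.+1 = j by rewrite -le kP.
  by rewrite le xsS jl; apply: step_adj.
have xsT i : (f < i)%N -> xs i.+1 = Fmap s (Tm (pos f i.+1)) (xs i).
  by move=> fi; rewrite xsS /step; case: eqP => // h; case: noz; exists i.
(* From index [f.+1] on, only [Tm] has been applied and never the replacement, so no iterate of [N]
   annihilates the starting vector. *)
pose u := itm s f.+1; pose N := Bt s Tm f.+1.
have posm l k : pos f (f.+1 * l + k) = pos f k.
  by apply: val_inj; rewrite [LHS]val_pos [RHS]val_pos mulnC modnMDl.
have path l k : xs (f.+1 * l.+1 + k)%N = map_mx (itm s k) (xs (f.+1 * l.+1)%N) *m Bt s Tm k.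
  elim: k => [|k IH]; first by rewrite addn0 map_itm0 mulmx1.
  rewrite addnS xsT; last by rewrite mulnS -addnA ltnS leq_addr.
  by rewrite -addnS posm IH /Fmap map_mxM -map_itmS BtS mulmxA.
have [|||y ny yE] := @lang_fixed_vector u (q ^ f.+1) d N (xs (f.+1 * 1)%N).
- by rewrite -(exp1n f.+1) ltn_exp2r.
- by move=> z; apply: itm_pow.
- move=> l; suff -> : iter l (Fmap u N) (xs (f.+1 * 1)%N) = xs (f.+1 * l.+1)%N by [].
  elim: l => // l IH; rewrite iterS IH [in RHS]mulnS addnC path.
  by [].
pose Y k := map_mx (itm s k) y *m Bt s Tm k.
have YS k : Y k.+1 = Fmap s (Tm (pos f k.+1)) (Y k).
  by rewrite /Y /Fmap map_mxM -map_itmS BtS mulmxA.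
have Yf : Y f.+1 = y by [].
have Y0 : Y 0%N = y by rewrite /Y map_itm0 mulmx1.
have Ynz k : (k <= f.+1)%N -> Y k != 0.
  move=> kf; have : Y (k + (f.+1 - k))%N != 0 by rewrite subnKC // Yf.
  elim: (f.+1 - k)%N => [|m IH]; first by rewrite addn0.
  rewrite addnS YS => h; apply: IH; apply: contra h => /eqP ->.
  by rewrite /Fmap map_mx0 mul0mx.
exists (fun j => Y j) => j; split; first by apply/Ynz/ltnW.
have adjY k : (k <= f)%N -> adjacent (pos f k.+1) (Y k) (Y k.+1).
  by move=> kf; rewrite YS; apply: adjacentT; rewrite -YS Ynz.
clearbody Y; case E: (nat_of_ord j) => [|k].
  have jE : j = pos f f.+1 by rewrite pos_full; apply: val_inj.
  have pE : nat_of_ord (ord_pred j) = f by rewrite jE pos_pred val_pos modn_small.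
  by rewrite pE Y0 -Yf jE; apply: adjY.
have kf : (k <= f)%N by have := ltn_ord j; rewrite E ltnS => /ltnW.
have jE : j = pos f k.+1 by rewrite -E pos_ord.
have pE : nat_of_ord (ord_pred j) = k by rewrite jE pos_pred val_pos modn_small.
by rewrite pE jE; apply: adjY.
Qed.
End Lang.

(** * Intermediate lattices from compatible lines *)

Lemma extend_row (K : fieldType) d (x : 'rV[K]_d) : x != 0 ->
  exists2 U : 'M[K]_d, U \in unitmx & forall i : 'I_d, i = 0%N :> nat -> row i U = x.
Proof.
move=> nx; have fx : row_free x by rewrite /row_free rank_rV nx.
have [n2 [K' [e fK]]] := row_free_complete fx; subst d.
exists (col_mx x K'); first by rewrite -row_full_unit.
move=> i i0; rewrite (_ : i = lshift n2 0); last exact: val_inj.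
by apply/rowP => k; rewrite mxE (@col_mxEu _ 1 n2).
Qed.

Lemma sum_leq_ord (m n : nat) : (m <= n)%N -> \sum_(i < n) (m <= i)%N%:Z = (n - m)%N%:Z.
Proof.
move=> mn; rewrite -(big_mkord xpredT (fun i => (m <= i)%N%:Z)) (@big_cat_nat _ _ _ m) //=.
rewrite big_nat_cond big1 ?add0r => [|i]; last by rewrite andbT => /andP [_]; rewrite ltnNge => /negPf ->.
rewrite (eq_big_nat _ _ (F2 := fun=> 1%:Z)) => [|i /andP [->]] //.
by rewrite sumr_const_nat -[RHS]natz.
Qed.

Section IntermediateLattices.
Variable S : dvr.
Local Notation L := (dvr_field S).
Local Notation v := (@dval S).
Local Notation pi := (unif S).
Hypothesis closedK : forall P : {poly rfield S}, (1 < size P)%N -> exists x, root P x.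
Variables (sg : {rmorphism L -> L}) (s : {rmorphism rfield S -> rfield S}) (q : nat).
Hypothesis fs : frob sg.
Hypothesis sres : forall x, ge_val v x 0 -> res (sg x) = s (res x).
Hypothesis q1 : (1 < q)%N.
Hypothesis sE : forall z, s z = z ^+ q.
Variable f : nat.

Section Blocks.
Variables (m d : nat) (B E : 'I_f.+1 -> 'M[L]_(m + d)).
Hypothesis d0 : (0 < d)%N.
Hypothesis uB : forall j, B j \in unitmx.
Hypothesis uE : forall j, E j \in unitmx.
(** The rows of [E j] form a basis of the upper lattice and those of [De *m E j] one of the lower
    lattice, so the quotient is read on the last [d] coordinates modulo [pi]. [G j] is the matrix of
    [F], [H j] that of [V] up to a Frobenius twist; conjugation by [De] rewrites both on the lower
    lattice. *)
Let De : 'M[L]_(m + d) := zdiag S (fun i => (m <= i)%N%:Z).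
Let G j := map_mx sg (E (ord_pred j)) *m B j *m invmx (E j).
Let H j := pi *: invmx (G j).
Hypothesis hG : forall j, intm (G j).
Hypothesis hH : forall j, intm (H j).
Hypothesis hGD : forall j, intm (De *m G j *m invmx De).
Hypothesis hHD : forall j, intm (De *m H j *m invmx De).

Lemma uG j : G j \in unitmx.
Proof. by rewrite !unitmx_mul map_unitmx unitmx_inv !uE uB. Qed.

Lemma conj_De (A : 'M[L]_(m + d)) : intm (De *m A *m invmx De) -> gem (ursubmx A) 1.
Proof.
move=> h i j; have := h (lshift d i) (rshift m j); rewrite invmx_zdiag mul_zdiagE zdiag_mulE.
rewrite /= leqNgt ltn_ord /= leq_addr expr0z mul1r mulrC ge_unifM opprK add0r.
by rewrite !mxE.
Qed.

Lemma res_rsub (y : 'rV[L]_(m + d)) (A : 'M[L]_(m + d)) : intm y -> intm A -> gem (ursubmx A) 1 ->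
  resm (rsubmx (y *m A)) = resm (rsubmx y) *m resm (drsubmx A).
Proof.
move=> hy hA hA1.
have hl : intm (lsubmx y) by move=> i j; rewrite mxE.
have hr : intm (rsubmx y) by move=> i j; rewrite mxE.
have hd : intm (drsubmx A) by move=> i j; rewrite !mxE.
rewrite -[y in LHS]hsubmxK -[A in LHS]submxK mul_row_block row_mxKr.
have h1 : gem (lsubmx y *m ursubmx A) 1 by apply: intmM.
have h0 : intm (lsubmx y *m ursubmx A) by apply: gemW h1.
have h2 : intm (rsubmx y *m drsubmx A) by apply: intmM.
have r0 : resm (lsubmx y *m ursubmx A) = 0 by apply/resm_eq0.
by rewrite (resmD h0 h2) r0 add0r resmM.
Qed.

Let Fm j := resm (drsubmx (G j)).
Let Wm j := resm (drsubmx (H j)).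

(** The product of the lower right blocks is [pi] minus a product with the upper right block of [C],
    and both terms vanish modulo [pi]. *)
Lemma drsub_mul0 (A C : 'M[L]_(m + d)) : intm A -> intm C -> gem (ursubmx C) 1 ->
  A *m C = pi%:M -> resm (drsubmx A) *m resm (drsubmx C) = 0.
Proof.
move=> hA hC hC1 AC.
have hd1 : intm (drsubmx A) by move=> i j; rewrite !mxE.
have hd2 : intm (drsubmx C) by move=> i j; rewrite !mxE.
have hl : intm (dlsubmx A) by move=> i j; rewrite !mxE.
rewrite -resmM //; apply/resm_eq0; first exact: intmM.
have := AC; rewrite -{1}[A]submxK -{1}[C]submxK mulmx_block scalar_mx_block.
move=> /eq_block_mx [_ _ _ e].
have -> : drsubmx A *m drsubmx C = pi%:M - dlsubmx A *m ursubmx C by rewrite -e addrC addKr.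
apply: gemB; last exact: intmM.
by apply: gem_scalar; rewrite -[pi]expr1z.
Qed.

Lemma FW0 j : Fm j *m Wm j = 0.
Proof.
apply: drsub_mul0 => //; first exact: conj_De.
by rewrite -scalemxAr mulmxV ?uG // scalemx1.
Qed.

Lemma intermediate_blocks : exists X : 'I_f.+1 -> 'M[L]_(m + d), forall j,
  let FX := map_mx sg (X (ord_pred j)) *m B j in
  [/\ X j \in unitmx, intm (De *m E j *m invmx (X j)), intm (X j *m invmx (E j)),
      vdet (X j) = vdet (De *m E j) - 1 &
      intm (FX *m invmx (X j)) /\ intm (pi *: X j *m invmx FX)].
Proof.
have [x hx] := adjacent_lines closedK q1 sE d0 FW0.
have /fin_all_exists [U hU] : forall j, exists U : 'M[L]_d, GLO U /\
    forall i : 'I_d, i = 0%N :> nat -> row i (resm U) = x j.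
  move=> j; have [nx _] := hx j; have [U0 uU0 hU0] := extend_row nx.
  by have [U [gU UE]] := lft_unitmx uU0; exists U; rewrite UE.
(* [T j *m E j] spans the lower lattice together with a lift of [x j]: [D'] keeps the first row of
   [U j], which lifts [x j], and multiplies the others by [pi]. *)
pose D' : 'M[L]_d := zdiag S (fun i : 'I_d => (1 <= i)%N%:Z).
pose T j : 'M[L]_(m + d) := block_mx 1%:M 0 0 (D' *m U j).
have uU j : U j \in unitmx by have [[]] := hU j.
have uD : D' \in unitmx := zdiag_unit S _.
have uT j : T j \in unitmx by rewrite block_unitmx unitmx1 unitmx_mul uD uU.
pose X j := T j *m E j.
have uX j : X j \in unitmx by rewrite unitmx_mul uT uE.
(* Membership in the new lattice: integral coordinates, the last [d] of which reduce into the line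
   of [x j]. Stability under [F] and [V] thereby becomes [adjacent]. *)
have TP j (y : 'rV[L]_(m + d)) : intm (y *m invmx (T j)) <->
    intm y /\ (resm (rsubmx y) <= x j)%MS.
  have [[hU1 _ iU] hU0] := hU j.
  have iT : invmx (T j) = block_mx 1%:M 0 0 (invmx (U j) *m invmx D').
    by rewrite invmx_diag ?unitmx1 ?unitmx_mul ?uD ?uU // invmx1 invmxM.
  have hD : intm D' by apply: zdiag_intm.
  split=> [h|[hy /submxP [al alE]]].
    set c := y *m invmx (T j) in h; have yE : y = c *m T j by rewrite mulmxKV.
    have hr : intm (rsubmx c) by move=> i k; rewrite mxE.
    split.
      rewrite yE; apply: intmM => //; apply/gem_block; split; [exact: intm1|exact: gem0|exact: gem0|].
      exact: intmM.
    rewrite yE -[c]hsubmxK mul_row_block !mulmx0 add0r row_mxKr mulmxA resmM //; last exact: intmM.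
    rewrite mulmx_sum_row; apply: summx_sub => i _.
    have [i0|i0] := posnP i; first by rewrite hU0 // scalemx_sub // submx_refl.
    suff -> : resm (rsubmx c *m D') 0 i = 0 by rewrite scale0r sub0mx.
    rewrite mxE; apply/eqP; rewrite res_eq0; last exact: intmM.
    rewrite mul_zdiagE i0 mulrC ge_unifM subrr; exact: hr.
  have hr : intm (rsubmx y) by move=> i k; rewrite mxE.
  have hl : intm (lsubmx y) by move=> i k; rewrite mxE.
  rewrite iT -[y]hsubmxK mul_row_block !mulmx0 add0r addr0 mulmx1 mulmxA.
  suff h : intm (rsubmx y *m invmx (U j) *m invmx D').
    move=> i k; case: (split_ordP k) => l ->; first by rewrite row_mxEl.
    by rewrite row_mxEr.
  have hyU : intm (rsubmx y *m invmx (U j)) by apply: intmM.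
  move=> i k; rewrite invmx_zdiag mul_zdiagE mulrC ge_unifM opprK add0r ord1.
  have [k0|k0] := posnP k; first exact: hyU.
  rewrite -res_eq0 //; have : resm (rsubmx y *m invmx (U j)) 0 k = 0; last by rewrite mxE => ->.
  have kE : x j *m resm (invmx (U j)) = row (Ordinal d0) 1%:M.
    rewrite -(hU0 (Ordinal d0) erefl) -row_mul -resmM // mulmxV //; first by rewrite resm1.
  rewrite resmM // alE -mulmxA kE rowE mulmx1 mxE big1 // => l _; rewrite !mxE.
  by rewrite (_ : (k == Ordinal d0) = false) ?andbF ?mulr0 //; apply/eqP => e; move: k0; rewrite e.
exists X => j FX; have [[hU1 _ iU] hU0] := hU j; split=> //.
- rewrite /X invmxM // mulmxA mulmxK //.
  apply: intm_rows => i; rewrite row_mul; apply/TP; split.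
    by move=> a b; rewrite mxE; apply: zdiag_intm.
  suff -> : resm (rsubmx (row i De)) = 0 by apply: sub0mx.
  apply/resm_eq0.
    by move=> a b; rewrite !mxE; case: eqP => // _; rewrite mulr1n; apply: geW (ge_unifz _ _); case: leq.
  move=> a b; rewrite !mxE; case: eqP => // ->; rewrite mulr1n /= leq_addr.
  exact: ge_unifz.
- rewrite /X mulmxK //; apply/gem_block; split; [exact: intm1|exact: gem0|exact: gem0|].
  by apply: intmM => //; apply: zdiag_intm.
- have vT : vdet (T j) = (d - 1)%N%:Z.
    have [gU _] := hU j; have u1 : (1%:M : 'M[L]_m) \in unitmx by apply: unitmx1.
    have u2 : D' *m U j \in unitmx by rewrite unitmx_mul uD uU.
    by rewrite (vdet_block _ u1 u2) vdet1 add0r (vdetM uD (uU j)) vdet_zdiag sum_leq_ord // (vdet_GLO gU) addr0.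
  rewrite (vdetM (uT j) (uE j)) vT (vdetM (zdiag_unit S _) (uE j)) vdet_zdiag sum_leq_ord ?leq_addr //.
  rewrite addKn; move: (vdet (E j)) => z; lia.
have [_ /andP [a1 a2]] := hx j.
have FXE : FX = map_mx sg (T (ord_pred j)) *m G j *m E j.
  by rewrite /FX /X map_mxM /G !mulmxA mulmxKV.
have hG1 := conj_De (hGD j); have hH1 := conj_De (hHD j).
have uFT : map_mx sg (T (ord_pred j)) \in unitmx by rewrite map_unitmx.
have rowT k i : intm (row i (T k)) /\ (resm (rsubmx (row i (T k))) <= x k)%MS.
  apply/TP; rewrite -row_mul mulmxV // => a b; rewrite mxE; exact: intm1.
split.
  rewrite FXE /X invmxM // mulmxA mulmxK //.
  apply: intm_rows => i; rewrite !row_mul; apply/TP; rewrite -map_row.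
  have [r1 r2] := rowT (ord_pred j) i; set y := row i _ in r1 r2 *.
  have hsy : intm (map_mx sg y) by apply/frob_gem.
  split; first exact: intmM.
  rewrite res_rsub // -map_rsubmx.
  have -> : resm (map_mx sg (rsubmx y)) = map_mx s (resm (rsubmx y)).
    by apply: resm_frob => // a b; rewrite mxE.
  apply: submx_trans a1; rewrite -/(Fm j); apply: submxMr.
  by rewrite map_submx.
have -> : pi *: X j *m invmx FX = T j *m H j *m invmx (map_mx sg (T (ord_pred j))).
  have uFG : map_mx sg (T (ord_pred j)) *m G j \in unitmx by rewrite unitmx_mul uFT uG.
  rewrite FXE (invmxM uFG (uE j)) (invmxM uFT (uG j)) /X -scalemxAl -[T j *m E j *m _]mulmxA (mulKVmx (uE j)).
  by rewrite /H -scalemxAr -scalemxAl mulmxA.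
apply: intm_rows => i; rewrite !row_mul.
have [r1 r2] := rowT j i; set y := row i _ in r1 r2 *.
have [w wE] := frob_surj (y *m H j) fs.
have hw : intm w by apply/(frob_gem _ _ fs); rewrite wE; apply: intmM.
rewrite -wE -map_invmx -map_mxM; apply/frob_gem => //; apply/TP; split=> //.
rewrite -(map_submx s).
have -> : map_mx s (resm (rsubmx w)) = resm (rsubmx (y *m H j)).
  rewrite -wE -map_rsubmx; symmetry; apply: resm_frob => // a b; by rewrite mxE.
by rewrite res_rsub // -/(Wm j); apply: submx_trans a2; apply: submxMr.
Qed.
End Blocks.

(** [minuscule_smith], applied to the inclusion of [M0 j] in [M1 j], gives bases adapted to both;
    comparing determinants shows that exactly [d] elementary divisors are 1. *)
Lemma intermediate_family n (B : 'I_f.+1 -> 'M[L]_n) (M0 M1 : 'I_f.+1 -> lset L n) (d : nat) :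
  (0 < d)%N -> (forall j, B j \in unitmx) ->
  (forall j, [/\ is_lattice v (M0 j), is_lattice v (M1 j), lsub (M0 j) (M1 j),
     lsub (scl pi (M1 j)) (M0 j) & lat_len v (M0 j) (M1 j) d%:Z]) ->
  (forall M, M = M0 \/ M = M1 -> forall j, let FM := img (Fmap sg (B j)) (M (ord_pred j)) in
     lsub FM (M j) /\ lsub (scl pi (M j)) FM) ->
  exists N : 'I_f.+1 -> lset L n, forall j, let FN := img (Fmap sg (B j)) (N (ord_pred j)) in
    [/\ is_lattice v (N j), lsub (M0 j) (N j), lsub (N j) (M1 j), lat_len v (M0 j) (N j) 1 &
        lsub FN (N j) /\ lsub (scl pi (N j)) FN].
Proof.
move=> d0 uB hM hF.
have /fin_all_exists [E hE] : forall j, exists E : 'M[L]_n, [/\ (d <= n)%N, basis_of E (M1 j) &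
    basis_of (zdiag S (fun i : 'I_n => (n - d <= i)%N%:Z) *m E) (M0 j)].
  move=> j; have [[A0 b0] [A1 b1] h1 h2 h3] := hM j.
  have [u0 _] := b0; have [u1 _] := b1.
  have uC : A0 *m invmx A1 \in unitmx by rewrite unitmx_mul unitmx_inv u0.
  have [||m [U [V [mn gU gV CE]]]] := @minuscule_smith S n (A0 *m invmx A1) uC.
  - exact/(lsubP b0 b1).
  - rewrite invmxM ?unitmx_inv // invmxK scalemxAl.
    exact/(lsubP (basis_of_scl (unif_neq0 S) b1) b0).
  have /(lat_lenP _ b0 b1) e3 := h3.
  have uV := GLO_unit gV; have uU := GLO_unit gU.
  have em : d%:Z = (n - m)%N%:Z.
    rewrite e3; have := congr1 (@vdet S n) CE.
    rewrite !vdetM ?unitmx_mul ?unitmx_inv ?uU ?uV ?zdiag_unit // vdetV // => ->.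
    by rewrite (vdet_GLO gU) (vdet_GLO gV) add0r addr0 vdet_zdiag sum_leq_ord.
  have em' : (n - d = m)%N by lia.
  exists (V *m A1); split; [by lia|exact: basis_of_GLOl|rewrite em'].
  have -> : zdiag S (fun i : 'I_n => (m <= i)%N%:Z) *m (V *m A1) = invmx U *m A0.
    rewrite -[A0](mulmxKV u1) CE !mulmxA mulVmx // mul1mx //.
  by apply: basis_of_GLOl => //; apply: GLO_inv.
have dn : (d <= n)%N by have [] := hE ord0.
have [m en] : exists m, n = (m + d)%N by exists (n - d)%N; rewrite subnK.
subst n; rewrite addnK in hE; clear dn.
have uE j : E j \in unitmx by have [_ []] := hE j.
pose De : 'M[L]_(m + d) := zdiag S (fun i => (m <= i)%N%:Z).
have uDe : De \in unitmx := zdiag_unit S _.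
pose G j := map_mx sg (E (ord_pred j)) *m B j *m invmx (E j).
have [h1 h2] : (forall j, intm (G j) /\ intm (pi *: invmx (G j))) /\
   (forall j, intm (De *m G j *m invmx De) /\ intm (De *m (pi *: invmx (G j)) *m invmx De)).
  split=> j; have [_ b1 b0] := hE j; have [_ b1' b0'] := hE (ord_pred j).
    have uFB : map_mx sg (E (ord_pred j)) *m B j \in unitmx by rewrite unitmx_mul map_unitmx uE uB.
    have [q2 q3] := hF M1 (or_intror erefl) j.
    have bF := basis_of_Fmap fs (uB j) b1'; split; first exact/(lsubP bF b1).
    have /(lsubP (basis_of_scl (unif_neq0 S) b1) bF) := q3.
    by rewrite /G (invmxM uFB) ?unitmx_inv // invmxK scalemxAl.
  have uFB : map_mx sg (E (ord_pred j)) *m B j \in unitmx by rewrite unitmx_mul map_unitmx uE uB.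
  have [q2 q3] := hF M0 (or_introl erefl) j.
  have bF := basis_of_Fmap fs (uB j) b0'; rewrite map_mxM map_zdiag // -mulmxA in bF.
  have /(lsubP bF b0) p2 := q2; have /(lsubP (basis_of_scl (unif_neq0 S) b0) bF) p1 := q3.
  rewrite (invmxM uDe (uE j)) in p2; rewrite (invmxM uDe uFB) in p1; split.
    by rewrite /G !mulmxA in p2 *.
  rewrite /G (invmxM uFB) ?unitmx_inv // invmxK.
  by rewrite -scalemxAr -!scalemxAl !mulmxA in p1 *.
have [X hX] := intermediate_blocks d0 uB uE (fun j => (h1 j).1) (fun j => (h1 j).2)
  (fun j => (h2 j).1) (fun j => (h2 j).2).
exists (fun j => ospan v (X j)) => j FN.
have bX i : basis_of (X i) (ospan v (X i)) by split=> //; have [] := hX i.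
have [uX x1 x2 x3 [x4 x5]] := hX j; have [_ b1 b0] := hE j.
have bF := basis_of_Fmap fs (uB j) (bX (ord_pred j)).
split.
- by exists (X j).
- exact/(lsubP b0 (bX j)).
- exact/(lsubP (bX j) b1).
- by apply/(lat_lenP _ b0 (bX j)); rewrite x3 -/De; move: (vdet _) => z; lia.
- split; first exact/(lsubP bF (bX j)).
  exact/(lsubP (basis_of_scl (unif_neq0 S) (bX j)) bF).
Qed.
End IntermediateLattices.

(** * Shifts of lattices and relative lengths *)

Section LatticeCalculus.
Variable S : dvr.
Local Notation L := (dvr_field S).
Local Notation v := (@dval S).
Local Notation pi := (unif S).
Variable n : nat.
Implicit Types (M N : lset L n) (A : 'M[L]_n).

(* [shl q M] is the lattice [pi^-q M]. *)
Definition shl (q : int) M : lset L n := fun x => M (pi ^ q *: x).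

Lemma sclE c M x : c != 0 -> scl c M x <-> M (c^-1 *: x).
Proof.
move=> nc; split=> [[y [My ->]]|h]; first by rewrite scalerA mulVf // scale1r.
by exists (c^-1 *: x); rewrite scalerA mulfV // scale1r.
Qed.

Lemma scl_shl q M x : scl pi^-1 (shl q M) x <-> shl (q + 1) M x.
Proof.
by rewrite sclE ?invr_eq0 ?unif_neq0 // invrK /shl scalerA expfzDr ?unif_neq0 // expr1z.
Qed.

Lemma basis_of_shl q A M : basis_of A M -> basis_of (pi ^ (- q) *: A) (shl q M).
Proof.
move=> bA; have [u h] := basis_of_scl (unifz_neq0 S (- q)) bA; split=> // x.
by rewrite -h sclE ?unifz_neq0 // invr_expz opprK.
Qed.

Lemma basis_of_ext A M N : (forall x, M x <-> N x) -> basis_of A M -> basis_of A N.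
Proof. by move=> e [u h]; split=> // x; rewrite -e. Qed.

Lemma is_lattice_shl q M : is_lattice v M -> is_lattice v (shl q M).
Proof. by move=> [A /(basis_of_shl q) h]; exists (pi ^ (- q) *: A). Qed.

Lemma lat_len_basis M N k : lat_len v M N k <->
  exists A B, [/\ basis_of A M, basis_of B N & k = vdet A - vdet B].
Proof.
split=> [[A [B [uA uB hA hB e]]]|[A [B [[uA hA] [uB hB] e]]]]; exists A, B; split=> //.
Qed.

Lemma lat_len_trans M1 M2 M3 k l : lat_len v M1 M2 k -> lat_len v M2 M3 l ->
  lat_len v M1 M3 (k + l).
Proof.
move=> /lat_len_basis [A [B [bA bB ->]]] /lat_len_basis [B' [C [bB' bC ->]]].
apply/lat_len_basis; exists A, C; split=> //.
by rewrite (basis_of_vdet bB bB') addrA subrK.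
Qed.

Lemma lat_len_diff M1 M2 M3 k l : lat_len v M1 M2 k -> lat_len v M1 M3 l ->
  lat_len v M2 M3 (l - k).
Proof.
move=> /lat_len_basis [A [B [bA bB ->]]] /lat_len_basis [A' [C [bA' bC ->]]].
apply/lat_len_basis; exists B, C; split=> //.
by rewrite (basis_of_vdet bA bA'); move: (vdet _) (vdet _) (vdet _) => x y z; lia.
Qed.

Lemma lat_len_refl M : is_lattice v M -> lat_len v M M 0.
Proof. by move=> [A h]; apply/lat_len_basis; exists A, A; rewrite subrr. Qed.

Lemma lat_len_shl q M N k : lat_len v M N k -> lat_len v (shl q M) (shl q N) k.
Proof.
move=> /lat_len_basis [A [B [bA bB ->]]]; apply/lat_len_basis.
exists (pi ^ (- q) *: A), (pi ^ (- q) *: B); split; try exact: basis_of_shl.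
have [uA _] := bA; have [uB _] := bB.
by rewrite !vdet_scale ?unifz_neq0 // opprD addrACA subrr add0r.
Qed.

Lemma lat_len_shl_shl q r M : is_lattice v M -> lat_len v (shl q M) (shl r M) ((r - q) * n%:Z).
Proof.
move=> [A bA]; have [uA _] := bA; apply/lat_len_basis.
exists (pi ^ (- q) *: A), (pi ^ (- r) *: A); split; try exact: basis_of_shl.
rewrite !vdet_scale ?unifz_neq0 // !dval_unifz -[_ *+ n]mulr_natr -[(- r) *+ n]mulr_natr natz.
by move: (vdet A) => z; lia.
Qed.

Lemma lat_len_ext M M' N N' k : (forall x, M x <-> M' x) -> (forall x, N x <-> N' x) ->
  lat_len v M N k -> lat_len v M' N' k.
Proof.
move=> e1 e2 /lat_len_basis [A [B [bA bB ->]]]; apply/lat_len_basis; exists A, B; split=> //.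
  exact: basis_of_ext bA.
exact: basis_of_ext bB.
Qed.

Lemma lsub_shl q M N : lsub M N -> lsub (shl q M) (shl q N).
Proof. by move=> h x; apply: h. Qed.

Lemma lattice_scale M c x : is_lattice v M -> ge_val v c 0 -> M x -> M (c *: x).
Proof.
move=> [A [uA h]] hc /h [d [hd ->]]; apply/h; exists (c *: d); rewrite scalemxAl; split=> // k.
by rewrite mxE; have := geM hc (hd k); rewrite addr0.
Qed.

Lemma lsub_shl_shl q r M : is_lattice v M -> q <= r -> lsub (shl q M) (shl r M).
Proof.
move=> lM qr x hx; rewrite /shl (_ : r = (r - q) + q); last by rewrite subrK.
rewrite expfzDr ?unif_neq0 // -scalerA; apply: lattice_scale => //.
by apply: geW (ge_unifz S _); rewrite subr_ge0.
Qed.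

Section Fmap.
Variables (sg : {rmorphism L -> L}) (B : 'M[L]_n).
Hypothesis fs : frob sg.
Hypothesis uB : B \in unitmx.

Lemma lat_len_Fmap M N k : lat_len v M N k ->
  lat_len v (img (Fmap sg B) M) (img (Fmap sg B) N) k.
Proof.
move=> /lat_len_basis [A [C [bA bC ->]]]; apply/lat_len_basis.
exists (map_mx sg A *m B), (map_mx sg C *m B); split; try exact: basis_of_Fmap.
have [uA _] := bA; have [uC _] := bC.
by rewrite !vdetM ?map_unitmx // !frob_vdet // opprD addrACA subrr addr0.
Qed.

Lemma img_shl q M x : img (Fmap sg B) (shl q M) x <-> shl q (img (Fmap sg B) M) x.
Proof.
have FZ c y : sg c = c -> Fmap sg B (c *: y) = c *: Fmap sg B y.
  by move=> sc; rewrite /Fmap map_mxZ /= sc scalemxAl.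
split=> [[y [My ->]]|[y [My e]]].
  by exists (pi ^ q *: y); rewrite FZ // frob_unifz.
exists (pi ^ (- q) *: y); rewrite /shl scalerA -expfzDr ?unif_neq0 // subrr expr0z scale1r.
split=> //; rewrite FZ ?frob_unifz // -e scalerA -expfzDr ?unif_neq0 // addNr expr0z.
by rewrite scale1r.
Qed.

Lemma Fcond_shl q M N (k : int) :
  (let FM := img (Fmap sg B) M in [/\ lsub FM N, lsub (scl pi N) FM & lat_len v FM N k]) ->
  let FM := img (Fmap sg B) (shl q M) in
  [/\ lsub FM (shl q N), lsub (scl pi (shl q N)) FM & lat_len v FM (shl q N) k].
Proof.
move=> /= [h1 h2 h3]; split.
- by move=> x /img_shl; apply: lsub_shl.
- move=> x hx; apply/img_shl; apply: h2; move: hx; rewrite !sclE ?unif_neq0 // /shl.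
  by rewrite !scalerA mulrC.
- apply: lat_len_ext (lat_len_shl q h3) => // x; exact: iff_sym (img_shl _ _ _).
Qed.
End Fmap.
End LatticeCalculus.

(** * Periodic lattice chains *)

Section Chains.
Variable S : dvr.
Local Notation L := (dvr_field S).
Local Notation v := (@dval S).
Local Notation pi := (unif S).
Variable n : nat.
Local Notation N1 := (n.+1%:Z).

Definition om (i : int) : 'I_n.+1 := inord `|(i %% N1)%Z|%N.

Lemma omE i : (om i : nat)%:Z = (i %% N1)%Z.
Proof.
have h0 : 0 <= (i %% N1)%Z by rewrite modz_ge0.
have h1 : (i %% N1)%Z < N1 by rewrite ltz_pmod.
by rewrite /om inordK ?gez0_abs //; lia.
Qed.

Lemma inIE (Ib : {set 'I_n.+1}) i : inI Ib i <-> om i \in Ib.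
Proof.
split=> [[k kI e]|h]; last by exists (om i) => //; rewrite omE.
by rewrite (_ : om i = k) //; apply/val_inj/eqP; rewrite -eqz_nat omE e.
Qed.

Lemma om_shift i k : om (i + k * N1) = om i.
Proof. by apply/val_inj/eqP; rewrite -eqz_nat !omE addrC modzMDl. Qed.

Lemma om_eq i i' : om i = om i' -> i = i' + ((i - i') %/ N1)%Z * N1.
Proof.
move/(congr1 (fun k : 'I_n.+1 => (k : nat)%:Z)); rewrite !omE => e.
have d : (N1 %| i - i')%Z by rewrite -eqz_mod_dvd e.
by rewrite (divzK d) addrC subrK.
Qed.

Lemma om_ord (k : 'I_n.+1) : om (k : nat)%:Z = k.
Proof. by apply/val_inj/eqP; rewrite -eqz_nat omE modz_small //=; have := ltn_ord k; lia. Qed.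

(** A non-empty set of residues stable under adding 1 contains all of them. *)
Lemma om_gap (Jb : {set 'I_n.+1}) : Jb != set0 -> Jb != setT ->
  exists i, om i \in Jb /\ om (i + 1) \notin Jb.
Proof.
move=> /set0Pn [k kJ] nT; apply: NNPP => h.
have step i : om i \in Jb -> om (i + 1) \in Jb.
  by move=> iJ; apply: contraT => h'; exfalso; apply: h; exists i.
have all (l : nat) : om ((k : nat)%:Z + l%:Z) \in Jb.
  elim: l => [|l IH]; first by rewrite addr0 om_ord.
  by have := step _ IH; rewrite -addrA -[l%:Z + 1]/(l + 1)%N%:Z addn1.
case/negP: nT; apply/eqP/setP => t; rewrite inE.
have := all (t + (n.+1 - k))%N; rewrite -PoszD addnCA subnKC; last exact: ltnW.
by rewrite PoszD -[Posz n.+1]mul1r om_shift om_ord.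
Qed.

Variables (Jb : {set 'I_n.+1}).
Variable M : int -> lset L n.+1.
Hypothesis chM : periodic_chain v pi Jb M.

Lemma chain_lattice i : om i \in Jb -> is_lattice v (M i).
Proof. by move/inIE; case: chM => h _ _; apply: h. Qed.

Lemma chain_sub i i' : om i \in Jb -> om i' \in Jb -> i <= i' ->
  lsub (M i) (M i') /\ lat_len v (M i) (M i') (i' - i).
Proof.
move=> hi hi'; rewrite le_eqVlt => /orP [/eqP <-|lt].
  by rewrite subrr; split=> //; apply/lat_len_refl/chain_lattice.
by case: chM => _ h _; apply: h => //; apply/inIE.
Qed.

Lemma chain_shift i k x : om i \in Jb -> M (i + k * N1) x <-> shl k (M i) x.
Proof.
have per i' x' : om i' \in Jb -> M (i' + N1) x' <-> M i' (pi *: x').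
  move=> /inIE hi; case: chM => _ _ h; rewrite h // sclE ?invr_eq0 ?unif_neq0 //.
  by rewrite invrK.
have pos l i' x' : om i' \in Jb -> M (i' + l%:Z * N1) x' <-> shl l%:Z (M i') x'.
  elim: l x' => [|l IH] x' hi; first by rewrite mul0r addr0 /shl expr0z scale1r.
  rewrite (_ : i' + l.+1%:Z * N1 = i' + l%:Z * N1 + N1); last by lia.
  by rewrite per ?om_shift // IH // /shl scalerA -exprnP -exprSr.
move=> hi; case: k => l; first exact: pos.
rewrite NegzE mulNr; set j := i - _.
have ij : i = j + l.+1%:Z * N1 by rewrite /j subrK.
have hj : om j \in Jb by rewrite -(om_shift j l.+1%:Z) -ij.
rewrite /shl {1}ij pos // /shl scalerA -expfzDr ?unif_neq0 // subrr expr0z scale1r.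
by [].
Qed.

End Chains.

Section SingletonChain.
Variable S : dvr.
Local Notation L := (dvr_field S).
Local Notation v := (@dval S).
Local Notation pi := (unif S).
Variables (sg : {rmorphism L -> L}) (n f : nat) (r : 'I_f.+1 -> nat) (B : 'I_f.+1 -> 'M[L]_n.+1).
Hypothesis fs : frob sg.
Local Notation N1 := (n.+1%:Z).
Local Notation Xset := (Xset v sg pi r B).

Lemma Xset_sub (Ib Jb : {set 'I_n.+1}) Mt : Ib \subset Jb -> Xset Jb Mt -> Xset Ib Mt.
Proof.
move=> /subsetP sIJ [ch fc].
have inIJ i : inI Ib i -> inI Jb i by move=> [k /sIJ kJ e]; exists k.
split=> [j|i /inIJ]; last exact: fc.
have [h1 h2 h3] := ch j; split=> [i /inIJ|i i' /inIJ hi /inIJ|i /inIJ]; auto.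
Qed.

Lemma singleton_chain (k : 'I_n.+1) (M : 'I_f.+1 -> lset L n.+1) :
  (forall j, is_lattice v (M j)) ->
  (forall j, let FM := img (Fmap sg (B j)) (M (ord_pred j)) in
    [/\ lsub FM (M j), lsub (scl pi (M j)) FM & lat_len v FM (M j) (r j)%:Z]) ->
  exists Mt, Xset [set k] Mt.
Proof.
move=> lat fc; pose qi i := ((i - (k : nat)%:Z) %/ N1)%Z.
have qE i : inI [set k] i -> i = (k : nat)%:Z + qi i * N1.
  by move=> /inIE; rewrite inE => /eqP e; apply: om_eq; rewrite om_ord.
exists (fun i j => shl (qi i) (M j)); split=> [j|i Ji j]; last exact: Fcond_shl.
split.
- by move=> i _; apply: is_lattice_shl.
- move=> i i' Ji Ji' lt; have e := qE _ Ji; have e' := qE _ Ji'.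
  have le : qi i < qi i' by move: lt; rewrite {1}e {1}e'; nia.
  split; first by apply: lsub_shl_shl => //; apply: ltW.
  rewrite (_ : i' - i = (qi i' - qi i) * N1); first exact: lat_len_shl_shl.
  by rewrite {1}e {1}e'; lia.
- move=> i Ji x; rewrite scl_shl (_ : qi (i + N1) = qi i + 1) //.
  by rewrite /qi addrAC -{1}[N1]mul1r divzDr ?dvdz_mull // mulzK.
Qed.
End SingletonChain.

(** * Filling up a chain *)

Section ExtendStep.
Variable S : dvr.
Local Notation L := (dvr_field S).
Local Notation v := (@dval S).
Local Notation pi := (unif S).
Hypothesis closedK : forall P : {poly rfield S}, (1 < size P)%N -> exists x, root P x.
Variables (sg : {rmorphism L -> L}) (s : {rmorphism rfield S -> rfield S}) (q : nat).
Hypothesis fs : frob sg.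
Hypothesis sres : forall x, ge_val v x 0 -> res (sg x) = s (res x).
Hypothesis q1 : (1 < q)%N.
Hypothesis sE : forall z, s z = z ^+ q.
Variables (n f : nat) (r : 'I_f.+1 -> nat) (B : 'I_f.+1 -> 'M[L]_n.+1).
Hypothesis uB : forall j, B j \in unitmx.
Local Notation N1 := (n.+1%:Z).
Local Notation Xset := (Xset v sg pi r B).
Local Notation om := (om n).

(** The index [i0 + 1] is filled together with its translates by multiples of [n.+1], between [i0]
    and the next index [i0 + d] of the chain. The condition on dimensions is inherited from [i0],
    because [N j] over [M0 j] and its image under [F] both have length 1. *)
Lemma extend_step (Jb : {set 'I_n.+1}) Mt : Jb != set0 -> Jb != setT -> Xset Jb Mt ->
  exists t Mt', [/\ t \notin Jb, Xset (t |: Jb) Mt' &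
    forall i, inI Jb i -> forall j x, Mt' i j x <-> Mt i j x].
Proof.
move=> n0 nT [ch fc]; have [i0 [i0J i1J]] := om_gap n0 nT.
set t := om (i0 + 1) in i1J.
have ex : exists k : nat, (0 < k)%N && (om (i0 + k%:Z) \in Jb).
  by exists n.+1; rewrite -[Posz n.+1]mul1r om_shift i0J.
case: (ex_minnP ex) => d /andP [d0 dJ] dmin.
have dn : (d <= n.+1)%N by apply: dmin; rewrite -[Posz n.+1]mul1r om_shift i0J.
have {}fc i : om i \in Jb -> forall j, let FM := img (Fmap sg (B j)) (Mt i (ord_pred j)) in
    [/\ lsub FM (Mt i j), lsub (scl pi (Mt i j)) FM & lat_len v FM (Mt i j) (r j)%:Z].
  by move=> iJ; apply: fc; apply/inIE.
have lat i j (hi : om i \in Jb) := chain_lattice (ch j) hi.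
have sub i i' j (hi : om i \in Jb) (hi' : om i' \in Jb) (le : i <= i') := chain_sub (ch j) hi hi' le.
have shift i k j x (hi : om i \in Jb) := chain_shift (ch j) k x hi.
pose M0 j := Mt i0 j; pose M1 j := Mt (i0 + d%:Z) j.
have [j|M hM j|N hN] := @intermediate_family S closedK sg s q fs sres q1 sE f n.+1 B M0 M1 d d0 uB.
- have i0d : i0 <= i0 + d%:Z by lia.
  have [h1 h2] := sub _ _ j i0J dJ i0d; split; [exact: lat|exact: lat|exact: h1| |].
    (* As [d <= n.+1], the lattice at [i0 + d] lies in the one at [i0 + n.+1], which is [pi^-1]
       times the lattice at [i0]. *)
    have i0n : om (i0 + 1 * N1) \in Jb by rewrite om_shift.
    have [|h3 _] := sub _ _ j dJ i0n; first by lia.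
    move=> x [y [/h3 hy ->]]; have /shift := hy; rewrite /shl expr1z; exact.
  have e : i0 + d%:Z - i0 = d%:Z by lia.
  by rewrite e in h2.
- by case: hM => ->; [have [] := fc i0 i0J j|have [] := fc _ dJ j].
pose qi i := ((i - (i0 + 1)) %/ N1)%Z.
have qE i : om i = t -> i = i0 + 1 + qi i * N1 by apply: om_eq.
pose Mt' i j := if om i == t then shl (qi i) (N j) else Mt i j.
have old i j : om i \in Jb -> Mt' i j = Mt i j.
  by move=> iJ; rewrite /Mt'; case: eqP => // e; rewrite -e iJ in i1J.
have new i j : om i = t -> Mt' i j = shl (qi i) (N j) by move=> e; rewrite /Mt' e eqxx.
have J'P i : inI (t |: Jb) i <-> om i = t \/ om i \in Jb.
  by rewrite inIE !inE; split=> [/orP [/eqP|]|[->|->]]; rewrite ?eqxx ?orbT; auto.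
(* [lo i] and [hi i] are the nearest old indices around [i], equal to [i] when [i] is old;
   inclusions and lengths are deduced through them. *)
pose lo i := if om i == t then i0 + qi i * N1 else i.
pose hi i := if om i == t then i0 + d%:Z + qi i * N1 else i.
have loJ i : inI (t |: Jb) i -> om (lo i) \in Jb.
  by move=> /J'P; rewrite /lo; case: eqP => [_ _|ne [|//]]; rewrite ?om_shift.
have hiJ i : inI (t |: Jb) i -> om (hi i) \in Jb.
  by move=> /J'P; rewrite /hi; case: eqP => [_ _|ne [|//]]; rewrite ?om_shift.
have lohi i : lo i <= i <= hi i.
  rewrite /lo /hi; case: eqP => [/qE e|_]; last by rewrite lexx.
  by rewrite {2 3}e; apply/andP; split; lia.
have hilo i i' : inI (t |: Jb) i -> inI (t |: Jb) i' -> i < i' -> hi i <= lo i'.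
  move=> Ji Ji' lt; rewrite /hi /lo; case: eqP => [/qE e|ne]; case: eqP => [/qE e'|ne'].
  - have : qi i < qi i' by move: lt; rewrite {1}e {1}e'; nia.
    by nia.
  (* By minimality of [d], no old index lies strictly between the two old neighbours of a new
     one. *)
  - rewrite leNgt; apply/negP => lt'.
    have k0 : 0 < i' - (i0 + qi i * N1) by lia.
    have := dmin (absz (i' - (i0 + qi i * N1))%R); rewrite absz_gt0 gt_eqF // gez0_abs ?ltW //=.
    rewrite (_ : i0 + (i' - (i0 + qi i * N1)) = i' + (- qi i) * N1) ?om_shift; last by lia.
    have [//|-> /(_ isT)] := (J'P i').1 Ji'.
    by lia.
  - by lia.
  - exact: ltW.
have loP i j : inI (t |: Jb) i -> lsub (Mt (lo i) j) (Mt' i j) /\ lat_len v (Mt (lo i) j) (Mt' i j) (i - lo i).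
  move=> Ji; rewrite /lo; case: eqP => [e|ne].
    have [_ h1 _ h2 _] := hN j; rewrite (new _ _ e).
    have sh x : shl (qi i) (M0 j) x <-> Mt (i0 + qi i * N1) j x by rewrite shift.
    split; first by move=> x /sh hx; apply: h1.
    have -> : i - (i0 + qi i * N1) = 1 by rewrite {1}(qE _ e); lia.
    exact: lat_len_ext sh (fun=> iff_refl _) (lat_len_shl _ h2).
  have [//|iJ] := (J'P i).1 Ji; rewrite old // subrr; split=> //.
  exact/lat_len_refl/lat.
have hiP i j : inI (t |: Jb) i -> lsub (Mt' i j) (Mt (hi i) j).
  move=> Ji; rewrite /hi; case: eqP => [e|ne].
    have [_ _ h1 _ _] := hN j; rewrite (new _ _ e) => x hx.
    by apply/(shift _ _ _ _ dJ); apply: h1.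
  by have [//|iJ] := (J'P i).1 Ji; rewrite old.
exists t, Mt'; split=> //; last by move=> i /inIE iJ j x; rewrite old.
split=> [j|i Ji j].
  split.
  - move=> i Ji; have [e|iJ] := (J'P i).1 Ji; last by rewrite old //; apply: lat.
    by rewrite new //; apply: is_lattice_shl; have [] := hN j.
  - move=> i i' Ji Ji' lt; have hl := hilo _ _ Ji Ji' lt.
    have [s1 l1] := loP _ j Ji; have [s2 l2] := loP _ j Ji'.
    split.
      have [s3 _] := sub _ _ j (hiJ _ Ji) (loJ _ Ji') hl.
      by move=> x /(hiP _ _ Ji) /s3 /s2.
    have [|_ l3] := sub _ _ j (loJ _ Ji) (loJ _ Ji').
      have /andP [a1 a2] := lohi i; exact: le_trans a1 (le_trans a2 hl).
    have := lat_len_diff l1 (lat_len_trans l3 l2).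
    by rewrite (_ : _ - (i - lo i) = i' - i) //; lia.
  - move=> i Ji x; have [e|iJ] := (J'P i).1 Ji.
      have e' : om (i + N1) = t by rewrite -[N1]mul1r om_shift.
      rewrite !new // scl_shl (_ : qi (i + N1) = qi i + 1) //.
      by rewrite /qi addrAC -{1}[N1]mul1r divzDr ?dvdz_mull // mulzK.
    have iJ' : om (i + N1) \in Jb by rewrite -[N1]mul1r om_shift.
    by rewrite !old //; have [_ _ h] := ch j; apply: h; apply/inIE.
have [e|iJ] := (J'P i).1 Ji; last by rewrite /= !old //; apply: fc.
rewrite /= !(new _ _ e); apply: Fcond_shl => //.
have [_ _ _ l1 [h1 h2]] := hN j; have [_ _ _ l2 _] := hN (ord_pred j).
split=> //; have [_ _ l3] := fc _ i0J j.
have l4 := lat_len_Fmap fs (uB j) l2.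
have := lat_len_diff l4 (lat_len_trans l3 l1).
by rewrite addrK.
Qed.

(** Going up to the full index set settles every larger type at once, by restriction ([Xset_sub]);
    the number of missing residues decreases at each insertion. *)
Lemma extend_chain (Jb : {set 'I_n.+1}) Mt : Jb != set0 -> Xset Jb Mt ->
  exists Mt', Xset setT Mt' /\ forall i, inI Jb i -> forall j x, Mt' i j x <-> Mt i j x.
Proof.
have [k] := ubnP #|~: Jb|; elim: k Jb Mt => // k IH Jb Mt lt n0 hX.
have [e|nT] := eqVneq Jb setT; first by exists Mt; rewrite -e.
have [t [Mt1 [tJ h1 h2]]] := extend_step n0 nT hX.
have [|||Mt2 [h3 h4]] := IH (t |: Jb) Mt1 => //.
- have := cardsC Jb; have := cardsC (t |: Jb); rewrite cardsU1 tJ; lia.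
- by apply/set0Pn; exists t; rewrite !inE eqxx.
exists Mt2; split=> // i Ji j x; rewrite h4 ?h2 //.
by move/inIE: Ji => Ji; apply/inIE; rewrite !inE Ji orbT.
Qed.
End ExtendStep.

(** * Algebraic closedness of the residue field and the conclusion *)

Section ResidueClosed.
Variable S : dvr.
Local Notation L := (dvr_field S).
Local Notation v := (@dval S).

Lemma resX (x : L) k : ge_val v x 0 -> res (x ^+ k) = res x ^+ k.
Proof.
move=> hx; elim: k => [|k IH]; first by rewrite !expr0 res1.
by rewrite !exprS resM ?IH // geX.
Qed.

(** After normalisation the leading coefficient is lifted to 1 by hand, since [lft 1] may differ
    from 1 and the hypothesis concerns monic polynomials. *)
Lemma residue_closed :
  (forall P : {poly L}, P \is monic -> (1 < size P)%N -> (forall i, ge_val v P`_i 0) ->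
     exists x, ge_val v x 0 /\ ge_val v P.[x] 1) ->
  forall P : {poly rfield S}, (1 < size P)%N -> exists x, root P x.
Proof.
move=> cl P sP; have nP : P != 0 by rewrite -size_poly_gt0 ltnW.
pose P1 := (lead_coef P)^-1 *: P; pose m := (size P).-1.
have nl : lead_coef P != 0 by rewrite lead_coef_eq0.
pose Q : {poly L} := \poly_(i < m.+1) (if (i == m)%N then 1 else lft P1`_i).
have Qm : Q`_m = 1 by rewrite coef_poly ltnSn eqxx.
have sQ : size Q = m.+1 by rewrite size_poly_eq // eqxx oner_neq0.
have Qint i : ge_val v Q`_i 0.
  rewrite coef_poly; case: ifP => // _; case: ifP => // _; exact: lft_intg.
have Qres i : (i < m.+1)%N -> res Q`_i = P1`_i.
  move=> im; rewrite coef_poly im; case: eqP => [->|_]; last exact: lftK.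
  by rewrite res1 coefZ -[P`_m]/(lead_coef P) mulVf.
have [|||x [hx Px]] := cl Q => //.
- by rewrite monicE lead_coefE sQ /= Qm.
- by rewrite sQ /m; lia.
exists (res x); have hxk k : ge_val v (x ^+ k) 0 by apply: geX.
have hterm i : ge_val v (Q`_i * x ^+ i) 0 by have := geM (Qint i) (hxk i); rewrite addr0.
have P1x : P1.[res x] = 0.
  have sP1 : size P1 = m.+1 by rewrite size_scale ?invr_eq0 // prednK // ltnW.
  rewrite horner_coef sP1.
  have hQ : ge_val v Q.[x] 0 by apply: geW Px.
  have : res Q.[x] == 0 by rewrite res_eq0.
  rewrite horner_coef sQ res_sum // => /eqP e; rewrite -[RHS]e; apply: eq_bigr => i _.
  by rewrite resM // resX // Qres.
move: P1x; rewrite hornerZ => /eqP; rewrite mulf_eq0 invr_eq0 (negPf nl) /=.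
by rewrite /root.
Qed.
End ResidueClosed.

Theorem theorem7p1 (L : fieldType) (v : L -> int) (sigma : {rmorphism L -> L})
  (pi : L) (p a : nat) (f n : nat) (hf : (0 < f)%N) (r : 'I_f -> nat)
  (B : 'I_f -> 'M[L]_n) :
  local_setup v sigma pi p a ->
  (forall j, (r j <= n)%N) ->
  (forall j, B j \in unitmx) ->
  (forall Ib : {set 'I_n}, Ib != set0 ->
     (exists Mt, Xset v sigma pi r B Ib Mt) <->
     in_BGmu v sigma pi r B (Ordinal hf)) /\
  (forall Ib Jb : {set 'I_n}, Jb != set0 -> Jb \subset Ib ->
     forall Mt, Xset v sigma pi r B Jb Mt ->
     exists Mt', Xset v sigma pi r B Ib Mt' /\
       forall i, inI Jb i -> forall j x, Mt' i j x <-> Mt i j x).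
Proof.
move=> [[vM [vD [pi0 vpi]]] cpl [[_ [pp _]] [_ cl]] [a0 bs vs sq spi]] rn uB.
have [k [rs [lf [h1 h2 h3 h4 h5]]]] := residue_field_exists vM vD.
pose S := @Dvr L v pi k rs lf vM vD pi0 vpi cpl h1 h2 h3 h4 (fun t => (h5 t).1) (fun t => (h5 t).2).
have fs : @frob S sigma by split.
have closedK := @residue_closed S cl.
have [s sres] := frob_res fs.
have q1 : (1 < p ^ a)%N by rewrite -(exp1n a) ltn_exp2r ?prime_gt1.
(* The Frobenius condition on [sigma] makes the induced map the power map of exponent [p ^ a], the
   form in which Lang's theorem is applied. *)
have sE z : s z = z ^+ (p ^ a).
  rewrite -[z](@lftK S) -sres ?lft_intg // -resX ?lft_intg //; apply/eqP.
  rewrite res_eq ?frob_ge ?geX ?lft_intg //; exact: sq (lft_intg z).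
case: f hf r B rn uB => // f hf r B rn uB; rewrite (_ : Ordinal hf = ord0); last exact: val_inj.
case: n B rn uB => [|n] B rn uB.
  (* For [n = 0] there is no non-empty set of indices. *)
  by split=> [Ib /set0Pn [[]]|Ib Jb /set0Pn [[]]].
have ext := @extend_chain S closedK sigma s (p ^ a) fs sres q1 sE n f r B uB.
split=> [Ib nI|Ib Jb nJ sJI Mt hX]; last first.
  have [Mt' [h h']] := ext Jb Mt nJ hX; exists Mt'; split=> //.
  exact: (@Xset_sub S sigma n f r B Ib setT Mt' (subsetT _) h).
have /set0Pn [i iI] := nI; split=> [[Mt [ch fc]]|hB].
  have iI' : inI Ib (i : nat)%:Z by apply/inIE; rewrite om_ord.
  apply: (@mazur_inequality S sigma n.+1 f r B (fun j => Mt (i : nat)%:Z j)) => //.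
    by move=> j; have [h _ _] := ch j; apply: h.
  by move=> j; apply: fc.
have [X hX] := @lattice_family_exists S sigma n.+1 f r B fs uB rn hB.
have [||Mt hMt] := @singleton_chain S sigma n f r B fs i (fun j => ospan v (X j)).
- by move=> j; exists (X j); have [u _] := hX j.
- by move=> j; have [_ h] := hX j.
(* The chain of type [[set i]] is filled up to a full one, then restricted to [Ib]. *)
have [|Mt' [h _]] := ext [set i] Mt _ hMt; first by apply/set0Pn; exists i; rewrite inE.
exists Mt'; exact: (@Xset_sub S sigma n f r B Ib setT Mt' (subsetT _) h).
Qed.
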